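(* Let $n\ge1$ be an integer and let $L_0\in\operatorname{GL}_{2d}(\mathbb{R})$ be such that $|\det L_0|=n$. If $g_1,\dots,g_n\in\mathcal{E}_{L_0}(\mathbb{R}^d)$, then $\mathcal{G}(g_1,\dots,g_n,L_0)$ cannot be a multi-window Gabor frame for $L^2(\mathbb{R}^d)$.
   Context: Fix $d\ge1$. For $z=(x,\omega)\in\mathbb{R}^{2d}$, $(\pi(z)f)(t)=e^{2\pi i\,t\cdot\omega}f(t-x)$ on $L^2(\mathbb{R}^d)$. For $g_1,\dots,g_n\in L^2(\mathbb{R}^d)$ and $L\in\operatorname{GL}_{2d}(\mathbb{R})$, $\mathcal{G}(g_1,\dots,g_n,L)=\bigcup_{i=1}^n\{\pi(Lk)g_i:k\in\mathbb{Z}^{2d}\}$ (as a family indexed by $(i,k)$); it is a multi-window Gabor frame if there are $A,B>0$ with $A\|f\|_2^2\le\sum_{i=1}^n\sum_k|\langle f,\pi(Lk)g_i\rangle|^2\le B\|f\|_2^2$ for all $f\in L^2(\mathbb{R}^d)$. For a single $g$, write $\mathcal{G}(g,L)$; $B>0$ is a Bessel bound for it if $\sum_k|\langle f,\pi(Lk)g\rangle|^2\le B\|f\|_2^2$ for all $f$. Put $\phi(t)=e^{-\pi\|t\|^2}$, $\mathcal{V}_\phi f(z)=\langle f,\pi(z)\phi\rangle_2$, $\nu(z)=1+\sum_i|z_i|$, $M^1_\nu(\mathbb{R}^d)=\{f\in L^2(\mathbb{R}^d):\mathcal{V}_\phi f\cdot\nu\in L^1(\mathbb{R}^{2d})\}$.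 The Heisenberg module $\mathcal{E}_L(\mathbb{R}^d)\subseteq L^2(\mathbb{R}^d)$ is the completion of $M^1_\nu(\mathbb{R}^d)$, realized inside $L^2(\mathbb{R}^d)$ (the embedding into $L^2(\mathbb{R}^d)$ being continuous), in the norm $\|f\|_{\mathcal{E}_L(\mathbb{R}^d)}=\inf\{C^{1/2}:C\text{ is a Bessel bound for }\mathcal{G}(f,L)\}$. *)

(* Defs.v *)
(* L^2(R^d) is represented by square-integrable functions, not by classes
   modulo a.e. equality; every predicate below only depends on the class.
   Measurability is Borel measurability, so each class has a representative. *)
From HB Require Import structures.
From mathcomp Require Import all_boot all_order all_algebra.
From mathcomp Require Import all_classical all_reals all_analysis.
From mathcomp.real_closed Require Import complex.

Set Implicit Arguments.
Unset Strict Implicit.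
Unset Printing Implicit Defensive.

Import Order.TTheory GRing.Theory Num.Theory.
Import numFieldNormedType.Exports.
Import Normc.

Local Open Scope classical_set_scope.
Local Open Scope ring_scope.
Local Open Scope complex_scope.

Notation Euclidean R n := (n.-tuple (measurableTypeR R)).

Section lebesgue_measure_Euclidean.
Context (R : realType).

Section cons.
Context (n : nat) (mu : {sigma_finite_measure set (Euclidean R n) -> \bar R}).

Definition Euclidean_cons (x : measurableTypeR R * Euclidean R n) :
  Euclidean R n.+1 := cons_tuple x.1 x.2.

Definition Euclidean_uncons (x : Euclidean R n.+1) :
  measurableTypeR R * Euclidean R n := (thead x, behead_tuple x).

Lemma Euclidean_consK : cancel Euclidean_cons Euclidean_uncons.
Proof. by case=> x y; congr pair; exact/val_inj. Qed.

Lemma measurable_Euclidean_cons : measurable_fun setT Euclidean_cons.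
Proof. exact: measurable_cons. Qed.

Lemma measurable_Euclidean_uncons : measurable_fun setT Euclidean_uncons.
Proof.
apply/measurable_fun_pairP; split; first exact: measurable_tnth.
exact: measurable_behead.
Qed.

Definition lebesgue_cons : set (Euclidean R n.+1) -> \bar R :=
  pushforward (@lebesgue_measure R \x mu)%E Euclidean_cons.

Let lebesgue_cons0 : lebesgue_cons set0 = 0%E.
Proof. by rewrite /lebesgue_cons /pushforward preimage_set0 measure0. Qed.

Let lebesgue_cons_ge0 A : (0 <= lebesgue_cons A)%E.
Proof. by rewrite /lebesgue_cons /pushforward; exact: measure_ge0. Qed.

Let lebesgue_cons_sigma_additive : semi_sigma_additive lebesgue_cons.
Proof.
have mcons := measurable_Euclidean_cons.
rewrite /lebesgue_cons; exact: measure_semi_sigma_additive.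
Qed.

HB.instance Definition _ := isMeasure.Build _ _ _ lebesgue_cons
  lebesgue_cons0 lebesgue_cons_ge0 lebesgue_cons_sigma_additive.

Let lebesgue_cons_sigma_finite : sigma_finite setT lebesgue_cons.
Proof.
have /sigma_finiteP[F [FT ndF Foo]] := sigma_finiteT (@lebesgue_measure R).
have /sigma_finiteP[G [GT ndG Goo]] := sigma_finiteT mu.
exists (fun k => Euclidean_uncons @^-1` (F k `*` G k)).
  rewrite -preimage_bigcup; apply/esym/seteqP; split=> // x _.
  have [i _ Fi] : (\bigcup_i F i) (thead x) by rewrite -FT.
  have [j _ Gj] : (\bigcup_i G i) (behead_tuple x) by rewrite -GT.
  exists (maxn i j) => //; split.
  - by move: Fi; exact/subsetPset/ndF/leq_maxl.
  - by move: Gj; exact/subsetPset/ndG/leq_maxr.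
move=> k; have [mF Fk] := Foo k; have [mG Gk] := Goo k; split.
  rewrite -[X in measurable X]setTI; apply: measurable_Euclidean_uncons => //.
  exact: measurableX.
rewrite /lebesgue_cons /pushforward -comp_preimage.
rewrite (_ : _ \o _ = id); last first.
  by apply/funext => x /=; rewrite Euclidean_consK.
by rewrite /= product_measure1E// lte_mul_pinfty// ge0_fin_numE.
Qed.

HB.instance Definition _ := Measure_isSigmaFinite.Build _ _ _ lebesgue_cons
  lebesgue_cons_sigma_finite.

End cons.

Fixpoint lebesgue_Euclidean (n : nat) :
    {sigma_finite_measure set (Euclidean R n) -> \bar R} :=
  match n with
  | 0 => \d_([tuple] : Euclidean R 0)
  | m.+1 => lebesgue_cons (lebesgue_Euclidean m)
  end.

End lebesgue_measure_Euclidean.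
Arguments lebesgue_Euclidean : clear implicits.

Section complex_integral.
Context d (T : measurableType d) (R : realType).
Implicit Types (mu : {measure set T -> \bar R}) (f : T -> R[i]).

Definition cmeasurable f :=
  measurable_fun setT (fun t => complex.Re (f t)) /\
  measurable_fun setT (fun t => complex.Im (f t)).

Definition cintegrable mu f :=
  mu.-integrable setT (fun t => (complex.Re (f t))%:E) /\
  mu.-integrable setT (fun t => (complex.Im (f t))%:E).

Definition cintegral mu f : R[i] :=
  (\int[mu]_t complex.Re (f t)) +i* (\int[mu]_t complex.Im (f t)).

End complex_integral.

Section L2.
Context (R : realType) (d : nat).
Implicit Types f g : Euclidean R d -> R[i].

Definition L2norm f : \bar R :=
  Lnorm (lebesgue_Euclidean R d) 2%:E (fun t => (normc (f t))%:E).

Definition L2 f := cmeasurable f /\ (L2norm f < +oo)%E.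

Definition L2inner f g : R[i] :=
  cintegral (lebesgue_Euclidean R d) (fun t => f t * (g t)^*).

End L2.

Section gabor.
Context (R : realType) (d : nat).
Implicit Types (f g : Euclidean R d -> R[i]) (z : Euclidean R (d + d))
  (L : 'M[R]_(d + d)).

Definition position z : Euclidean R d := [tuple tnth z (lshift d i) | i < d].

Definition frequency z : Euclidean R d := [tuple tnth z (rshift d i) | i < d].

Definition expi (theta : R) : R[i] := cos theta +i* sin theta.

Definition tfshift z f : Euclidean R d -> R[i] := fun t =>
  expi (2 * pi * \sum_(i < d) tnth t i * tnth (frequency z) i) *
  f [tuple tnth t i - tnth (position z) i | i < d].

Definition lattice_point L (k : 'cV[int]_(d + d)) : Euclidean R (d + d) :=
  [tuple (L *m map_mx intr k) i 0 | i < d + d].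

Definition gabor_sum L g f : \bar R :=
  \esum_(k in [set: 'cV[int]_(d + d)])
    (normc (L2inner f (tfshift (lattice_point L k) g)) ^+ 2)%:E.

Definition multiwindow_gabor_frame (n : nat) L
    (g : 'I_n -> Euclidean R d -> R[i]) : Prop :=
  exists A B : R, [/\ 0 < A, 0 < B & forall f, L2 f ->
    (A%:E * L2norm f ^+ 2 <= \sum_(i < n) gabor_sum L (g i) f)%E /\
    (\sum_(i < n) gabor_sum L (g i) f <= B%:E * L2norm f ^+ 2)%E].

Definition bessel_bound L g (B : R) : Prop :=
  0 < B /\
  forall f, L2 f -> (gabor_sum L g f <= B%:E * L2norm f ^+ 2)%E.

Definition gaussian : Euclidean R d -> R[i] := fun t =>
  (expR (- pi * \sum_(i < d) tnth t i ^+ 2))%:C.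

Definition stft g f z : R[i] := L2inner f (tfshift z g).

Definition weight z : R := 1 + \sum_(i < d + d) `|tnth z i|.

Definition M1 f : Prop :=
  L2 f /\ cintegrable (lebesgue_Euclidean R (d + d))
    (fun z => stft gaussian f z * (weight z)%:C).

(* Extended-real valued, so that the infimum is +oo when there is no Bessel
   bound. *)
Definition heisenberg_norm L f : \bar R :=
  ereal_inf [set (Num.sqrt B)%:E | B in bessel_bound L f].

(* The completion of [M1] is realized in L^2 by continuous extension of the
   inclusion: a class of Cauchy sequences is sent to its L^2-limit. *)
Definition heisenberg_module L f : Prop :=
  L2 f /\ exists u : nat -> Euclidean R d -> R[i],
    [/\ forall k, M1 (u k),
        forall e : R, 0 < e -> exists N : nat, forall j k : nat,
          (N <= j)%N -> (N <= k)%N ->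
          (heisenberg_norm L (u j \- u k)%R < e%:E)%E
      & (fun k => L2norm (u k \- f)) @ \oo --> 0%E].

End gabor.

(* Main.v *)
Require Import Defs.
From mathcomp Require Import all_boot all_order all_algebra.
From mathcomp Require Import all_classical all_reals all_analysis.
From mathcomp Require Import measurable_realfun lebesgue_integral_fubini.
From mathcomp.real_closed Require Import complex.
From mathcomp Require Import ring lra.
Set Implicit Arguments.
Unset Strict Implicit.
Unset Printing Implicit Defensive.
Import Order.TTheory GRing.Theory Num.Theory.
Import numFieldNormedType.Exports.
Import Normc.
Local Open Scope classical_set_scope.
Local Open Scope ring_scope.
Local Open Scope complex_scope.

(** Suppose that the lattice [L0 Z^2d] has covolume [n] and that the [n] windows
    [g_i] generate a frame; write [pi(z)] for the time-frequency shift by [z].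

    The lower frame bound survives a perturbation of the windows with small
    Bessel bound, and elements of the Heisenberg module are, by the very choice
    of its norm, limits of elements of [M^1_nu] in that sense
    ([frame_perturbation]).  So the [g_i] may be taken in [M^1_nu].  The Moyal
    identity ([moyal]), which comes from the Plancherel theorem applied to
    [f(t) phi(t - x)] for each [x], shows that such windows satisfy
    [|pi(s e) g - g| = O(s)] for the unit translation and modulation directions
    [e] ([M1_lipschitz]), so that [t_j g] is square integrable
    ([modulation_derivative]).

    The Riesz theorem for the inner product that the frame defines gives dual
    windows [h_i] with
      <f,u> = sum_(j,l) <f, pi(l) h_j> <pi(l) g_j, u>
    and [<g_i,h_i> = sum_(j,l) |<g_i, pi(l) h_j>|^2 >= <g_i,h_i>^2]
    ([dual_frame]).  Averaging the expansion of [pi(z) phi] over a fundamental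
    domain of the lattice computes [sum_i <g_i,h_i>]: it equals
    [|det L0| = n] ([trace_identity]).  Hence each [<g_i,h_i>] is [1], and the
    families are biorthogonal: [<g_i, pi(l) h_j> = 0] unless [i = j] and
    [l = 0] ([biorthogonality]).

    Biorthogonality contradicts the uncertainty principle.  The argument is
    Battle's proof of the Balian-Low theorem with position and momentum replaced
    by the differences [D_w = pi(w) - 1], so that no regularity of the [h_i] is
    needed.  Expanding [<D_v D_w g_i, h_i>] and commuting [D_v] past the lattice
    shifts shows, by biorthogonality, that the sum over [i] is almost symmetric
    in [v] and [w]: for [w] and [v] of length [s] along a position axis and the
    conjugate frequency axis, the asymmetry is [o(s^2)].  But
    [pi(v) pi(w) - pi(w) pi(v) = (e^(2 i pi s^2) - 1) pi(w) pi(v)] makes it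
    equivalent to [2 i pi n s^2] ([no_biorthogonal_frame]). *)

(** * Complex numbers, inner product spaces and the Riesz representation theorem *)

Section complex_prelim.
Context {R : realType}.
Implicit Types z w : R[i].
Local Notation C := R[i].

Definition nsq z : R := complex.Re z ^+ 2 + complex.Im z ^+ 2.

(** Identities between complex numbers are proved by taking real and
    imaginary parts with [reimE] and calling [ring]. *)
Lemma complexP z w : complex.Re z = complex.Re w ->
  complex.Im z = complex.Im w -> z = w.
Proof. by case: z w => a b [c e] /= -> ->. Qed.

Lemma cReD z w : complex.Re (z + w) = complex.Re z + complex.Re w.
Proof. by case: z w => a b [c e]. Qed.
Lemma cImD z w : complex.Im (z + w) = complex.Im z + complex.Im w.
Proof. by case: z w => a b [c e]. Qed.
Lemma cReN z : complex.Re (- z) = - complex.Re z.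
Proof. by case: z => a b. Qed.
Lemma cImN z : complex.Im (- z) = - complex.Im z.
Proof. by case: z => a b. Qed.
Lemma cReM z w : complex.Re (z * w) =
  complex.Re z * complex.Re w - complex.Im z * complex.Im w.
Proof. by case: z w => a b [c e]. Qed.
Lemma cImM z w : complex.Im (z * w) =
  complex.Re z * complex.Im w + complex.Im z * complex.Re w.
Proof. by case: z w => a b [c e]. Qed.
Lemma cReJ z : complex.Re z^* = complex.Re z.
Proof. by case: z => a b. Qed.
Lemma cImJ z : complex.Im z^* = - complex.Im z.
Proof. by case: z => a b. Qed.
Lemma cRe0 : complex.Re (0 : C) = 0. Proof. by []. Qed.
Lemma cIm0 : complex.Im (0 : C) = 0. Proof. by []. Qed.
Lemma cRe1 : complex.Re (1 : C) = 1. Proof. by []. Qed.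
Lemma cIm1 : complex.Im (1 : C) = 0. Proof. by []. Qed.
Lemma cReC (x : R) : complex.Re x%:C = x. Proof. by []. Qed.
Lemma cImC (x : R) : complex.Im x%:C = 0. Proof. by []. Qed.
Lemma cRei : complex.Re ('i : C) = 0. Proof. by []. Qed.
Lemma cImi : complex.Im ('i : C) = 1. Proof. by []. Qed.
Lemma cReCi (a b : R) : complex.Re (a +i* b) = a. Proof. by []. Qed.
Lemma cImCi (a b : R) : complex.Im (a +i* b) = b. Proof. by []. Qed.

Definition reimE := (cReD, cImD, cReN, cImN, cReM, cImM, cReJ, cImJ, cRe0, cIm0, cRe1, cIm1,
  cReC, cImC, cRei, cImi, cReCi, cImCi).

Lemma cRe_sum I (r : seq I) P (F : I -> C) :
  complex.Re (\sum_(i <- r | P i) F i) = \sum_(i <- r | P i) complex.Re (F i).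
Proof. exact: (big_morph _ cReD cRe0). Qed.

Lemma nsq_ge0 z : 0 <= nsq z.
Proof. by rewrite /nsq addr_ge0 ?sqr_ge0. Qed.
Lemma nsq0 : nsq 0 = 0. Proof. by rewrite /nsq !reimE; ring. Qed.
Lemma nsq1 : nsq 1 = 1. Proof. by rewrite /nsq !reimE; ring. Qed.
Lemma nsqM z w : nsq (z * w) = nsq z * nsq w.
Proof. by rewrite /nsq !reimE; ring. Qed.
Lemma nsqJ z : nsq z^* = nsq z.
Proof. by rewrite /nsq !reimE; ring. Qed.
Lemma nsqN z : nsq (- z) = nsq z.
Proof. by rewrite /nsq !reimE; ring. Qed.
Lemma nsqC (x : R) : nsq x%:C = x ^+ 2.
Proof. by rewrite /nsq !reimE; ring. Qed.
Lemma nsqE z : nsq z = normc z ^+ 2.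
Proof. by case: z => a b; rewrite /nsq /= sqr_sqrtr// addr_ge0 ?sqr_ge0. Qed.
Lemma nsq_eq0 z : nsq z = 0 -> z = 0.
Proof.
move/eqP; rewrite /nsq paddr_eq0 ?sqr_ge0// !sqrf_eq0 => /andP[/eqP a /eqP b].
exact: complexP.
Qed.
Lemma mulcJ z : z * z^* = (nsq z)%:C.
Proof. by apply: complexP; rewrite /nsq !reimE; ring. Qed.
Lemma nsqD_le z w : nsq (z + w) <= 2 * nsq z + 2 * nsq w.
Proof.
rewrite /nsq !reimE.
have := sqr_ge0 (complex.Re z - complex.Re w).
have := sqr_ge0 (complex.Im z - complex.Im w).
nra.
Qed.
Lemma Re_le_nsq z w : complex.Re (z * w^*) <= (nsq z + nsq w) / 2.
Proof.
rewrite /nsq !reimE.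
have := sqr_ge0 (complex.Re z - complex.Re w).
have := sqr_ge0 (complex.Im z - complex.Im w).
nra.
Qed.
Lemma Re_sqr_le z : complex.Re z ^+ 2 <= nsq z.
Proof. by rewrite /nsq lerDl sqr_ge0. Qed.
Lemma Im_sqr_le z : complex.Im z ^+ 2 <= nsq z.
Proof. by rewrite /nsq lerDr sqr_ge0. Qed.

End complex_prelim.

Section prehilbert.
Context {R : realType} {V : zmodType}.
Variables (sc : R[i] -> V -> V) (D : V -> Prop) (ip : V -> V -> R[i]).

(** Inner products are kept on the functions themselves: square integrability
    is a predicate [D] on a space of functions, and the null functions are not
    quotiented out, so definiteness is not among the axioms. *)
Record prehilbert : Prop := Prehilbert {
  ph_dom0 : D 0;
  ph_domD : forall f g, D f -> D g -> D (f + g);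
  ph_domZ : forall c f, D f -> D (sc c f);
  ph_scN1 : forall f, sc (-1) f = - f;
  ph_ipD : forall f g h, D f -> D g -> D h -> ip (f + g) h = ip f h + ip g h;
  ph_ipZ : forall c f g, D f -> D g -> ip (sc c f) g = c * ip f g;
  ph_ipC : forall f g, D f -> D g -> ip g f = (ip f g)^*;
  ph_ge0 : forall f, D f -> 0 <= complex.Re (ip f f) }.

Definition sqn f : R := complex.Re (ip f f).

Hypothesis H : prehilbert.

Lemma ph_domN f : D f -> D (- f).
Proof. by move=> Df; rewrite -(ph_scN1 H); exact: ph_domZ. Qed.
Lemma ph_domB f g : D f -> D g -> D (f - g).
Proof. by move=> Df Dg; apply: ph_domD => //; exact: ph_domN. Qed.

Lemma ph_ipDr f g h : D f -> D g -> D h -> ip h (f + g) = ip h f + ip h g.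
Proof.
move=> Df Dg Dh; rewrite (ph_ipC H (ph_domD H Df Dg) Dh) (ph_ipD H)// rmorphD/=.
by rewrite -!(ph_ipC H).
Qed.
Lemma ph_ipZr c f g : D f -> D g -> ip f (sc c g) = c^* * ip f g.
Proof.
move=> Df Dg; rewrite (ph_ipC H (ph_domZ H c Dg) Df) (ph_ipZ H)// rmorphM/=.
by rewrite -(ph_ipC H).
Qed.
Lemma ph_ipN f g : D f -> D g -> ip (- f) g = - ip f g.
Proof. by move=> Df Dg; rewrite -(ph_scN1 H) (ph_ipZ H)// mulN1r. Qed.
Lemma ph_ipNr f g : D f -> D g -> ip f (- g) = - ip f g.
Proof.
by move=> Df Dg; rewrite -(ph_scN1 H) ph_ipZr// rmorphN rmorph1 mulN1r.
Qed.
Lemma ph_ipB f g h : D f -> D g -> D h -> ip (f - g) h = ip f h - ip g h.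
Proof. by move=> Df Dg Dh; rewrite (ph_ipD H)// ?ph_ipN//; exact: ph_domN. Qed.
Lemma ph_ipBr f g h : D f -> D g -> D h -> ip h (f - g) = ip h f - ip h g.
Proof. by move=> Df Dg Dh; rewrite ph_ipDr// ?ph_ipNr//; exact: ph_domN. Qed.
Lemma ph_ip_real f : D f -> ip f f = (sqn f)%:C.
Proof.
move=> Df; apply: complexP; rewrite ?reimE//.
have /(congr1 (@complex.Im R)) := ph_ipC H Df Df; rewrite !reimE; lra.
Qed.

Lemma sqn_ge0 f : D f -> 0 <= sqn f. Proof. exact: ph_ge0. Qed.

Lemma sqnD f g : D f -> D g ->
  sqn (f + g) = sqn f + 2 * complex.Re (ip f g) + sqn g.
Proof.
move=> Df Dg; rewrite /sqn (ph_ipD H)// ?ph_ipDr//; last exact: ph_domD.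
rewrite (ph_ipC H Df Dg) !reimE; ring.
Qed.
Lemma sqnZ c f : D f -> sqn (sc c f) = nsq c * sqn f.
Proof.
move=> Df; rewrite {1}/sqn (ph_ipZ H)// ?ph_ipZr//; last exact: ph_domZ.
by rewrite ph_ip_real// mulrA mulcJ !reimE; ring.
Qed.
Lemma sqnN f : D f -> sqn (- f) = sqn f.
Proof. by move=> Df; rewrite -(ph_scN1 H) sqnZ// nsqN nsq1 mul1r. Qed.
Lemma sqnB f g : D f -> D g ->
  sqn (f - g) = sqn f - 2 * complex.Re (ip f g) + sqn g.
Proof.
move=> Df Dg; rewrite sqnD// ?sqnN// ?ph_ipNr//; last exact: ph_domN.
rewrite !reimE; ring.
Qed.
Lemma parallelogram f g : D f -> D g ->
  sqn (f - g) + sqn (f + g) = 2 * sqn f + 2 * sqn g.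
Proof. by move=> Df Dg; rewrite sqnB// sqnD//; ring. Qed.
Lemma sqnD_le f g : D f -> D g -> sqn (f + g) <= 2 * sqn f + 2 * sqn g.
Proof.
move=> Df Dg; rewrite -parallelogram// lerDr; apply: sqn_ge0.
exact: ph_domB.
Qed.
Lemma sqnB_le f g : D f -> D g -> sqn (f - g) <= 2 * sqn f + 2 * sqn g.
Proof.
move=> Df Dg; rewrite -parallelogram// lerDl; apply: sqn_ge0.
exact: ph_domD.
Qed.

(** From [0 <= |f - c g|^2] at its minimum in [c], [c = <f,g> / |g|^2]; only
    multiples of [<f,g>] by reals need to be tried for [c]. *)
Lemma cauchy_schwarz f g : D f -> D g -> nsq (ip f g) <= sqn f * sqn g.
Proof.
move=> Df Dg.
have key (s : R) : 0 <= sqn f - 2 * s * nsq (ip f g)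
    + s ^+ 2 * nsq (ip f g) * sqn g.
  have Dc := ph_domZ H (s%:C * ip f g) Dg.
  have := sqn_ge0 (ph_domB Df Dc); rewrite sqnB// sqnZ// ph_ipZr// nsqM nsqC.
  rewrite rmorphM/= -mulrA (mulrC _ (ip f g)) mulcJ !reimE; lra.
have q0 := sqn_ge0 Df; have r0 := sqn_ge0 Dg; have n0 := nsq_ge0 (ip f g).
have [g0|g0] := eqVneq (sqn g) 0.
  rewrite g0 mulr0; rewrite leNgt; apply/negP => n1.
  have := key ((sqn f + 1) / (2 * nsq (ip f g))); rewrite g0 mulr0 addr0.
  rewrite leNgt => /negP; apply.
  have -> : 2 * ((sqn f + 1) / (2 * nsq (ip f g))) * nsq (ip f g) = sqn f + 1.
    by field; rewrite ?gt_eqF//.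
  lra.
have g1 : 0 < sqn g by rewrite lt0r g0.
have := key (sqn g)^-1.
have -> : sqn f - 2 * (sqn g)^-1 * nsq (ip f g) +
   (sqn g)^-1 ^+ 2 * nsq (ip f g) * sqn g = (sqn f * sqn g - nsq (ip f g)) / sqn g.
  by field.
by rewrite pmulr_lge0 ?invr_gt0// subr_ge0.
Qed.

Lemma polarization f g : D f -> D g ->
  complex.Re (ip f g) = (sqn (f + g) - sqn (f - g)) / 4.
Proof. by move=> Df Dg; rewrite sqnD// sqnB//; field. Qed.

Lemma Im_ip f g : D f -> D g ->
  complex.Im (ip f g) = complex.Re (ip f (sc 'i g)).
Proof. by move=> Df Dg; rewrite ph_ipZr// !reimE; ring. Qed.

Lemma sqn_triangle f g : D f -> D g ->
  Num.sqrt (sqn (f + g)) <= Num.sqrt (sqn f) + Num.sqrt (sqn g).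
Proof.
move=> Df Dg; have q0 := sqn_ge0 Df; have r0 := sqn_ge0 Dg.
have a0 := sqrtr_ge0 (sqn f); have b0 := sqrtr_ge0 (sqn g).
rewrite -(ler_pXn2r (n := 2))// ?nnegrE ?sqrtr_ge0 ?addr_ge0//.
rewrite sqr_sqrtr ?sqn_ge0//; last exact: ph_domD.
rewrite sqnD// sqrrD !sqr_sqrtr//.
suff : complex.Re (ip f g) <= Num.sqrt (sqn f) * Num.sqrt (sqn g) by lra.
rewrite (le_trans (ler_norm _))// -(ler_pXn2r (n := 2))// ?nnegrE ?mulr_ge0//.
rewrite real_normK ?num_real// exprMn !sqr_sqrtr//.
exact: le_trans (Re_sqr_le _) (cauchy_schwarz Df Dg).
Qed.

Definition ph_complete : Prop := forall u : nat -> V, (forall k, D (u k)) ->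
  (forall e : R, 0 < e -> exists N, forall j k, (N <= j)%N -> (N <= k)%N ->
     sqn (u j - u k) < e) ->
  exists2 f, D f & forall e : R, 0 < e -> exists N, forall k, (N <= k)%N ->
     sqn (u k - f) < e.

(** The functional [l] is represented by a minimiser of [|f|^2 - 2 Re (l f)],
    found as the limit of a minimising sequence, which is Cauchy by the
    parallelogram identity. *)
Lemma riesz (l : V -> R[i]) (K : R) : ph_complete ->
  (forall f g, D f -> D g -> l (f + g) = l f + l g) ->
  (forall c f, D f -> l (sc c f) = c * l f) ->
  (forall f, D f -> nsq (l f) <= K * sqn f) ->
  exists2 h, D h & forall f, D f -> l f = ip f h.
Proof.
move=> cpl lD lZ lK.
(* The infimum of J is written as a supremum, because of the form of the completeness axiom. *)
pose J f := sqn f - 2 * complex.Re (l f).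
pose S : set R := [set - J f | f in D].
have D0 := ph_dom0 H.
have S0 : S !=set0 by exists (- J 0), 0.
have Sub : ubound S (`|K|).
  move=> _ [f Df <-]; rewrite /J.
  have q0 := sqn_ge0 Df; have /(le_trans (Re_sqr_le _)) b := lK _ Df.
  have K0 := normr_ge0 K; have KK := ler_norm K.
  have : complex.Re (l f) <= (sqn f + `|K|) / 2.
    apply: le_trans (ler_norm _) _.
    have sK : 0 <= (sqn f + `|K|) / 2 by lra.
    rewrite -(ler_pXn2r (n := 2)) ?nnegrE// real_normK ?num_real//.
    apply: le_trans b _.
    have : K * sqn f <= `|K| * sqn f by rewrite ler_wpM2r.
    have := sqr_ge0 (sqn f - `|K|).
    rewrite !expr2; set a := `|K|; lra.
  lra.
have hS : has_sup S by split => //; exists `|K|.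
pose m := - sup S.
have Jm f : D f -> m <= J f.
  by move=> Df; rewrite /m lerNl; apply: sup_upper_bound => //; exists f.
have exu k : exists f, D f /\ J f < m + k.+1%:R^-1.
  have k0 : (0:R) < k.+1%:R^-1 by rewrite invr_gt0.
  have [_ [f Df <-] b] := sup_adherent k0 hS.
  by exists f; split => //; rewrite /m; move: (_^-1) b => a b; lra.
have [u uP] := choice exu.
have Du k : D (u k) by have [] := uP k.
have lN f : D f -> l (- f) = - l f.
  by move=> Df; rewrite -(ph_scN1 H) lZ// mulN1r.
have Dh c f : D f -> D (sc c f) by exact: ph_domZ.
have cau j k : sqn (u j - u k) <= 2 * j.+1%:R^-1 + 2 * k.+1%:R^-1.
  have par := parallelogram (Du j) (Du k).
  have Dm := Dh (2^-1)%:C _ (ph_domD H (Du j) (Du k)).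
  have := Jm _ Dm; rewrite /J sqnZ ?lZ; try exact: ph_domD.
  rewrite lD// nsqC !reimE.
  have [_] := uP j; have [_] := uP k; rewrite /J.
  have -> : (2^-1 : R) ^+ 2 = 4^-1 by field.
  move: (j.+1%:R^-1) (k.+1%:R^-1) => v w.
  set a := sqn (u j + u k) in par *; lra.
have inv_small (e : R) : 0 < e -> exists N, forall k, (N <= k)%N -> (k.+1%:R^-1 : R) < e.
  move=> e0; exists (Num.trunc e^-1).+1 => k Nk.
  rewrite invf_plt ?posrE//.
  rewrite (lt_le_trans (truncnS_gt _))// ler_nat.
  by rewrite (leq_trans Nk).
have [h Dhh hP] : exists2 f, D f & forall e : R, 0 < e -> exists N, forall k, (N <= k)%N ->
     sqn (u k - f) < e.
  apply: cpl => // e e0.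
  have e4 : 0 < e / 4 by lra.
  have [N NP] := inv_small _ e4.
  exists N => j k Nj Nk; apply: le_lt_trans (cau j k) _.
  have := NP _ Nj; have := NP _ Nk.
  by move: (j.+1%:R^-1) (k.+1%:R^-1) => v w; lra.
have main f : D f -> complex.Re (l f) = complex.Re (ip f h).
  move=> Df; set B := complex.Re (ip f h) - complex.Re (l f).
  suff B0 : B = 0 by move: B0; rewrite /B; lra.
  have Q0 := sqn_ge0 Df; set Q := sqn f in Q0.
  have key (t : R) : 0 <= 2 * t * B + t ^+ 2 * Q.
    apply/ler_addgt0Pr => e e0.
    have e2 : 0 < e / 2 by lra.
    have [N NP] := inv_small _ e2.
    have t1 : 0 < `|t| + 1 by rewrite ltr_wpDl.
    have e3 : 0 < (e / (4 * (`|t| + 1))) ^+ 2 / (Q + 1).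
      by rewrite divr_gt0 ?exprn_gt0 ?divr_gt0 ?mulr_gt0//; lra.
    have [M MP] := hP _ e3.
    pose k := maxn N M.
    have := NP k (leq_maxl _ _); have := MP k (leq_maxr _ _).
    have [_] := uP k; move: (k.+1%:R^-1) => v b3 b1 b2.
    have Dt := Dh t%:C _ Df.
    have := Jm _ (ph_domD H (Du k) Dt).
    rewrite /J sqnD// sqnZ// ph_ipZr// lD// lZ// nsqC !reimE -/Q.
    rewrite /J in b3; move=> b4.
    have Dd := ph_domB (Du k) Dhh.
    have cs := cauchy_schwarz Dd Df.
    have : `|complex.Re (ip (u k - h) f)| <= e / (4 * (`|t| + 1)).
      have eK : 0 <= e / (4 * (`|t| + 1)) by rewrite divr_ge0 ?mulr_ge0//; lra.
      rewrite -(ler_pXn2r (n := 2)) ?nnegrE//.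
      rewrite real_normK ?num_real//.
      apply: le_trans (Re_sqr_le _) _; apply: le_trans cs _.
      rewrite -/Q.
      have Q1 : 0 < Q + 1 by lra.
      rewrite ltr_pdivlMr// in b1; have := sqn_ge0 Dd; nra.
    rewrite ph_ipB// !reimE.
    have -> : complex.Re (ip h f) = complex.Re (ip f h).
      by rewrite (ph_ipC H Df Dhh) !reimE.
    set c := complex.Re (ip (u k) f) in b4 *.
    move=> b5.
    have b6 : `|t * (c - complex.Re (ip f h))| <= e / 4.
      rewrite normrM.
      apply: le_trans (_ : (`|t| + 1) * (e / (4 * (`|t| + 1))) <= _).
        by apply: ler_pM => //; lra.
      rewrite le_eqVlt; apply/orP; left; apply/eqP; field.
      by rewrite gt_eqF.
    rewrite ler_norml in b6; case/andP: b6 => b6 b7.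
    rewrite /B; lra.
  have Q1 : 0 < Q + 1 by lra.
  have := key (- (B / (Q + 1))).
  have -> : 2 * - (B / (Q + 1)) * B + (- (B / (Q + 1))) ^+ 2 * Q =
            - (B ^+ 2) * ((Q + 2) / (Q + 1) ^+ 2).
    by field; rewrite gt_eqF.
  rewrite pmulr_lge0; last by rewrite divr_gt0 ?exprn_gt0//; lra.
  rewrite oppr_ge0 => b; apply/eqP; rewrite -sqrf_eq0 eq_le b.
  exact: sqr_ge0.
exists h => // f Df; apply: complexP; first exact: main.
have := main _ (Dh 'i _ Df); rewrite lZ// (ph_ipZ H)// !reimE; lra.
Qed.

End prehilbert.

(** * Square-integrable complex functions *)

Section fatou_le.
Local Open Scope ereal_scope.
Context d (T : measurableType d) (R : realType) (mu : {measure set T -> \bar R}).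

(** Fatou's lemma in the form used throughout: a bound on the integrals of
    the terms, from some rank on, passes to a pointwise limit. *)
Lemma fatou_le (f_ : nat -> T -> \bar R) (f : T -> \bar R) (K : \bar R) N :
  (forall n, measurable_fun setT (f_ n)) -> (forall n x, 0 <= f_ n x) ->
  (forall x, f_ n x @[n --> \oo] --> f x) ->
  (forall n, (N <= n)%N -> \int[mu]_x f_ n x <= K) -> \int[mu]_x f x <= K.
Proof.
move=> mf f0 ff fK.
have := @fatou _ _ _ mu setT measurableT (fun n => f_ (n + N)%N)
  (fun n => mf _) (fun n x _ => f0 _ x).
have -> : \int[mu]_x limn_einf ((fun n => f_ (n + N)%N)^~ x) = \int[mu]_x f x.
  apply: eq_integral => x _.
  have /cvg_limn_einf_sup[-> _] : f_ (n + N)%N x @[n --> \oo] --> f x.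
    by have := ff x; rewrite -(cvg_shiftn N).
  by [].
move=> h; apply: le_trans h _; rewrite limn_einf_lim.
apply: lime_le; first exact: is_cvg_einfs.
apply: nearW => n; apply: le_trans (_ : \int[mu]_x f_ (n + N)%N x <= _).
  by apply: ereal_inf_lbound; exists n => /=.
exact: fK (leq_addl _ _).
Qed.

End fatou_le.

Section cmeasurable_theory.
Context d (T : measurableType d) (R : realType).
Implicit Types f g : T -> R[i].

Lemma cmeasurableD f g : cmeasurable f -> cmeasurable g -> cmeasurable (f + g).
Proof.
move=> [f1 f2] [g1 g2]; split.
- rewrite (_ : (fun _ => _) = (fun t => complex.Re (f t) + complex.Re (g t))).
    exact: measurable_funD.
  by apply/funext => t; rewrite !reimE.
- rewrite (_ : (fun _ => _) = (fun t => complex.Im (f t) + complex.Im (g t))).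
    exact: measurable_funD.
  by apply/funext => t; rewrite !reimE.
Qed.
Lemma cmeasurableM f g : cmeasurable f -> cmeasurable g ->
  cmeasurable (fun t => f t * g t).
Proof.
move=> [f1 f2] [g1 g2]; split.
- under eq_fun do rewrite cReM.
  by apply: measurable_funB; exact: measurable_funM.
- under eq_fun do rewrite cImM.
  by apply: measurable_funD; exact: measurable_funM.
Qed.
Lemma cmeasurableJ f : cmeasurable f -> cmeasurable (fun t => (f t)^*).
Proof.
move=> [f1 f2]; split; first by under eq_fun do rewrite cReJ.
by under eq_fun do rewrite cImJ; exact: measurable_funN.
Qed.
Lemma cmeasurable_cst c : cmeasurable (fun _ : T => c : R[i]).
Proof. by split; exact: measurable_cst. Qed.
Lemma cmeasurableB f g : cmeasurable f -> cmeasurable g ->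
  cmeasurable (fun t => f t - g t).
Proof.
move=> mf mg; apply: cmeasurableD => //; split.
- under eq_fun do rewrite cReN; exact: measurable_funN mg.1.
- under eq_fun do rewrite cImN; exact: measurable_funN mg.2.
Qed.

Lemma cmeasurableC (f : T -> R) : measurable_fun setT f ->
  cmeasurable (fun t => (f t)%:C).
Proof. by move=> mf; split => //=; exact: measurable_cst. Qed.
Lemma cmeasurable_expi (f : T -> R) : measurable_fun setT f ->
  cmeasurable (fun t => expi (f t)).
Proof.
move=> mf; split => /=; apply: measurableT_comp => //.
- by apply: continuous_measurable_fun; exact: continuous_cos.
- by apply: continuous_measurable_fun; exact: continuous_sin.
Qed.
Lemma cmeasurable_comp d' (T' : measurableType d') f (h : T' -> T) :
  cmeasurable f -> measurable_fun setT h -> cmeasurable (fun t => f (h t)).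
Proof.
by move=> [f1 f2] mh; split; [exact: (measurableT_comp f1 mh)|exact: (measurableT_comp f2 mh)].
Qed.
Lemma measurable_nsq f : cmeasurable f -> measurable_fun setT (fun t => nsq (f t)).
Proof. by move=> [f1 f2]; apply: measurable_funD; exact: measurable_funX. Qed.
Lemma measurable_ensq f : cmeasurable f ->
  measurable_fun setT (fun t => (nsq (f t))%:E).
Proof. by move=> mf; apply/measurable_EFinP; exact: measurable_nsq. Qed.

End cmeasurable_theory.

Definition scf {T : Type} {R : realType} (c : R[i]) (f : T -> R[i]) : T -> R[i] :=
  fun t => c * f t.

Section L2_space.
Context d (T : measurableType d) (R : realType) (mu : {measure set T -> \bar R}).
Implicit Types f g h : T -> R[i].

Definition L2on f : Prop :=
  cmeasurable f /\ (\int[mu]_t (nsq (f t))%:E < +oo)%E.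

Definition cip f g : R[i] := cintegral mu (fun t => f t * (g t)^*).

Lemma ensq_ge0 (z : R[i]) : (0 <= (nsq z)%:E)%E.
Proof. by rewrite lee_fin nsq_ge0. Qed.
#[local] Hint Resolve ensq_ge0 : core.

Lemma L2on0 : L2on 0.
Proof.
split; first exact: cmeasurable_cst.
by rewrite (eq_integral (cst 0%E)) ?integral0// => t _ /=; rewrite nsq0.
Qed.

Lemma L2onZ c f : L2on f -> L2on (scf c f).
Proof.
move=> [mf f2]; split; first by apply: cmeasurableM => //; exact: cmeasurable_cst.
under eq_integral do rewrite nsqM EFinM.
rewrite ge0_integralZl_EFin ?nsq_ge0//; last exact: measurable_ensq.
by rewrite lte_mul_pinfty// lee_fin nsq_ge0.
Qed.

Lemma L2onD f g : L2on f -> L2on g -> L2on (f + g).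
Proof.
move=> [mf f2] [mg g2]; split; first exact: cmeasurableD.
have mf' := measurable_ensq mf; have mg' := measurable_ensq mg.
apply: (@le_lt_trans _ _ (\int[mu]_t (2%:E * (nsq (f t))%:E + 2%:E * (nsq (g t))%:E))%E).
  apply: ge0_le_integral => //; first exact: measurable_ensq (cmeasurableD mf mg).
  - by apply: emeasurable_funD; exact: measurable_funeM.
  - by move=> t _; rewrite -!EFinM -EFinD lee_fin nsqD_le.
rewrite ge0_integralD//; try by move=> *; rewrite mule_ge0.
- by rewrite !ge0_integralZl_EFin// lte_add_pinfty// lte_mul_pinfty.
- exact: measurable_funeM.
- exact: measurable_funeM.
Qed.

Lemma L2on_integrable f g : L2on f -> L2on g ->
  cintegrable mu (fun t => f t * (g t)^*).
Proof.
move=> [mf f2] [mg g2].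
have mp := cmeasurableM mf (cmeasurableJ mg).
have mf' := measurable_ensq mf; have mg' := measurable_ensq mg.
have I : mu.-integrable setT (fun t => (nsq (f t))%:E + (nsq (g t))%:E)%E.
  apply: integrableD => //; apply/integrableP; split => //.
    by under eq_integral do rewrite gee0_abs//.
  by under eq_integral do rewrite gee0_abs//.
split; apply: le_integrable I => //.
- by apply/measurable_EFinP; case: mp.
- move=> t _; rewrite -EFinD/= lee_fin [leRHS]ger0_norm ?(addr_ge0 (nsq_ge0 _) (nsq_ge0 _))//.
  rewrite ler_norml; apply/andP; split.
    have := Re_le_nsq (- f t) (g t); rewrite nsqN mulNr cReN.
    have := nsq_ge0 (f t); have := nsq_ge0 (g t); lra.
  have := Re_le_nsq (f t) (g t).
  have := nsq_ge0 (f t); have := nsq_ge0 (g t); lra.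
- by apply/measurable_EFinP; case: mp.
- move=> t _; rewrite -EFinD/= lee_fin [leRHS]ger0_norm ?(addr_ge0 (nsq_ge0 _) (nsq_ge0 _))//.
  have E : complex.Im (f t * (g t)^*) = complex.Re (f t * ('i * g t)^*).
    by rewrite !reimE; ring.
  have N : nsq ('i * g t) = nsq (g t) by rewrite nsqM /nsq !reimE; ring.
  rewrite E ler_norml; apply/andP; split.
    have := Re_le_nsq (- f t) ('i * g t); rewrite nsqN mulNr cReN N.
    have := nsq_ge0 (f t); have := nsq_ge0 (g t); lra.
  have := Re_le_nsq (f t) ('i * g t); rewrite N.
  have := nsq_ge0 (f t); have := nsq_ge0 (g t); lra.
Qed.

Lemma cRe_cintegral f :
  complex.Re (cintegral mu f) = \int[mu]_t complex.Re (f t).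
Proof. by []. Qed.
Lemma cIm_cintegral f :
  complex.Im (cintegral mu f) = \int[mu]_t complex.Im (f t).
Proof. by []. Qed.

Lemma cintegralD (f g : T -> R[i]) : cintegrable mu f -> cintegrable mu g ->
  cintegral mu (fun t => f t + g t) = cintegral mu f + cintegral mu g.
Proof.
move=> [f1 f2] [g1 g2]; apply: complexP; rewrite ?(cReD, cImD) !(cRe_cintegral, cIm_cintegral).
  by under eq_Rintegral do rewrite cReD; rewrite RintegralD.
by under eq_Rintegral do rewrite cImD; rewrite RintegralD.
Qed.

Lemma cintegralZ c (f : T -> R[i]) : cintegrable mu f ->
  cintegral mu (fun t => c * f t) = c * cintegral mu f.
Proof.
move=> [f1 f2].
have iZ (k : R) (h : T -> R) : mu.-integrable setT (fun t => (h t)%:E) ->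
    mu.-integrable setT (fun t => (k * h t)%:E).
  by move=> ih; apply: eq_integrable (integrableZl measurableT k ih) => // t _; rewrite EFinM.
apply: complexP; rewrite ?(cReM, cImM) !(cRe_cintegral, cIm_cintegral).
  under eq_Rintegral do rewrite cReM.
  by rewrite RintegralB// ?RintegralZl//; exact: iZ.
under eq_Rintegral do rewrite cImM.
by rewrite RintegralD// ?RintegralZl//; exact: iZ.
Qed.

Lemma sqn_cip f : L2on f -> (sqn cip f)%:E = (\int[mu]_t (nsq (f t))%:E)%E.
Proof.
move=> [mf f2]; rewrite /sqn /cip cRe_cintegral /Rintegral.
under eq_integral do rewrite mulcJ cReC.
by rewrite fineK// ge0_fin_numE// integral_ge0.
Qed.

Lemma cip_prehilbert : prehilbert scf L2on cip.
Proof.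
split.
- exact: L2on0.
- exact: L2onD.
- exact: L2onZ.
- by move=> f; apply/funext => t; rewrite /scf mulN1r.
- move=> f g h Lf Lg Lh; rewrite /cip -cintegralD; try exact: L2on_integrable.
  by congr cintegral; apply/funext => t; rewrite -mulrDl.
- move=> c f g Lf Lg; rewrite /cip -cintegralZ; last exact: L2on_integrable.
  by congr cintegral; apply/funext => t; rewrite mulrA.
- move=> f g Lf Lg; have [i1 i2] := L2on_integrable Lf Lg.
  apply: complexP; rewrite /cip ?(cReJ, cImJ) !(cRe_cintegral, cIm_cintegral).
    by apply: eq_Rintegral => t _; rewrite !reimE; ring.
  rewrite -mulN1r -RintegralZl//.
  by apply: eq_Rintegral => t _; rewrite !reimE; ring.
- by move=> f Lf; rewrite -lee_fin -/(sqn cip f) sqn_cip// integral_ge0.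
Qed.

End L2_space.

#[local] Hint Resolve ensq_ge0 : core.

(** * Completeness of the space of square-integrable functions *)

Lemma cvg_geometric_increments (R : realType) (a : nat -> R) (K : R) :
  (forall k, `|a k.+1 - a k| <= K * 2^-1 ^+ k) -> cvgn a.
Proof.
move=> aK.
have h : cvgn (series (telescope a)).
  apply: normed_cvg.
  have gK n : `|telescope a n| <= geometric K 2^-1 n by exact: aK.
  apply: (@series_le_cvg _ _ (geometric K 2^-1)) => [n|n|n|].
  - exact: normr_ge0.
  - exact: le_trans (normr_ge0 _) (gK n).
  - exact: gK.
  - by apply: is_cvg_geometric_series; rewrite ger0_norm ?invf_lt1 ?ltr1n.
rewrite (_ : a = fun n => a 0%N + series (telescope a) n).
  by apply: is_cvgD => //; exact: is_cvg_cst.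
by apply/funext => n; rewrite seriesEnat/= telescope_sumr// addrC subrK.
Qed.

Section L2_complete.
Context d (T : measurableType d) (R : realType) (mu : {measure set T -> \bar R}).
Implicit Types f g h : T -> R[i].

Local Notation q := (sqn (cip mu)).

Lemma cvg_nsq (a : nat -> R[i]) (b z : R[i]) :
  (complex.Re (a k) @[k --> \oo] --> complex.Re b) ->
  (complex.Im (a k) @[k --> \oo] --> complex.Im b) ->
  (nsq (z - a k))%:E @[k --> \oo] --> (nsq (z - b))%:E.
Proof.
move=> a1 a2.
have h : nsq (z - a k) @[k --> \oo] --> nsq (z - b).
  rewrite /nsq !reimE !expr2.
  under eq_fun do rewrite !reimE !expr2.
  by apply: cvgD; apply: cvgM; apply: cvgB => //; exact: cvg_cst.
by apply: cvg_EFin; [exact: nearW|exact: h].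
Qed.

(** Riesz-Fischer: along a subsequence whose increments decay geometrically
    in norm, the weighted sum of the squared increments is integrable, so that
    the subsequence converges almost everywhere; Fatou's lemma identifies the
    limit in norm. *)
Lemma L2on_complete : ph_complete (L2on mu) (cip mu).
Proof.
have H := cip_prehilbert mu.
move=> u Lu cau.
have e8 k : 0 < (8^-1 : R) ^+ k by rewrite exprn_gt0 ?invr_gt0.
have [Nf NfP] := choice (fun k => cau _ (e8 k)).
(* The increments of the subsequence are below 8^-k, so that they remain summable after multiplication by 4^k. *)
pose phi k := (k + \sum_(i < k.+1) Nf i)%N.
have phik k : (k <= phi k)%N by exact: leq_addr.
have phiN k : (Nf k <= phi k)%N.
  by rewrite /phi big_ord_recr/= !addnA leq_addl.
have phiS k : (Nf k <= phi k.+1)%N.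
  rewrite /phi big_ord_recr/= big_ord_recr/=.
  apply: leq_trans (leq_addl _ _); apply: leq_trans (leq_addr _ _).
  exact: leq_addl.
pose v k := u (phi k).
have qv k : q (v k.+1 - v k) < 8^-1 ^+ k by exact: NfP.
have Lv k : L2on mu (v k) by exact: Lu.
have Ldv k : L2on mu (v k.+1 - v k) by exact: (ph_domB H).
pose s_ k t := ((4 ^+ k * nsq ((v k.+1 - v k) t))%:E : \bar R).
have s0 k t : (0 <= s_ k t)%E.
  by rewrite lee_fin mulr_ge0// ?nsq_ge0// exprn_ge0.
have ms k : measurable_fun setT (s_ k).
  apply/measurable_EFinP; apply: measurable_funM; first exact: measurable_cst.
  by apply: measurable_nsq; exact: (Ldv k).1.
pose s t := (\sum_(k <oo) s_ k t)%E.
have sg0 t : (0 <= s t)%E by apply: nneseries_ge0 => n _ _.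
have mS : measurable_fun setT s by exact: ge0_emeasurable_sum.
have Is : (\int[mu]_t s t < +oo)%E.
  rewrite integral_nneseries//.
  apply: (@le_lt_trans _ _ (\sum_(k <oo) (2^-1 ^+ k)%:E)%E).
    apply: lee_nneseries => [k _ _|k _]; first exact: integral_ge0.
    rewrite /s_; under eq_integral do rewrite EFinM.
    rewrite ge0_integralZl_EFin//; last by apply: measurable_ensq; exact: (Ldv k).1.
    rewrite -sqn_cip// -EFinM lee_fin.
    have -> : (2^-1 : R) ^+ k = 4 ^+ k * 8^-1 ^+ k.
      by rewrite -exprMn; congr (_ ^+ _); field.
    by rewrite ler_wpM2l ?exprn_ge0// ltW.
  have /cvg_lim : eseries (fun k => (2^-1 ^+ k)%:E) @ \oo --> ((1 / (1 - 2^-1))%:E : \bar R).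
    rewrite (_ : eseries _ = EFin \o series (geometric 1 2^-1)); last first.
      apply/funext => n; rewrite /eseries /series /= -sumEFin.
      by apply: eq_bigr => i _; rewrite mul1r.
    apply: cvg_EFin; first by apply: nearW.
    by apply: cvg_geometric_series; rewrite ger0_norm ?invf_lt1 ?ltr1n.
  by move=> -> //; rewrite ltry.
pose A := [set t | (s t < +oo)%E].
have mA : measurable A.
  rewrite (_ : A = setT `&` s @^-1` `]-oo, +oo%E[%classic).
    by apply: mS => //; exact: emeasurable_itv.
  by rewrite setTI; apply/seteqP; split => t /=; rewrite in_itv.
have aeA : {ae mu, forall t, A t}.
  have /integrable_ae : mu.-integrable setT s.
    apply/integrableP; split => //.
    by under eq_integral do rewrite gee0_abs//.
  move=> /(_ measurableT); apply: filterS => t /(_ Logic.I).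
  by rewrite /A /= ge0_fin_numE//.
pose w k t := (\1_A t)%:C * v k t.
have wE k t : A t -> w k t = v k t.
  by move=> At; rewrite /w indicE mem_set// mul1r.
have mw k : cmeasurable (w k).
  by apply: cmeasurableM; [exact: cmeasurableC|exact: (Lv k).1].
have inc t : A t -> forall k, nsq ((v k.+1 - v k) t) <= fine (s t) * 4^-1 ^+ k.
  move=> At k.
  have : (s_ k t <= s t)%E.
    rewrite /s (nneseries_split 0 k.+1)//= add0n.
    rewrite big_mkord big_ord_recr/=.
    apply: (@le_trans _ _ (\sum_(i < k) s_ i t + s_ k t)%E).
      by rewrite leeDr// sume_ge0.
    by rewrite leeDl// nneseries_ge0.
  have fs : s t \is a fin_num by rewrite ge0_fin_numE//.
  rewrite -(fineK fs) lee_fin.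
  have -> : (4^-1 : R) ^+ k = (4 ^+ k)^-1 by rewrite exprVn.
  by rewrite ler_pdivlMr ?exprn_gt0// mulrC.
have incw (f : R[i] -> R) : (forall z w, f (z - w) = f z - f w) -> f 0 = 0 ->
   (forall z, f z ^+ 2 <= nsq z) -> forall t, cvgn (fun k => f (w k t)).
  move=> fB f0 fn t.
  have [At|nAt] := pselect (A t); last first.
    apply: (@cvg_geometric_increments _ _ 0) => k.
    by rewrite /w indicE memNset// !mul0r subrr normr0.
  apply: (@cvg_geometric_increments _ _ (Num.sqrt (fine (s t)))) => k.
  rewrite !wE// -fB.
  have b := le_trans (fn _) (inc _ At k).
  have f1 : 0 <= fine (s t) by rewrite fine_ge0//.
  have p0 : 0 <= Num.sqrt (fine (s t)) * 2^-1 ^+ k.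
    by rewrite mulr_ge0 ?sqrtr_ge0 ?exprn_ge0.
  rewrite -(ler_pXn2r (n := 2)) ?nnegrE// real_normK ?num_real//.
  rewrite exprMn sqr_sqrtr// -exprM mulnC exprM.
  by have -> : (2^-1 : R) ^+ 2 = 4^-1 by field.
have cvR : forall t, cvgn (fun k => complex.Re (w k t)).
  by apply: incw => // [z z'|z]; [rewrite cReD cReN|exact: Re_sqr_le].
have cvI : forall t, cvgn (fun k => complex.Im (w k t)).
  by apply: incw => // [z z'|z]; [rewrite cImD cImN|exact: Im_sqr_le].
pose F t : R[i] := limn (fun k => complex.Re (w k t)) +i* limn (fun k => complex.Im (w k t)).
have mF : cmeasurable F.
  split => /=.
  - apply: (@measurable_fun_cvg _ _ _ _ (fun k t => complex.Re (w k t))) => // k.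
    exact: (mw k).1.
  - apply: (@measurable_fun_cvg _ _ _ _ (fun k t => complex.Im (w k t))) => // k.
    exact: (mw k).2.
have cmN f : cmeasurable f -> cmeasurable (- f).
  move=> mf; rewrite (_ : - f = fun t => (-1) * f t).
    by apply: cmeasurableM => //; exact: cmeasurable_cst.
  by apply/funext => t; rewrite mulN1r.
have main (e : R) : 0 < e -> exists N, forall k, (N <= k)%N ->
    (\int[mu]_t (nsq ((u k - F) t))%:E <= e%:E)%E.
  move=> e0; have [N NP] := cau _ e0; exists N => j Nj.
  apply: (@fatou_le _ _ _ mu (fun k t => (nsq ((u j - w k) t))%:E) _ _ N) => //.
  - move=> n; apply: measurable_ensq; apply: cmeasurableD; first by exact: (Lu j).1.
    exact: cmN.
  - by move=> t; apply: cvg_nsq; [exact: cvR|exact: cvI].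
  - move=> n Nn.
    have -> : (\int[mu]_x (nsq ((u j - w n) x))%:E = \int[mu]_x (nsq ((u j - v n) x))%:E)%E.
      apply: ge0_ae_eq_integral => //.
      + apply: measurable_ensq; apply: cmeasurableD; first by exact: (Lu j).1.
        exact: cmN.
      + by apply: measurable_ensq; exact: (ph_domB H (Lu j) (Lv n)).1.
      + move: aeA; apply: filterS => t At _ /=.
        congr ((nsq _)%:E); change (u j t - w n t = u j t - v n t).
        by rewrite wE.
    rewrite -sqn_cip; last exact: (ph_domB H).
    rewrite lee_fin ltW//; apply: NP => //.
    exact: leq_trans Nn (phik n).
have LuF k : (\int[mu]_t (nsq ((u k - F) t))%:E < +oo)%E -> L2on mu (u k - F).
  by split => //; apply: cmeasurableD; [exact: (Lu k).1|exact: cmN].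
have LF : L2on mu F.
  have [N NP] := main _ ltr01.
  have L1 : L2on mu (u N - F) by apply: LuF; rewrite (le_lt_trans (NP _ (leqnn _)))// ltry.
  rewrite (_ : F = u N - (u N - F)); first exact: (ph_domB H).
  by rewrite opprB addrC subrK.
exists F => // e e0.
have e2 : 0 < e / 2 by lra.
have [N NP] := main _ e2; exists N => k Nk.
have := NP _ Nk; rewrite -sqn_cip; last exact: (ph_domB H).
by rewrite lee_fin => h; lra.
Qed.

End L2_complete.

(** * Lebesgue measure on Euclidean space: translations *)

Section affine_line.
Context {R : realType}.
Local Notation mu := (@lebesgue_measure R).

Let affine (a b : R) : measurableTypeR R -> measurableTypeR R := fun x => a * x + b.

Let measurable_affine a b : measurable_fun setT (affine a b).
Proof.
apply: (@measurable_funD _ _ R) => //; apply: (@measurable_funM _ _ R) => //.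
Qed.

Let affine_pushforward a b : {measure set (measurableTypeR R) -> \bar R} :=
  measure_function_pushforward__canonical__measure_function_Measure mu
    (measurable_affine a b).

Lemma lebesgue_measure_affine (a b : R) (A : set (measurableTypeR R)) : a != 0 ->
  measurable A -> mu A = ((`|a|)%:E * mu (affine a b @^-1` A))%E.
Proof.
move=> a0 mA; have an0 : 0 <= `|a| by [].
pose m := mscale (NngNum an0) (affine_pushforward a b).
suff : mu A = m A by rewrite /m/= /mscale/= /pushforward.
apply: lebesgue_measure_unique => // _ [[x y] xy <-] /=.
rewrite /m /mscale /= /pushforward.
rewrite lebesgue_measure_itv/= lte_fin.
have [ap|an] := ltP 0 a.
  rewrite (_ : _ @^-1` _ = `](x - b) / a, (y - b) / a]%classic); last first.
    apply/seteqP; split => t /=; rewrite /affine !in_itv/= ltr_pdivrMr// ler_pdivlMr//;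
      move=> /andP[? ?]; apply/andP; split; lra.
  rewrite lebesgue_measure_itv/= lte_fin ltr_pM2r ?invr_gt0// ltrD2r.
  case: ifPn => xy'; rewrite ?mule0// -!EFinD -EFinM; congr (_%:E).
  by rewrite gtr0_norm//; field.
have {}an : a < 0 by rewrite lt_neqAle a0.
rewrite (_ : _ @^-1` _ = `[(y - b) / a, (x - b) / a[%classic); last first.
  apply/seteqP; split => t /=; rewrite /affine !in_itv/= ltr_ndivlMr// ler_ndivrMr//;
      move=> /andP[? ?]; apply/andP; split; lra.
rewrite lebesgue_measure_itv/= lte_fin ltr_nM2r ?invr_lt0// ltrD2r.
case: ifPn => xy'; rewrite ?mule0// -!EFinD -EFinM; congr (_%:E).
by rewrite ltr0_norm//; field.
Qed.

Lemma ge0_integral_affine (a b : R) (f : measurableTypeR R -> \bar R) : a != 0 ->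
  measurable_fun setT f -> (forall x, 0 <= f x)%E ->
  (\int[mu]_x f x = (`|a|)%:E * \int[mu]_x f (a * x + b)%R)%E.
Proof.
move=> a0 mf f0; have an0 : 0 <= `|a| by [].
rewrite (@eq_measure_integral _ _ _ _ (mscale (NngNum an0) (affine_pushforward a b))); last first.
  by move=> A mA _; exact: lebesgue_measure_affine.
rewrite ge0_integral_mscale//.
by rewrite ge0_integral_pushforward ?preimage_setT//; move=> *; exact: f0.
Qed.

End affine_line.

Section euclidean.
Context {R : realType}.
Local Notation E n := (Euclidean R n).
Local Notation leb n := (lebesgue_Euclidean R n).

Definition Econs n (x : R) (y : E n) : E n.+1 := cons_tuple x y.

Lemma measurable_Econs n : measurable_fun setT
  (fun xy : measurableTypeR R * E n => Econs xy.1 xy.2).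
Proof. exact: measurable_Euclidean_cons. Qed.

Lemma ge0_integral_Econs n (f : E n.+1 -> \bar R) :
  measurable_fun setT f -> (forall x, 0 <= f x)%E ->
  (\int[leb n.+1]_x f x =
   \int[@lebesgue_measure R]_x \int[leb n]_y f (Econs x y))%E.
Proof.
move=> mf f0.
rewrite /= /lebesgue_cons ge0_integral_pushforward//; last exact: measurable_Euclidean_cons.
rewrite preimage_setT fubini_tonelli1//.
  by apply: (measurableT_comp mf); exact: measurable_Euclidean_cons.
by move=> x /=; exact: f0.
Qed.

Lemma ge0_integral_Econs_swap n (f : E n.+1 -> \bar R) :
  measurable_fun setT f -> (forall x, 0 <= f x)%E ->
  (\int[leb n.+1]_x f x =
   \int[leb n]_y \int[@lebesgue_measure R]_x f (Econs x y))%E.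
Proof.
move=> mf f0; rewrite ge0_integral_Econs//.
apply: (@fubini_tonelli _ _ _ _ _ lebesgue_measure (leb n)
  (fun xy => f (Econs xy.1 xy.2))) => //.
by apply: (measurableT_comp mf); exact: measurable_Econs.
Qed.

(** Vectors of [E n] as column matrices, to use the block calculus. *)
Definition tcol n (x : E n) : 'cV[R]_n := \col_i tnth x i.
Definition ctup n (v : 'cV[R]_n) : E n := [tuple v i 0 | i < n].

Lemma tcolK n : cancel (@tcol n) (@ctup n).
Proof. by move=> x; apply: eq_from_tnth => i; rewrite tnth_mktuple mxE. Qed.
Lemma ctupK n : cancel (@ctup n) (@tcol n).
Proof. by move=> x; apply/colP => i; rewrite mxE tnth_mktuple. Qed.

Lemma tcol_Econs n x (y : E n) : tcol (Econs x y) = col_mx (x%:M : 'cV_1) (tcol y).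
Proof.
apply/(@colP _ (1 + n)) => i; rewrite [LHS]mxE; case: (split_ordP (i : 'I_(1 + n))) => j ->.
  rewrite col_mxEu [RHS]mxE !ord1 eqxx mulr1n.
  by transitivity (tnth (Econs x y) ord0) => //; congr tnth; exact/val_inj.
rewrite col_mxEd [RHS]mxE.
transitivity (tnth (Econs x y) (lift ord0 j)); first by congr tnth; exact/val_inj.
by rewrite tnthS; congr tnth; exact/val_inj.
Qed.

Lemma ctup_col_mx n (x : 'cV[R]_1) (y : 'cV[R]_n) :
  ctup (col_mx x y) = Econs (x 0 0) (ctup y).
Proof.
apply: (can_inj (@tcolK _)); rewrite tcol_Econs !ctupK.
by congr col_mx; apply/colP => i; rewrite !ord1 mxE eqxx mulr1n.
Qed.

Lemma measurable_tcol n i : measurable_fun setT (fun x : E n => tcol x i 0).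
Proof. by under eq_fun do rewrite mxE; exact: measurable_tnth. Qed.

Lemma measurable_ctup d (T : measurableType d) n (F : T -> 'cV[R]_n) :
  (forall i, measurable_fun setT (fun t => F t i 0)) ->
  measurable_fun setT (fun t => ctup (F t)).
Proof.
move=> mF.
apply: (@measurable_fun_tnthP _ _ T (measurableTypeR R) n (fun t => ctup (F t))).2.
move=> i.
rewrite (_ : _ \o _ = fun t => F t i 0); first exact: mF.
by apply/funext => t /=; rewrite tnth_mktuple.
Qed.

Definition tadd n (v : 'cV[R]_n) (x : E n) : E n := ctup (v + tcol x).
Definition tlin n (L : 'M[R]_n) (x : E n) : E n := ctup (L *m tcol x).

Lemma measurable_tadd n v : measurable_fun setT (@tadd n v).
Proof.
apply: measurable_ctup => i; under eq_fun do rewrite mxE.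
by apply: measurable_funD => //; exact: measurable_tcol.
Qed.

Lemma measurable_tlin n (L : 'M[R]_n) : measurable_fun setT (tlin L).
Proof.
apply: measurable_ctup => i; under eq_fun do rewrite mxE.
apply: measurable_sum => j; apply: measurable_funM => //; exact: measurable_tcol.
Qed.

Lemma tlinM n (A B : 'M[R]_n) x : tlin (A *m B) x = tlin A (tlin B x).
Proof. by rewrite /tlin ctupK mulmxA. Qed.

Lemma integral_Euclidean0 (f : E 0 -> \bar R) :
  measurable_fun setT f -> (\int[leb 0]_x f x = f [tuple])%E.
Proof. by move=> mf; rewrite /= integral_dirac// diracE in_setT mul1e. Qed.

Lemma tnth_Econs0 n x (y : E n) : tnth (Econs x y) ord0 = x.
Proof. by []. Qed.
Lemma tnth_EconsS n x (y : E n) j : tnth (Econs x y) (lift ord0 j) = tnth y j.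
Proof. by rewrite tnthS; congr tnth; exact/val_inj. Qed.

Lemma tnth_tadd n v (x : E n) i : tnth (tadd v x) i = v i 0 + tnth x i.
Proof. by rewrite tnth_mktuple !mxE. Qed.

Lemma tadd_Econs n (v : 'cV[R]_n.+1) x (y : E n) : tadd v (Econs x y) =
  Econs (v ord0 0 + x) (tadd (\col_i v (lift ord0 i) 0) y).
Proof.
apply: eq_from_tnth => i; rewrite tnth_tadd.
case: (unliftP ord0 i) => [j|] ->; last by rewrite !tnth_Econs0.
by rewrite !tnth_EconsS tnth_tadd mxE.
Qed.

(** By induction on the dimension, from translation invariance on the line. *)
Lemma ge0_integral_translation n (v : 'cV[R]_n) (f : E n -> \bar R) :
  measurable_fun setT f -> (forall x, 0 <= f x)%E ->
  (\int[leb n]_x f (tadd v x) = \int[leb n]_x f x)%E.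
Proof.
elim: n v f => [|n IH] v f mf f0.
  by apply: eq_integral => x _; congr f; rewrite (tuple0 x) (tuple0 (tadd _ _)).
have mfv : measurable_fun setT (fun x => f (tadd v x)).
  by apply: measurableT_comp => //; exact: measurable_tadd.
rewrite !ge0_integral_Econs//.
under eq_integral do under eq_integral do rewrite tadd_Econs.
under eq_integral => x _.
  rewrite (IH _ (fun y => f (Econs (v ord0 0 + x) y)))//.
    over.
  apply: measurableT_comp => //.
  apply: (measurableT_comp (@measurable_Econs n) (pair1_measurable _)).
have mF : measurable_fun setT (fun x : measurableTypeR R => (\int[leb n]_y f (Econs x y))%E).
  apply: (@measurable_fun_fubini_tonelli_F _ _ _ _ _ (leb n) (fun xy => f (Econs xy.1 xy.2))) => //.
  by apply: measurableT_comp => //; exact: measurable_Econs.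
rewrite [RHS](@ge0_integral_affine _ 1 (v ord0 0))//; last first.
  by move=> x; exact: integral_ge0.
rewrite normr1 mul1e; apply: eq_integral => x _.
by apply: eq_integral => y _; rewrite mul1r addrC.
Qed.

End euclidean.

(** * Lebesgue measure on Euclidean space: linear changes of variables *)

Section linear_change.
Context {R : realType}.
Local Notation E n := (Euclidean R n).
Local Notation leb n := (lebesgue_Euclidean R n).

Lemma tlin_block n (a : 'M[R]_1) (b : 'M[R]_(1, n)) (c : 'M[R]_(n, 1)) (D : 'M[R]_n) x (y : E n) :
  tlin (block_mx a b c D : 'M[R]_n.+1) (Econs x y) =
  Econs (a 0 0 * x + (b *m tcol y) 0 0)
    (tadd (x *: c) (tlin D y)).
Proof.
rewrite /tlin tcol_Econs; transitivity (ctup ((block_mx a b c D) *m (col_mx x%:M (tcol y)))) => //.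
rewrite mul_block_col ctup_col_mx; congr Econs.
  by rewrite [LHS]mxE; congr (_ + _); rewrite mul_mx_scalar mxE mulrC.
by rewrite /tadd ctupK mul_mx_scalar.
Qed.

Lemma measurable_integral_fst n (f : E n.+1 -> \bar R) :
  measurable_fun setT f -> (forall x, 0 <= f x)%E ->
  measurable_fun setT (fun y => \int[@lebesgue_measure R]_x f (Econs x y))%E.
Proof.
move=> mf f0.
apply: (@measurable_fun_fubini_tonelli_G _ _ _ _ _ lebesgue_measure
  (fun xy => f (Econs xy.1 xy.2))) => //.
by apply: measurableT_comp => //; exact: measurable_Econs.
Qed.

Lemma tlin_upper n (a : R) (b : 'M[R]_(1, n)) (D : 'M[R]_n) x (y : E n) :
  tlin (block_mx a%:M b 0 D : 'M[R]_n.+1) (Econs x y) =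
  Econs (a * x + (b *m tcol y) 0 0) (tlin D y).
Proof.
rewrite tlin_block scaler0 /tadd add0r tcolK.
by congr (Econs (_ * _ + _)); rewrite mxE eqxx mulr1n.
Qed.

Lemma tlin_lower n (c : 'M[R]_(n, 1)) x (y : E n) :
  tlin (block_mx 1%:M 0 c 1%:M : 'M[R]_n.+1) (Econs x y) =
  Econs x (tadd (x *: c) y).
Proof.
rewrite tlin_block /tlin mul1mx tcolK mul0mx; congr Econs.
by rewrite !mxE eqxx mulr1n mul1r addr0.
Qed.

Lemma det_upper n (a : R) (b : 'M[R]_(1, n)) (D : 'M[R]_n) :
  \det (block_mx a%:M b 0 D : 'M[R]_n.+1) = a * \det D.
Proof. by have := det_ublock (a%:M : 'M[R]_1) b D; rewrite det_scalar expr1. Qed.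

Lemma det_lower n (c : 'M[R]_(n, 1)) :
  \det (block_mx 1%:M 0 c 1%:M : 'M[R]_n.+1) = 1.
Proof. by have := det_lblock (1%:M : 'M[R]_1) c (1%:M : 'M[R]_n); rewrite !det1 mulr1. Qed.

(** [L] multiplies Lebesgue measure by [|det L|]. *)
Definition volume_scaling n (L : 'M[R]_n) := forall f : E n -> \bar R,
  measurable_fun setT f -> (forall x, 0 <= f x)%E ->
  (\int[leb n]_x f x = (`|\det L|)%:E * \int[leb n]_x f (tlin L x))%E.

Lemma volume_scalingM n (A B : 'M[R]_n) :
  volume_scaling A -> volume_scaling B -> volume_scaling (A *m B).
Proof.
move=> VA VB f mf f0; rewrite VA// VB//; last first.
  by apply: measurableT_comp => //; exact: measurable_tlin.
rewrite muleA -EFinM -normrM -det_mulmx; congr (_ * _)%E.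
by apply: eq_integral => x _; rewrite tlinM.
Qed.

Lemma measurable_Econs2 n d (T : measurableType d) (u : T -> measurableTypeR R) (v : T -> E n) :
  measurable_fun setT u -> measurable_fun setT v ->
  measurable_fun setT (fun t => Econs (u t) (v t)).
Proof.
move=> mu mv; apply: (measurableT_comp (@measurable_Econs R n) (g := fun t => (u t, v t))).
exact/measurable_fun_pairP.
Qed.

Lemma volume_scaling_upper n (a : R) (b : 'M[R]_(1, n)) (D : 'M[R]_n) :
  a != 0 -> volume_scaling D ->
  volume_scaling (block_mx a%:M b 0 D : 'M[R]_n.+1).
Proof.
move=> a0 VD f mf f0.
have mfL : measurable_fun setT (fun x => f (tlin (block_mx a%:M b 0 D : 'M[R]_n.+1) x)).
  by apply: measurableT_comp => //; exact: measurable_tlin.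
rewrite !ge0_integral_Econs_swap//.
have mfy y : measurable_fun setT (fun x : measurableTypeR R => f (Econs x y)).
  by apply: measurableT_comp => //; apply: measurable_Econs2.
pose F y := (\int[lebesgue_measure]_x f (Econs x y))%E.
have F0 y : (0 <= F y)%E by exact: integral_ge0.
have mF : measurable_fun setT F.
  exact: measurable_integral_fst.
rewrite det_upper normrM EFinM -muleA.
transitivity (`|\det D|%:E * \int[leb n]_y F (tlin D y))%E; first exact: VD.
rewrite muleCA; congr (_ * _)%E; rewrite -ge0_integralZl_EFin//; last first.
- exact: (@measurable_integral_fst _ (fun x => f (tlin _ x))).
- by move=> y _; exact: integral_ge0.
apply: eq_integral => y _; rewrite /F (@ge0_integral_affine _ a ((b *m tcol y) 0 0))//.
congr (_ * _)%E; apply: eq_integral => x _.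
by rewrite tlin_upper.
Qed.

Lemma volume_scaling1 n : volume_scaling (1%:M : 'M[R]_n).
Proof.
move=> f mf f0; rewrite det1 normr1 mul1e.
by apply: eq_integral => x _; rewrite /tlin mul1mx tcolK.
Qed.

Lemma volume_scaling_lower n (c : 'M[R]_(n, 1)) :
  volume_scaling (block_mx 1%:M 0 c 1%:M : 'M[R]_n.+1).
Proof.
move=> f mf f0; rewrite det_lower normr1 mul1e.
have mfL : measurable_fun setT (fun x => f (tlin (block_mx 1%:M 0 c 1%:M : 'M[R]_n.+1) x)).
  by apply: measurableT_comp => //; exact: measurable_tlin.
rewrite !ge0_integral_Econs//; apply: eq_integral => x _.
rewrite -(ge0_integral_translation (x *: c)); last 2 first.
- by apply: measurableT_comp => //; apply: measurable_Econs2.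
- by [].
apply: eq_integral => y _.
by rewrite tlin_lower.
Qed.

Lemma pivot_block n (L : 'M[R]_n.+1) :
  L = block_mx (L ord0 ord0)%:M (ursubmx (L : 'M[R]_(1 + n)))
        (dlsubmx (L : 'M[R]_(1 + n))) (drsubmx (L : 'M[R]_(1 + n))).
Proof.
rewrite -[LHS](@submxK _ 1 n 1 n).
have -> // : ulsubmx (L : 'M[R]_(1 + n)) = (L ord0 ord0)%:M.
apply/matrixP => i j; rewrite !mxE !ord1 eqxx mulr1n; congr (L _ _); exact/val_inj.
Qed.

(** One step of Gaussian elimination: with a nonzero pivot, [L] is the product
    of a lower and an upper block triangular matrix, both of which act on one
    coordinate or on a smaller space at a time. *)
Lemma volume_scaling_pivot n (L : 'M[R]_n.+1) :
  (forall D : 'M[R]_n, \det D != 0 -> volume_scaling D) ->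
  \det L != 0 -> L ord0 ord0 != 0 -> volume_scaling L.
Proof.
move=> IH dL p0.
pose a := L ord0 ord0.
pose b : 'M[R]_(1, n) := ursubmx (L : 'M[R]_(1 + n)).
pose c : 'M[R]_(n, 1) := dlsubmx (L : 'M[R]_(1 + n)).
pose D : 'M[R]_n := drsubmx (L : 'M[R]_(1 + n)).
pose S := D - a^-1 *: (c *m b).
have LE : L = (block_mx 1%:M 0 (a^-1 *: c) 1%:M : 'M[R]_n.+1) *m
              (block_mx a%:M b 0 S : 'M[R]_n.+1).
  rewrite [LHS]pivot_block.
  transitivity ((block_mx 1%:M 0 (a^-1 *: c) 1%:M) *m (block_mx a%:M b 0 S)) => //.
  rewrite mulmx_block !mul1mx !mul0mx !addr0.
  rewrite mul_mx_scalar scalerA divff// scale1r -scalemxAl /S addrC subrK.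
  by [].
have dS : \det S != 0.
  move: dL; rewrite LE det_mulmx; rewrite det_lower det_upper mul1r.
  by rewrite mulf_eq0 negb_or => /andP[].
rewrite LE; apply: volume_scalingM; first exact: volume_scaling_lower.
by apply: volume_scaling_upper => //; exact: IH.
Qed.

Theorem ge0_integral_linear n (L : 'M[R]_n) : \det L != 0 -> volume_scaling L.
Proof.
elim: n L => [|n IH] L dL.
  move=> f mf f0; rewrite det_mx00 normr1 mul1e.
  by apply: eq_integral => x _; congr f; rewrite (tuple0 x) (tuple0 (tlin _ _)).
have [p0|p0] := eqVneq (L ord0 ord0) 0; last exact: volume_scaling_pivot.
(* A vanishing pivot is repaired by adding a lower row to the first one. *)
have [i0|] := pselect (forall i : 'I_n, L (lift ord0 i) ord0 = 0).
  move: dL; rewrite (expand_det_col L ord0) big1 ?eqxx// => i _.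
  by case: (unliftP ord0 i) => [j|] ->; rewrite ?i0 ?p0 mul0r.
move=> /existsNP[i /eqP Li].
pose U : 'M[R]_n.+1 := block_mx (1%:M : 'M[R]_1) (- delta_mx 0 i) 0 (1%:M : 'M[R]_n).
pose V : 'M[R]_n.+1 := block_mx (1%:M : 'M[R]_1) (delta_mx 0 i) 0 (1%:M : 'M[R]_n).
have UV : U *m V = 1%:M.
  transitivity (block_mx (1%:M : 'M[R]_1) (- delta_mx 0 i) 0 (1%:M : 'M[R]_n) *m
    block_mx (1%:M : 'M[R]_1) (delta_mx 0 i) 0 (1%:M : 'M[R]_n) : 'M[R]_(1 + n)) => //.
  rewrite mulmx_block !mul1mx !mulmx1 mulmx0 mul0mx !addr0 add0r subrr.
  by rewrite -scalar_mx_block.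
have LE : L = U *m (V *m L) by rewrite mulmxA UV mul1mx.
have dU : \det U = 1 by rewrite /U det_upper mul1r det1.
rewrite LE; apply: volume_scalingM.
  by apply: volume_scaling_upper; rewrite ?oner_eq0//; exact: volume_scaling1.
apply: volume_scaling_pivot => //.
  by move: dL; rewrite {1}LE det_mulmx dU mul1r.
have -> : (V *m L) ord0 ord0 = L (lift ord0 i) ord0; last exact: Li.
rewrite [in LHS](pivot_block L) p0.
set b := ursubmx _; set c := dlsubmx _; set D := drsubmx _.
transitivity ((block_mx (1%:M : 'M[R]_1) (delta_mx 0 i) 0 (1%:M : 'M[R]_n) *m
   block_mx (0%:M : 'M[R]_1) b c D) (lshift n 0) (lshift n 0)).
  by congr (_ _ _); exact/val_inj.
rewrite mulmx_block block_mxEul mul1mx -rowE !mxE mul0rn add0r.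
by congr (L _ _); exact/val_inj.
Qed.

End linear_change.

(** * Splitting integrals over products and over the cubes of a lattice *)

Section esum_countable.
Local Open Scope ereal_scope.
Context {R : realType} {I : countType}.

(** Sums over a countable type are turned into series, for which the
    convergence theorems of integration theory are stated. *)
Lemma esum_enum (a : I -> \bar R) : (forall k, 0 <= a k) ->
  \esum_(k in [set: I]) a k = \sum_(m <oo) oapp a 0 (@pickle_inv I m).
Proof.
move=> a0; pose b m := oapp a 0 (@pickle_inv I m).
have b0 m : 0 <= b m by rewrite /b; case: pickle_inv.
rewrite nneseries_esumT//.
transitivity (\esum_(m in pickle @` [set: I]) b m).
  rewrite esum_image; last by move=> x y _ _; exact: (pcan_inj pickleK).
  by apply: eq_esum => k _; rewrite /b pickleK_inv.
rewrite esum_mkcond; apply: eq_esum => m _; case: ifPn => // /negP h.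
rewrite /b; case E : (@pickle_inv I m) => [k|]//; case: h; rewrite inE.
by exists k => //; have := @pickle_invK I m; rewrite E /=.
Qed.

Context d (T : measurableType d) (mu : {measure set T -> \bar R}).

Lemma measurable_esum (a : I -> T -> \bar R) :
  (forall k, measurable_fun setT (a k)) -> (forall k x, 0 <= a k x) ->
  measurable_fun setT (fun x => \esum_(k in [set: I]) a k x).
Proof.
move=> ma a0; under eq_fun do rewrite esum_enum//.
apply: ge0_emeasurable_sum => //.
- by move=> m x _ _; case: (@pickle_inv I m) => [k|]/=.
- by move=> m _; case: (@pickle_inv I m) => [k|]//=.
Qed.

Lemma integral_esum (a : I -> T -> \bar R) :
  (forall k, measurable_fun setT (a k)) -> (forall k x, 0 <= a k x) ->
  \int[mu]_x (\esum_(k in [set: I]) a k x) =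
  \esum_(k in [set: I]) \int[mu]_x a k x.
Proof.
move=> ma a0; under eq_integral do rewrite esum_enum//.
rewrite integral_nneseries//; last 2 first.
- by move=> m; case: (@pickle_inv I m) => [k|]//=.
- by move=> m x _; case: (@pickle_inv I m) => [k|]//=.
rewrite esum_enum; last by move=> k; exact: integral_ge0.
apply: eq_eseriesr => m _; case: (@pickle_inv I m) => [k|]//=.
by rewrite integral0.
Qed.

End esum_countable.

Section concatenation.
Context {R : realType}.
Local Notation E n := (Euclidean R n).
Local Notation leb n := (lebesgue_Euclidean R n).

Definition Ecat m n (x : E m) (y : E n) : E (m + n) := cat_tuple x y.

Lemma measurable_Ecat m n d (T : measurableType d) (u : T -> E m) (v : T -> E n) :
  measurable_fun setT u -> measurable_fun setT v ->
  measurable_fun setT (fun t => Ecat (u t) (v t)).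
Proof.
move=> mu mv.
apply: (@measurable_fun_tnthP _ _ T (measurableTypeR R) _ _).2 => i.
case: (split_ordP i) => j ->.
- rewrite (_ : _ \o _ = (fun t => tnth (u t) j)).
    exact: (measurableT_comp (measurable_tnth (j : 'I_m)) mu).
  by apply/funext => t /=; rewrite tnth_lshift.
- rewrite (_ : _ \o _ = (fun t => tnth (v t) j)).
    exact: (measurableT_comp (measurable_tnth (j : 'I_n)) mv).
  by apply/funext => t /=; rewrite tnth_rshift.
Qed.

Lemma ge0_integral_Ecat m n (f : E (m + n) -> \bar R) :
  measurable_fun setT f -> (forall x, 0 <= f x)%E ->
  (\int[leb (m + n)]_z f z = \int[leb m]_x \int[leb n]_y f (Ecat x y))%E.
Proof.
elim: m f => [|m IH] f mf f0.
  rewrite [RHS]integral_Euclidean0//=.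
    by apply: eq_integral => y _; congr f; exact/val_inj.
  have -> : (fun x : E 0 => \int[leb n]_y f (Ecat x y))%E =
            (fun=> \int[leb n]_y f (Ecat ([tuple] : E 0) y))%E.
    by apply/funext => x; rewrite (tuple0 x).
  exact: measurable_cst.
rewrite [RHS]ge0_integral_Econs//; last 2 first.
- apply: (@measurable_fun_fubini_tonelli_F _ _ _ _ _ (leb n)
    (fun xy => f (Ecat xy.1 xy.2))) => //.
  by apply: measurableT_comp => //; exact: measurable_Ecat.
- by move=> x; exact: integral_ge0.
rewrite [LHS](@ge0_integral_Econs _ (m + n))//.
apply: eq_integral => a _.
have mfa : measurable_fun setT (fun z : E (m + n) => f (Econs a z)).
  by apply: measurableT_comp => //; exact: measurable_Econs2.
rewrite [LHS](IH _ mfa (fun z => f0 (Econs a z))).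
apply: eq_integral => x _; apply: eq_integral => y _.
by congr f; exact/val_inj.
Qed.

Lemma positionE d (x : E d) (y : E d) : position (Ecat x y) = x.
Proof. by apply: eq_from_tnth => i; rewrite tnth_mktuple tnth_lshift. Qed.
Lemma frequencyE d (x : E d) (y : E d) : frequency (Ecat x y) = y.
Proof. by apply: eq_from_tnth => i; rewrite tnth_mktuple tnth_rshift. Qed.

Lemma measurable_position d : measurable_fun setT (@position R d).
Proof.
apply: (@measurable_fun_tnthP _ _ _ (measurableTypeR R) _ _).2 => i.
rewrite (_ : _ \o _ = (fun z : E (d + d) => tnth z (lshift d i))).
  exact: measurable_tnth.
by apply/funext => t /=; rewrite tnth_mktuple.
Qed.
Lemma measurable_frequency d : measurable_fun setT (@frequency R d).
Proof.
apply: (@measurable_fun_tnthP _ _ _ (measurableTypeR R) _ _).2 => i.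
rewrite (_ : _ \o _ = (fun z : E (d + d) => tnth z (rshift d i))).
  exact: measurable_tnth.
by apply/funext => t /=; rewrite tnth_mktuple.
Qed.

End concatenation.

Section tiling.
Context {R : realType}.
Local Notation E n := (Euclidean R n).
Local Notation leb n := (lebesgue_Euclidean R n).

Definition in_cube n (x : E n) : bool := [forall i, 0 <= tnth x i < 1].
Definition intv n (k : 'cV[int]_n) : 'cV[R]_n := map_mx intr k.
Definition cube_part n (x : E n) : 'cV[int]_n := \col_i Num.floor (tnth x i).

Lemma in_cubeP n (x : E n) k : in_cube (tadd (- intv k) x) = (k == cube_part x).
Proof.
apply/forallP/eqP => [h|-> i]; last first.
  rewrite tnth_tadd !mxE; have := floor_itv (tnth x i).
  rewrite intrD => /andP[? ?]; apply/andP; split; lra.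
apply/colP => i; have := h i; rewrite tnth_tadd !mxE => /andP[h1 h2].
apply/esym/eqP; rewrite floor_eq intrD; apply/andP; split; lra.
Qed.

Lemma measurable_in_cube n : measurable_fun setT (fun x : E n => (in_cube x)%:R : R).
Proof.
rewrite (_ : (fun _ => _) = fun x => \prod_(i < n) (\1_`[0, 1[ (tnth x i) : R)).
  apply: measurable_prod => i _; apply: measurableT_comp => //.
  exact: measurable_tnth.
apply/funext => x; apply/esym; rewrite /in_cube; case: forallP => [h|/forallP].
  apply: big1 => i _; rewrite indicE mem_set//=; have := h i.
  by rewrite in_itv/=.
rewrite negb_forall => /existsP[i hi]; rewrite (bigD1 i)//= indicE memNset ?mul0r//=.
by rewrite in_itv/= (negbTE hi).
Qed.

(** Exactly one integer translate of a point lies in the unit cube. *)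
Lemma ge0_integral_tiling n (f : E n -> \bar R) :
  measurable_fun setT f -> (forall x, 0 <= f x)%E ->
  (\int[leb n]_x f x = \esum_(k in [set: 'cV[int]_n])
     \int[leb n]_x (((in_cube x)%:R : R)%:E * f (tadd (intv k) x)))%E.
Proof.
move=> mf f0.
have mc : measurable_fun setT (fun x : E n => ((in_cube x)%:R : R)%:E).
  by apply/measurable_EFinP; exact: measurable_in_cube.
pose a k x := (((in_cube (tadd (- intv k) x))%:R : R)%:E * f x)%E.
have ma k : measurable_fun setT (a k).
  apply: emeasurable_funM => //; apply: (measurableT_comp mc).
  exact: measurable_tadd.
have a0 k x : (0 <= a k x)%E by rewrite mule_ge0// lee_fin ler0n.
transitivity (\int[leb n]_x (\esum_(k in [set: 'cV[int]_n]) a k x))%E.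
  apply: eq_integral => x _.
  rewrite -[LHS](@esum_set1 _ _ (cube_part x) (fun=> f x))//.
  rewrite esum_mkcond; apply: eq_esum => k _; rewrite /a in_cubeP (_ : (k \in [set cube_part x]) = (k == cube_part x)); last by apply/idP/eqP; rewrite inE.
  by case: eqP; rewrite ?mul1e ?mul0e.
rewrite (integral_esum (leb n) ma a0); apply: eq_esum => k _.
rewrite -[LHS](ge0_integral_translation (intv k))//.
apply: eq_integral => x _; rewrite /a; congr ((_ (in_cube _))%:R%:E * _)%E.
by rewrite /tadd ctupK addrA addNr add0r tcolK.
Qed.

Lemma integral_cube n : (\int[leb n]_x ((in_cube x)%:R : R)%:E = 1)%E.
Proof.
elim: n => [|n IH].
  rewrite integral_Euclidean0; last by apply/measurable_EFinP; exact: measurable_in_cube.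
  by rewrite (_ : in_cube _)//; apply/forallP => -[].
rewrite ge0_integral_Econs//; last first.
  by apply/measurable_EFinP; exact: measurable_in_cube.
transitivity (\int[lebesgue_measure]_x (\1_(`[0%R, 1%R[%classic : set R) x)%:E)%E.
  apply: eq_integral => x _.
  transitivity (\int[leb n]_y ((\1_`[0%R, 1%R[ x)%:E * ((in_cube y)%:R : R)%:E))%E.
    apply: eq_integral => y _; rewrite -EFinM; congr (_%:E).
    rewrite indicE; have [xI|xI] := boolP (0 <= x < 1).
      rewrite mem_set/= ?in_itv// mul1r; congr (_%:R); congr (nat_of_bool _).
      apply/forallP/forallP => h i.
        by have := h (lift ord0 i); rewrite tnth_EconsS.
      by case: (unliftP ord0 i) => [j|] ->; rewrite ?tnth_Econs0 ?tnth_EconsS.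
    rewrite memNset/= ?in_itv/=; last exact/negP.
    rewrite mul0r (_ : in_cube _ = false)//; apply/negP => /forallP/(_ ord0).
    by rewrite tnth_Econs0; exact/negP.
  rewrite ge0_integralZl_EFin//; last by apply/measurable_EFinP; exact: measurable_in_cube.
  by rewrite IH mule1.
by rewrite integral_indic//= setIT lebesgue_measure_itv/= lte_fin ltr01 oppr0 adde0.
Qed.

End tiling.

(** * Density of step functions *)

Section L2_dct.
Context d (T : measurableType d) (R : realType) (mu : {measure set T -> \bar R}).

Lemma cvge0_small (u : nat -> \bar R) : u @ \oo --> 0%E ->
  forall e : R, 0 < e -> exists N, forall n, (N <= n)%N -> (u n < e%:E)%E.
Proof.
move=> u0 e e0.
have : \forall n \near \oo, (u n < e%:E)%E.
  by have /(_ (fun x => (x < e%:E)%E)) := u0; apply; exact: open_ereal_lt'.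
by case=> N _ NP; exists N.
Qed.

(** Dominated convergence for the mean-square distance to the limit, which is
    subtracted beforehand. *)
Lemma L2_dct (f_ : nat -> T -> R[i]) (h : T -> R) :
  (forall n, cmeasurable (f_ n)) ->
  (forall t, (nsq (f_ n t)) @[n --> \oo] --> 0) ->
  (forall n t, nsq (f_ n t) <= h t) ->
  mu.-integrable setT (EFin \o h) ->
  forall e : R, 0 < e -> exists N, forall n, (N <= n)%N ->
    (\int[mu]_t (nsq (f_ n t))%:E < e%:E)%E.
Proof.
move=> mf f0 fh ih.
apply: cvge0_small.
have [||_ _] := @dominated_convergence _ T R mu setT measurableT
  (fun n t => (nsq (f_ n t))%:E) (cst 0%E) (EFin \o h)
  (fun n => measurable_ensq (mf n)) (measurable_cst _) _ ih _.
- apply: aeW => t _; apply: cvg_EFin; first exact: nearW.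
  exact: f0.
- by apply: aeW => t n _ /=; rewrite lee_fin ger0_norm ?nsq_ge0.
by rewrite integral0.
Qed.

Definition cind (A : set T) : T -> R[i] := fun t => (\1_A t)%:C.

Lemma nsq_cind A t : nsq (cind A t) = \1_A t.
Proof. by rewrite /cind nsqC indicE; case: (t \in A); rewrite ?expr1n ?expr0n. Qed.

Lemma L2on_cind A : measurable A -> (mu A < +oo)%E -> L2on mu (cind A).
Proof.
move=> mA Aoo; split; first by apply: cmeasurableC; exact: measurable_indic.
by under eq_integral do rewrite nsq_cind; rewrite integral_indic//= setIT.
Qed.

End L2_dct.

Arguments cind {d T R} A.

Section L2_density.
Context {R : realType} {n : nat}.
Local Notation E := (Euclidean R n).
Local Notation leb := (lebesgue_Euclidean R n).

Definition big_cube (N : nat) : set E := [set t | forall i, `|tnth t i| < N%:R].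

Definition open_box (U : 'I_n -> set R) : set E := [set t | forall i, U i (tnth t i)].

Lemma big_cubeE N : big_cube N = open_box (fun=> ball (0 : R) N%:R).
Proof.
apply/seteqP; split => t /= h i; have := h i; rewrite /ball /=.
  by rewrite sub0r normrN.
by rewrite sub0r normrN.
Qed.

Lemma measurable_open_box U : (forall i, open (U i)) -> measurable (open_box U).
Proof.
move=> oU.
rewrite (_ : open_box U = \big[setI/setT]_(i < n) ((fun t => tnth t i) @^-1` U i)).
  apply: big_ind => // [A B mA mB|i _]; first exact: measurableI.
  rewrite -[X in measurable X]setTI.
  by apply: (measurable_tnth i) => //; exact: open_measurable.
apply/seteqP; split => t /=; rewrite -bigcap_seq /=.
  by move=> h i _; exact: h.
by move=> h i; apply: h => /=; rewrite mem_index_enum.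
Qed.

Lemma measurable_big_cube N : measurable (big_cube N).
Proof. by rewrite big_cubeE; apply: measurable_open_box => i; exact: ball_open. Qed.

(** Open boxes form a pi-system that generates the Borel sets, as Dynkin's
    lemma requires. *)
Lemma measurable_tupleE :
  @measurable _ E = <<s [set A | exists2 U, (forall i, open (U i)) & A = open_box U] >>.
Proof.
apply/seteqP; split; last first.
  apply: smallest_sub; first exact: sigma_algebra_measurable.
  by move=> _ [U oU ->]; exact: measurable_open_box.
apply: smallest_sub; first exact: smallest_sigma_algebra.
move=> A; rewrite -bigcup_seq => -[i _ [B mB <-]].
have mB' : (@RGenOpens.G R).-sigma.-measurable B.
  by rewrite -RGenOpens.measurableE.
have : preimage_set_system setT (fun t : E => tnth t i) (@RGenOpens.G R).-sigma.-measurable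
    (setT `&` (fun t : E => tnth t i) @^-1` B) by exists B.
rewrite -g_sigma_preimageE; apply: sub_sigma_algebra2 => _ [V [x [y ->]] <-].
exists (fun j => if j == i then `]x, y[%classic else setT).
  by move=> j; case: ifP => // _; exact: openT.
apply/seteqP; split => t /=.
  by move=> [_ h] j; case: eqP => [->|].
by move=> /(_ i); rewrite eqxx.
Qed.

Lemma lebesgue_big_cube N : (leb (big_cube N) < +oo)%E.
Proof.
pose c : R := (2 * N.+1%:R)^-1.
have c0 : c != 0 by rewrite invr_eq0 mulf_neq0.
pose v : 'cV[R]_n := const_mx 2^-1.
pose f (x : E) := ((in_cube (tadd v x))%:R : R)%:E.
have mf : measurable_fun setT f.
  apply: (measurableT_comp (f := fun x : E => ((in_cube x)%:R : R)%:E)).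
    by apply/measurable_EFinP; exact: measurable_in_cube.
  exact: measurable_tadd.
have f0 x : (0 <= f x)%E by rewrite lee_fin ler0n.
have dc : \det (c%:M : 'M[R]_n) != 0 by rewrite det_scalar expf_neq0.
have := ge0_integral_linear dc mf f0.
rewrite (ge0_integral_translation v (f := fun x : E => ((in_cube x)%:R : R)%:E))//; last first.
  by apply/measurable_EFinP; exact: measurable_in_cube.
rewrite integral_cube => X1.
have X2 : (\int[leb]_x f (tlin c%:M x) < +oo)%E.
  rewrite ltey; apply/eqP => Xoo; move: X1; rewrite Xoo gt0_muley//.
  by rewrite lte_fin normr_gt0.
apply: le_lt_trans X2.
have mQ := measurable_big_cube N.
rewrite -[leLHS]mul1e -[X in (_ * leb X)%E]setIT -integral_indic// mul1e.
apply: ge0_le_integral => //.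
- by apply/measurable_EFinP; exact: measurable_indic.
- by apply: measurableT_comp => //; exact: measurable_tlin.
- move=> x _; rewrite lee_fin indicE; have [|//] := boolP (x \in big_cube N).
  rewrite inE => Qx; rewrite (_ : in_cube _)//; apply/forallP => i.
  rewrite tnth_tadd tnth_mktuple mul_scalar_mx !mxE.
  have := Qx i; rewrite ltr_norml => /andP[h1 h2].
  have N1 : (N%:R : R) <= N.+1%:R by rewrite ler_nat.
  have Np : (0 : R) < 2 * N.+1%:R by rewrite mulr_gt0.
  have cp : 0 < c by rewrite invr_gt0.
  have cN : c * N.+1%:R = 2^-1 by rewrite /c invfM -mulrA mulVf ?mulr1 ?pnatr_eq0.
  move: (N.+1%:R : R) (N%:R : R) N1 Np cN h1 h2 => M K N1 Np cN h1 h2.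
  apply/andP; split; nra.
Qed.

(** Approximation by step functions on open boxes, in the form of an induction
    principle: Dynkin's lemma gives the measurable subsets of a bounded cube,
    and dominated convergence the rest. *)
Variable P : (E -> R[i]) -> Prop.
Local Notation ind := (@cind _ E R).
Local Notation q := (sqn (cip leb)).
Hypothesis PD : forall f g, L2on leb f -> L2on leb g -> P f -> P g -> P (f + g).
Hypothesis PZ : forall c f, L2on leb f -> P f -> P (scf c f).
Hypothesis Plim : forall f, L2on leb f ->
  (forall e : R, 0 < e -> exists g, [/\ L2on leb g, P g & q (f - g) < e]) -> P f.
Hypothesis Pbox : forall U, (forall i, open (U i)) ->
  (leb (open_box U) < +oo)%E -> P (ind (open_box U)).

Let H := cip_prehilbert leb.

Let L2cube A N : measurable A -> L2on leb (ind (A `&` big_cube N)).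
Proof.
move=> mA; apply: L2on_cind; first exact: measurableI _ (measurable_big_cube N).
apply: le_lt_trans (lebesgue_big_cube N); apply: le_measure; rewrite ?inE//.
- exact: measurableI _ (measurable_big_cube N).
- exact: measurable_big_cube.
Qed.

Let PQ N : P (ind (big_cube N)).
Proof.
by rewrite big_cubeE; apply: Pbox => [i|]; [exact: ball_open|rewrite -big_cubeE; exact: lebesgue_big_cube].
Qed.

Let LQ N : L2on leb (ind (big_cube N)).
Proof. by rewrite -[big_cube N]setTI; exact: L2cube. Qed.

Let P0 : P 0.
Proof.
rewrite (_ : 0 = scf 0 (ind (big_cube 0))); first exact: PZ.
by apply/funext => t; rewrite /scf mul0r.
Qed.

Let Psum I (r : seq I) (F : I -> E -> R[i]) :
  (forall i, L2on leb (F i)) -> (forall i, P (F i)) -> P (\sum_(i <- r) F i).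
Proof.
move=> LF PF.
suff : L2on leb (\sum_(i <- r) F i) /\ P (\sum_(i <- r) F i) by case.
elim: r => [|i r [IH1 IH2]]; first by rewrite !big_nil; split => //; exact: L2on0.
by rewrite !big_cons; split; [exact: L2onD|exact: PD].
Qed.

Let Pmeas A N : measurable A -> P (ind (A `&` big_cube N)).
Proof.
move=> mA; have := mA; rewrite measurable_tupleE; move: A mA => A0 _.
move: A0; apply: (@dynkin_induction _ E _ (fun A => P (ind (A `&` big_cube N)))).
- exact: measurable_tupleE.
- move=> A B [U oU ->] [V oV ->]; exists (fun i => U i `&` V i).
    by move=> i; exact: openI.
  by apply/seteqP; split => t /= => [[h1 h2] i|h]; [split|split => i; case: (h i)].
- by rewrite setTI.
- move=> _ [U oU ->].
  have UE : open_box U `&` big_cube N = open_box (fun i => U i `&` ball (0 : R) N%:R).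
    rewrite big_cubeE; apply/seteqP; split => t /= => [[h1 h2] i|h]; first by split.
    by split => i; case: (h i).
  have oUV i : open (U i `&` ball (0 : R) N%:R) by apply: openI => //; exact: ball_open.
  rewrite UE; apply: Pbox => //; apply: le_lt_trans (lebesgue_big_cube N).
  apply: le_measure; rewrite ?inE//; [exact: measurable_open_box|exact: measurable_big_cube|].
  by rewrite -UE; exact: subIsetr.
- move=> A mA PA.
  have -> : (ind (~` A `&` big_cube N) : E -> R[i]) = ind (big_cube N) + scf (-1) (ind (A `&` big_cube N)).
    apply: funext => t; change (ind (~` A `&` big_cube N) t =
       ind (big_cube N) t + (-1) * ind (A `&` big_cube N) t).
    rewrite /cind !indicE !in_setI in_setC.
    by case: (t \in A); case: (t \in big_cube N); rewrite /= ?mulr0 ?addr0 ?mulN1r ?subrr.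
  by apply: PD => //; [exact: L2onZ (L2cube _ mA)|exact: PZ (L2cube _ mA) _].
- move=> F mF tF PF.
  have mU : measurable (\bigcup_k F k) by exact: bigcupT_measurable.
  pose G m : E -> R[i] := ind ((\bigcup_(k in `I_m) F k) `&` big_cube N).
  have mS m : measurable (\bigcup_(k in `I_m) F k) by exact: bigcup_measurable.
  have GS m : G m.+1 = G m + ind (F m `&` big_cube N).
    apply: funext => t; change (G m.+1 t = G m t + ind (F m `&` big_cube N) t).
    rewrite /G /cind !indicE !in_setI.
    have [Ft|Ft] := pselect (F m t).
      have nF : ~ (\bigcup_(k in `I_m) F k) t.
        move=> [k km Fk]; have /trivIsetP/(_ k m I I) := tF.
        rewrite ltn_eqF// => /(_ erefl)/seteqP[/(_ t) h _]; exact: h.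
      rewrite (mem_set Ft) (memNset nF) (mem_set (_ : (\bigcup_(k in `I_m.+1) F k) t)).
        by rewrite /= add0r.
      by exists m => /=.
    rewrite (memNset Ft) /= addr0; congr ((_ && _)%:R%:C).
    have [Gt|Gt] := pselect ((\bigcup_(k in `I_m) F k) t).
      rewrite (mem_set Gt) mem_set//; case: Gt => k km Fk; exists k => //=.
      exact: ltnW.
    rewrite (memNset Gt) memNset// => -[k /= km Fk]; apply: Gt; exists k => //=.
    rewrite ltnS leq_eqVlt in km; case/orP: km => // /eqP km.
    by rewrite km in Fk.
  have PG m : P (G m).
    elim: m => [|m IH].
      rewrite (_ : G 0%N = 0) //; apply: funext => t.
      by rewrite /G /cind II0 bigcup_set0 set0I indic0.
    by rewrite GS; apply: PD => //; exact: L2cube.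
  have LG m : L2on leb (G m) by exact: L2cube.
  apply: Plim => [|e e0]; first exact: L2cube.
  have GE m t : G m t != ind ((\bigcup_k F k) `&` big_cube N) t ->
      [/\ big_cube N t, (\bigcup_k F k) t & forall k, (k < m)%N -> ~ F k t].
    rewrite /G /cind !indicE !in_setI.
    have [Qt|Qt] := pselect (big_cube N t); last by rewrite (memNset Qt) !andbF eqxx.
    rewrite (mem_set Qt) !andbT.
    have [Ut|Ut] := pselect ((\bigcup_k F k) t); last first.
      rewrite (memNset Ut) memNset ?eqxx// => -[k _ Fk]; apply: Ut; by exists k.
    rewrite (mem_set Ut); have [Vt|Vt] := pselect ((\bigcup_(k in `I_m) F k) t).
      by rewrite (mem_set Vt) eqxx.
    by move=> _; split => // k km Fk; apply: Vt; exists k.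
  have [||||M MP] := @L2_dct _ E R leb
    (fun m => ind ((\bigcup_k F k) `&` big_cube N) - G m) (\1_(big_cube N)) _ _ _ _ _ e0.
  - by move=> m; exact: (ph_domB H (L2cube N mU) (LG m)).1.
  - move=> t; apply: cvg_near_cst.
    have [[k _ Fk]|nU] := pselect ((\bigcup_k F k) t).
      exists k.+1 => // m /= km; apply/eqP; apply: contraT => h.
      have : G m t != ind ((\bigcup_k F k) `&` big_cube N) t.
        apply: contraNneq h => h; change (nsq (ind ((\bigcup_k F k) `&` big_cube N) t - G m t) == 0).
        by rewrite h subrr nsq0.
      by move=> /GE[_ _ /(_ k km)].
    exists 0%N => // m _; apply/eqP; apply: contraT => h.
    have : G m t != ind ((\bigcup_k F k) `&` big_cube N) t.
      apply: contraNneq h => h; change (nsq (ind ((\bigcup_k F k) `&` big_cube N) t - G m t) == 0).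
      by rewrite h subrr nsq0.
    by move=> /GE[_ /nU].
  - move=> m t; change (nsq (ind ((\bigcup_k F k) `&` big_cube N) t - G m t) <= \1_(big_cube N) t).
    have [<-|/GE[Qt _ _]] := eqVneq (G m t) (ind ((\bigcup_k F k) `&` big_cube N) t).
      by rewrite subrr nsq0.
    rewrite /G /cind !indicE !in_setI (mem_set Qt) !andbT.
    case: (_ \in _); case: (_ \in _); rewrite ?subrr ?subr0 ?sub0r ?nsqN ?nsq0 ?nsq1//.
  - have mQ := measurable_big_cube N; apply/integrableP; split.
      by apply/measurable_EFinP; exact: measurable_indic.
    under eq_integral do rewrite /= ger0_norm//.
    by rewrite integral_indic//= setIT; exact: lebesgue_big_cube.
  exists (G M); split => //; have := MP M (leqnn _).
  by rewrite -sqn_cip ?lte_fin//; exact: (ph_domB H (L2cube N mU) (LG M)).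
Qed.

Lemma eventually_big_cube (t : E) : exists N, forall m, (N <= m)%N -> big_cube m t.
Proof.
exists (\max_(i < n) (Num.trunc `|tnth t i|).+1)%N => m Nm i.
apply: lt_le_trans (truncnS_gt _) _; rewrite ler_nat; apply: leq_trans Nm.
exact: (leq_bigmax (F := fun i : 'I_n => (Num.trunc `|tnth t i|).+1)).
Qed.

Import HBNNSimple.

Let Pge0 (f : E -> R) : (forall t, 0 <= f t) ->
  L2on leb (fun t => (f t)%:C) -> P (fun t => (f t)%:C).
Proof.
move=> f0 Lf; have mf : measurable_fun setT f by exact: Lf.1.1.
have mEf : measurable_fun setT (EFin \o f) by exact/measurable_EFinP.
pose g := nnsfun_approx measurableT mEf.
have gf k t : g k t <= f t.
  rewrite -lee_fin nnsfun_approxE.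
  by apply: le_approx => // ? _; rewrite lee_fin.
have g0 k t : 0 <= g k t by exact: fun_ge0.
have gc t : (g k t) @[k --> \oo] --> f t.
  have := cvg_nnsfun_approx measurableT mEf (x := t) (fun t _ => f0 t) I.
  by move/fine_cvg.
pose G m : E -> R[i] := fun t => (g m t * \1_(big_cube m) t)%:C.
have mgy m y : measurable (g m @^-1` [set y]).
  by rewrite -[X in measurable X]setTI; exact: measurable_funP.
have GE m : G m = \sum_(y <- finmap.enum_fset (fset_set (range (g m))))
    scf y%:C (ind ((g m @^-1` [set y]) `&` big_cube m)).
  apply: funext => t; rewrite fct_sumE /G fimfunE fsbig_finite//= mulr_suml.
  rewrite rmorph_sum/=; apply: eq_bigr => y _.
  by rewrite /scf /cind !indicE in_setI -mulrA -natrM mulnb rmorphM.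
have LGy m y : L2on leb (scf y%:C (ind ((g m @^-1` [set y]) `&` big_cube m))).
  exact: L2onZ (L2cube _ (mgy m y)).
have PG m : P (G m).
  by rewrite GE; apply: Psum => // y; apply: PZ (L2cube _ (mgy m y)) (Pmeas _ (mgy m y)).
have LG m : L2on leb (G m).
  split.
    apply: cmeasurableC; apply: measurable_funM; first exact: measurable_funP.
    by apply: measurable_indic; exact: measurable_big_cube.
  apply: le_lt_trans Lf.2; apply: ge0_le_integral => //.
  - apply: measurable_ensq; apply: cmeasurableC; apply: measurable_funM; first exact: measurable_funP.
    by apply: measurable_indic; exact: measurable_big_cube.
  - by apply: measurable_ensq; exact: Lf.1.
  - move=> t _; rewrite lee_fin /G !nsqC ler_pXn2r ?nnegrE// ?mulr_ge0//.
    apply: le_trans (gf m t); rewrite ler_piMr// indicE; by case: (_ \in _).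
apply: Plim => // e e0.
have [||||M MP] := @L2_dct _ E R leb (fun m => (fun t => (f t)%:C) - G m)
    (fun t => nsq (f t)%:C) _ _ _ _ _ e0.
- by move=> m; exact: (ph_domB H Lf (LG m)).1.
- move=> t.
  have -> : (fun m => nsq (((fun t => (f t)%:C) - G m) t)) =
            (fun m => (f t - g m t * \1_(big_cube m) t) ^+ 2).
    by apply: funext => m; rewrite -nsqC rmorphB.
  have c1 : (\1_(big_cube m) t : R) @[m --> \oo] --> (1 : R).
    have [N NP] := eventually_big_cube t.
    apply: cvg_near_cst; exists N => // m /= Nm.
    by rewrite indicE mem_set//; exact: NP.
  have c2 : (f t - g m t * \1_(big_cube m) t) @[m --> \oo] --> (0 : R).
    rewrite -(subrr (f t)); apply: cvgB; first exact: cvg_cst.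
    by rewrite -[X in _ --> X]mulr1; exact: cvgM.
  rewrite -[X in _ --> X](mulr0 0); under eq_fun do rewrite expr2.
  exact: cvgM.
- move=> m t; change (nsq ((f t)%:C - (g m t * \1_(big_cube m) t)%:C) <= nsq (f t)%:C).
  rewrite -rmorphB !nsqC.
  have a1 : 0 <= g m t * \1_(big_cube m) t by rewrite mulr_ge0.
  have a2 : g m t * \1_(big_cube m) t <= f t.
    apply: le_trans (gf m t); rewrite ler_piMr// indicE; by case: (_ \in _).
  rewrite ler_pXn2r ?nnegrE ?subr_ge0// lerBlDr lerDl//.
- apply/integrableP; split; first by have := measurable_ensq Lf.1.
  under eq_integral do rewrite /= ger0_norm ?nsq_ge0//.
  by have := Lf.2.
exists (G M); split => //; have := MP M (leqnn _).
by rewrite -sqn_cip ?lte_fin//; exact: (ph_domB H Lf (LG M)).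
Qed.

Lemma L2_density f : L2on leb f -> P f.
Proof.
move=> Lf; have [[mR mI] _] := Lf.
have key (h : E -> R) : measurable_fun setT h -> (forall t, h t ^+ 2 <= nsq (f t)) ->
    L2on leb (fun t => (h t)%:C) /\ P (fun t => (h t)%:C).
  move=> mh hf.
  have pos (k : E -> R) : measurable_fun setT k -> (forall t, 0 <= k t) ->
     (forall t, k t ^+ 2 <= nsq (f t)) -> L2on leb (fun t => (k t)%:C) /\ P (fun t => (k t)%:C).
    move=> mk k0 kf.
    have Lk : L2on leb (fun t => (k t)%:C).
      split; first exact: cmeasurableC.
      apply: le_lt_trans Lf.2; apply: ge0_le_integral => //.
      - by apply: measurable_ensq; exact: cmeasurableC.
      - by apply: measurable_ensq; exact: Lf.1.
      - by move=> t _; rewrite lee_fin nsqC.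
    by split => //; exact: Pge0.
  have [|t|t|Lp Pp] := pos (fun t => Num.max (h t) 0).
  - by apply: measurable_maxr.
  - by rewrite le_max lexx orbT.
  - by rewrite /Num.max; case: ifP => _; rewrite ?expr0n/= ?nsq_ge0 ?hf.
  have [|t|t|Ln Pn] := pos (fun t => Num.max (- h t) 0).
  - by apply: measurable_maxr => //; exact: measurable_funN.
  - by rewrite le_max lexx orbT.
  - by rewrite /Num.max; case: ifP => _; rewrite ?sqrrN ?expr0n/= ?nsq_ge0 ?hf.
  have -> : (fun t => (h t)%:C) = (fun t => (Num.max (h t) 0)%:C)
       + scf (-1) (fun t => (Num.max (- h t) 0)%:C).
    apply: funext => t; change ((h t)%:C = (Num.max (h t) 0)%:C + (-1) * (Num.max (- h t) 0)%:C).
    rewrite mulN1r -rmorphN -rmorphD; congr (_%:C).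
    rewrite oppr_max oppr0 opprK.
    by case: ltP; case: leP => *; lra.
  by split; [exact: L2onD Lp (L2onZ _ Ln)|exact: PD Lp (L2onZ _ Ln) Pp (PZ _ Ln Pn)].
have [LR PR] := key _ mR (fun t => Re_sqr_le (f t)).
have [LI PI] := key _ mI (fun t => Im_sqr_le (f t)).
have -> : f = (fun t => (complex.Re (f t))%:C) + scf 'i (fun t => (complex.Im (f t))%:C).
  apply: funext => t; change (f t = (complex.Re (f t))%:C + 'i * (complex.Im (f t))%:C).
  exact: complexE.
exact: PD LR (L2onZ _ LI) PR (PZ _ LI PI).
Qed.

End L2_density.

(** * Continuity of translations in mean square *)

Section translation_L2.
Context {R : realType} {n : nat}.
Local Notation E := (Euclidean R n).
Local Notation leb := (lebesgue_Euclidean R n).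
Local Notation q := (sqn (cip leb)).
Implicit Types (f g : E -> R[i]) (v : 'cV[R]_n).

Definition ttrans v f : E -> R[i] := fun t => f (tadd v t).

Lemma integral_nsq_ttrans v f : cmeasurable f ->
  (\int[leb]_t (nsq (ttrans v f t))%:E = \int[leb]_t (nsq (f t))%:E)%E.
Proof.
move=> mf.
exact: (ge0_integral_translation v (measurable_ensq mf) (fun t => ensq_ge0 _)).
Qed.

Lemma L2on_ttrans v f : L2on leb f -> L2on leb (ttrans v f).
Proof.
move=> [mf f2]; split; last by rewrite integral_nsq_ttrans.
by apply: cmeasurable_comp => //; exact: measurable_tadd.
Qed.

Lemma sqn_ttrans v f : L2on leb f -> q (ttrans v f) = q f.
Proof.
move=> Lf; apply: EFin_inj; rewrite !sqn_cip//; last exact: L2on_ttrans.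
exact: integral_nsq_ttrans Lf.1.
Qed.

Let H := cip_prehilbert leb.

Lemma cvg_tadd_coord v (t : E) i :
  tnth (tadd (m.+1%:R^-1 *: v) t) i @[m --> \oo] --> tnth t i.
Proof.
rewrite -[X in _ --> X]add0r.
under eq_fun do rewrite tnth_tadd mxE.
apply: cvgD; last exact: cvg_cst.
rewrite -(mul0r (v i 0)); apply: cvgM; last exact: cvg_cst.
exact: cvg_harmonic.
Qed.

(** The indicator of an open box is pointwise continuous from inside, and its
    translates have the same norm; this forces convergence in norm. *)
Lemma ttrans_open_box v U (e : R) : (forall i, open (U i)) ->
  (leb (@open_box R n U) < +oo)%E -> 0 < e ->
  exists N, forall m, (N <= m)%N ->
    q (ttrans (m.+1%:R^-1 *: v) (cind (open_box U)) - cind (open_box U)) < e.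
Proof.
move=> oU Uoo e0; set B := open_box U.
have mB : measurable B by exact: measurable_open_box.
pose f : E -> R[i] := cind B.
have Lf : L2on leb f by exact: L2on_cind.
pose s m := m.+1%:R^-1 *: v.
pose h m : E -> R[i] := fun t => f t * (1 - ttrans (s m) f t).
have mT m : cmeasurable (ttrans (s m) f) by exact: (L2on_ttrans _ Lf).1.
have mh m : cmeasurable (h m).
  apply: cmeasurableM; first exact: Lf.1.
  rewrite (_ : (fun _ => _) = cst 1 + scf (-1) (ttrans (s m) f)).
    by apply: cmeasurableD; [exact: cmeasurable_cst|apply: cmeasurableM => //; exact: cmeasurable_cst].
  apply: funext => t; change (1 - ttrans (s m) f t = 1 + (-1) * ttrans (s m) f t); by rewrite mulN1r.
have hle m t : nsq (h m t) <= nsq (f t).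
  rewrite /h nsqM ler_piMr ?nsq_ge0// /f /ttrans /cind indicE.
  by case: (_ \in _); rewrite ?subrr ?subr0 ?nsq0 ?nsq1.
have [|||||N NP] := @L2_dct _ E R leb h (fun t => nsq (f t)) _ _ _ _ (e / 4).
- exact: mh.
- move=> t; apply: cvg_near_cst.
  have [Bt|nB] := pselect (B t); last first.
    by apply: nearW => m; rewrite /h /f /cind indicE memNset// mul0r nsq0.
  have nB : \forall m \near \oo, B (tadd (s m) t).
    apply: filter_forall => i; have /(_ (U i)) := @cvg_tadd_coord v t i; apply.
    by apply: open_nbhs_nbhs; split => //; exact: Bt.
  move: nB; apply: filterS => m Bm.
  by rewrite /h /ttrans /f /cind !indicE !mem_set// subrr mulr0 nsq0.
- exact: hle.
- apply/integrableP; split; first by have := measurable_ensq Lf.1.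
  under eq_integral do rewrite /= ger0_norm ?nsq_ge0//.
  by have := Lf.2.
- by rewrite divr_gt0.
exists N => m Nm.
have LT := L2on_ttrans (s m) Lf.
have LD := ph_domB H LT Lf.
have Lh : L2on leb (h m).
  split => //; apply: le_lt_trans Lf.2; apply: ge0_le_integral => //.
  - exact: measurable_ensq.
  - by apply: measurable_ensq; exact: Lf.1.
  - by move=> t _; rewrite lee_fin.
have key : q (ttrans (s m) f - f) + q f = q (ttrans (s m) f) + 2 * q (h m).
  apply: EFin_inj; rewrite !EFinD EFinM !sqn_cip//.
  rewrite -ge0_integralZl_EFin//; last exact: measurable_ensq.
  have mD := measurable_ensq LD.1; have mF := measurable_ensq Lf.1.
  have mTT := measurable_ensq (mT m); have mH := measurable_ensq (mh m).
  rewrite -!ge0_integralD//; last 2 first.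
  - by move=> t _; rewrite mule_ge0.
  - exact: measurable_funeM.
  apply: eq_integral => t _; rewrite -EFinM -!EFinD; congr (_%:E).
  change (nsq (f (tadd (s m) t) - f t) + nsq (f t) =
    nsq (f (tadd (s m) t)) + 2 * nsq (f t * (1 - f (tadd (s m) t)))).
  rewrite /f /cind !indicE; case: (_ \in _); case: (_ \in _); rewrite /nsq !reimE /=; ring.
rewrite sqn_ttrans// in key.
have := NP _ Nm; rewrite -sqn_cip// lte_fin => hm; rewrite -/f; lra.
Qed.

(** The functions whose translates converge form a closed subspace that
    contains the indicators of open boxes. *)
Lemma ttrans_continuous v f : L2on leb f -> forall e : R, 0 < e ->
  exists N, forall m, (N <= m)%N -> q (ttrans (m.+1%:R^-1 *: v) f - f) < e.
Proof.
pose P f := forall e : R, 0 < e ->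
  exists N, forall m, (N <= m)%N -> q (ttrans (m.+1%:R^-1 *: v) f - f) < e.
move: f; apply: (@L2_density R n P).
- move=> f g Lf Lg Pf Pg e e0.
  have e4 : 0 < e / 4 by rewrite divr_gt0.
  have [N NP] := Pf _ e4; have [M MP] := Pg _ e4.
  exists (maxn N M) => m; rewrite geq_max => /andP[/NP h1 /MP h2].
  set s := _ *: v in h1 h2 *.
  have -> : ttrans s (f + g) - (f + g) = (ttrans s f - f) + (ttrans s g - g).
    by rewrite -addrACA -opprD.
  have h3 := sqnD_le H (ph_domB H (L2on_ttrans s Lf) Lf) (ph_domB H (L2on_ttrans s Lg) Lg).
  by apply: le_lt_trans h3 _; lra.
- move=> c f Lf Pf e e0.
  have e4 : 0 < e / (nsq c + 1) by rewrite divr_gt0// ltr_wpDl// nsq_ge0.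
  have [N NP] := Pf _ e4; exists N => m /NP; set s := _ *: v.
  have -> : ttrans s (scf c f) - scf c f = scf c (ttrans s f - f).
    by apply: funext => t; rewrite /scf /= /ttrans -mulrBr.
  have LD := ph_domB H (L2on_ttrans s Lf) Lf.
  rewrite (sqnZ H c LD) ltr_pdivlMr ?ltr_wpDl ?nsq_ge0// => h.
  have := sqn_ge0 H LD; have := nsq_ge0 c; nra.
- move=> f Lf Pf e e0.
  have e4 : 0 < e / 20 by rewrite divr_gt0.
  have [g [Lg Pg gf]] := Pf _ e4.
  have [N NP] := Pg _ e4; exists N => m /NP; set s := _ *: v => h.
  have Lfg := ph_domB H Lf Lg.
  have -> : ttrans s f - f = (ttrans s (f - g) - (f - g)) + (ttrans s g - g).
    apply: funext => t.
    change (f (tadd s t) - f t =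
      f (tadd s t) - g (tadd s t) - (f t - g t) + (g (tadd s t) - g t)).
    ring.
  have LT := L2on_ttrans s Lfg.
  have h1 := sqnD_le H (ph_domB H LT Lfg) (ph_domB H (L2on_ttrans s Lg) Lg).
  have h2 := sqnB_le H LT Lfg; rewrite sqn_ttrans// in h2.
  apply: le_lt_trans h1 _; lra.
- by move=> U oU Uoo e e0; exact: ttrans_open_box.
Qed.

End translation_L2.

(** * The Poisson kernel on the line *)

Section line_integrals.
Context {R : realType}.

Lemma is_derive_scale (k x df : R) (f : R -> R) : is_derive x (1 : R) f df ->
  is_derive x (1 : R) (fun x => k * f x) (k * df).
Proof. by move=> h; have := @is_deriveZ R R R f k x 1 df h. Qed.

Lemma is_derive_add (x df dg : R) (f g : R -> R) : is_derive x (1 : R) f df ->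
  is_derive x (1 : R) g dg -> is_derive x (1 : R) (fun x => f x + g x) (df + dg).
Proof. by move=> hf hg; have := @is_deriveD R R R f g x 1 df dg hf hg. Qed.

Lemma is_derive_mul (x df dg : R) (f g : R -> R) : is_derive x (1 : R) f df ->
  is_derive x (1 : R) g dg ->
  is_derive x (1 : R) (fun x => f x * g x) (f x * dg + g x * df).
Proof. by move=> hf hg; have := @is_deriveM R R f g x 1 df dg hf hg. Qed.

Lemma is_derive_lin (k x : R) : is_derive x (1 : R) (fun x : R => k * x) k.
Proof.
have := is_derive_scale k (is_derive_id x (1 : R)); by rewrite mulr1.
Qed.

Local Notation mu := (@lebesgue_measure R).

(** Reduces an integral over the line to the half-line, where the fundamental
    theorem of calculus is available for nonnegative functions. *)
Lemma ge0_integral_even_part (f S : R -> R) : (forall x, 0 <= f x) ->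
  continuous f -> (forall x, S x = 2^-1 * (f x + f (- x))) ->
  (\int[mu]_x (f x)%:E = 2%:E * \int[mu]_(x in `[0%R, +oo[) (S x)%:E)%E.
Proof.
move=> f0 cf fS.
have S0 x : 0 <= S x by rewrite fS mulr_ge0 ?addr_ge0.
have cfN : continuous (f \o -%R).
  by move=> x; apply: continuous_comp; [exact: opp_continuous|exact: cf].
have cS : continuous S.
  rewrite (_ : S = fun x => 2^-1 * (f x + (f \o -%R) x)); last exact/funext.
  by move=> x; apply: cvgM; [exact: cvg_cst|apply: cvgD; [exact: cf|exact: cfN]].
have mf : measurable_fun setT (EFin \o f).
  by apply/measurable_EFinP; exact: continuous_measurable_fun.
have mfN : measurable_fun setT (EFin \o (f \o -%R)).
  by apply/measurable_EFinP; exact: continuous_measurable_fun.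
have fe0 x : (0 <= (EFin \o f) x)%E by rewrite lee_fin.
have E1 : (\int[mu]_x (f x)%:E = \int[mu]_x ((f \o -%R) x)%:E)%E.
  have n10 : (-1 : R) != 0 by rewrite oppr_eq0 oner_eq0.
  rewrite [LHS](ge0_integral_affine 0 n10 mf fe0) normrN1 mul1e.
  by apply: eq_integral => x _ /=; rewrite mulN1r addr0.
transitivity (\int[mu]_x (S x)%:E)%E.
  under [RHS]eq_integral do rewrite fS EFinM.
  rewrite ge0_integralZl_EFin//; last 2 first.
  - by move=> x _; rewrite lee_fin addr_ge0.
  - under eq_fun do rewrite EFinD; exact: emeasurable_funD.
  under [in RHS]eq_integral do rewrite EFinD.
  have fN0 x : (0 <= (f (- x))%:E)%E by rewrite lee_fin.
  have fP0 x : (0 <= (f x)%:E)%E by rewrite lee_fin.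
  rewrite ge0_integralD//.
  rewrite [X in (_ * (_ + X))%E](_ : _ = \int[mu]_x (f x)%:E)%E; last first.
    by rewrite E1.
  case: (\int[mu]_x _)%E => [r| |].
  - by rewrite -EFinD -EFinM; congr (_%:E); field.
  - by rewrite addye// gt0_muley// lte_fin invr_gt0.
  - by rewrite addNye gt0_muleNy// lte_fin invr_gt0.
have eS : S =1 S \o -%R by move=> x /=; rewrite !fS opprK addrC.
apply: etrans (ge0_symfun_integralT S0 cS eS) _.
by rewrite -set_itvcy.
Qed.

Lemma is_derive_exp_cos (c b A B x : R) : 0 < c ->
  is_derive x (1 : R) (fun x : R => expR (- (c * x)) *
     (- A / c + B * (- c * cos (b * x) + b * sin (b * x)) / (c ^+ 2 + b ^+ 2)))
   (expR (- (c * x)) * (A + B * cos (b * x))).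
Proof.
move=> c0.
have h : c ^+ 2 + b ^+ 2 != 0.
  by rewrite gt_eqF// ltr_pwDl ?exprn_gt0 ?sqr_ge0.
have dl k := is_derive_lin k x.
have dc : is_derive x (1 : R) (fun x => cos (b * x)) (- sin (b * x) * b).
  exact: (@is_derive1_comp _ cos (fun x => b * x)).
have ds : is_derive x (1 : R) (fun x => sin (b * x)) (cos (b * x) * b).
  exact: (@is_derive1_comp _ sin (fun x => b * x)).
have de : is_derive x (1 : R) (fun x => expR (- (c * x))) (expR (- (c * x)) * - c).
  have := @is_derive1_comp _ expR (fun x => - c * x) x _ _ _ (dl (- c)).
  rewrite (_ : expR \o _ = (fun x => expR (- (c * x)))) ?mulNr.
    by apply; exact: is_derive_expR.
  by apply: funext => y /=; rewrite mulNr.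
have d1 := is_derive_add (is_derive_scale (- c) dc) (is_derive_scale b ds).
have d2 := is_derive_add (is_derive_cst (- A / c) x (1 : R))
  (is_derive_scale (B / (c ^+ 2 + b ^+ 2)) d1).
have d3 := is_derive_mul de d2.
rewrite (_ : (fun x => _) = (fun x => expR (- (c * x)) * (- A / c +
     (B / (c ^+ 2 + b ^+ 2)) * (- c * cos (b * x) + b * sin (b * x))))); last first.
  by apply: funext => y; rewrite [in RHS]mulrAC.
apply: is_derive_eq d3 _.
rewrite /cst/=; field. by rewrite h gt_eqF.
Qed.

Lemma cvg_exp_decay (c : R) : 0 < c -> expR (- (c * x)) @[x --> +oo] --> (0 : R).
Proof.
move=> c0.
rewrite (_ : (fun x => expR (- (c * x))) = (fun z => expR (- z)) \o (fun z => c * z))//.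
apply: (@cvg_comp _ _ _ _ _ _ (pinfty_nbhs R)); last exact: cvgr_expR.
exact: gt0_cvgMry.
Qed.

(** The one-dimensional Fourier integral of the two-sided exponential, with a
    constant [A] added so that the integrand is nonnegative. *)
Lemma integral_exp_cos (c b A B th : R) : 0 < c -> `|B| <= A ->
  (\int[mu]_x (expR (- (c * `|x|)) * (A + B * cos (b * x + th)))%:E =
   (2 * A / c + B * (2 * c / (c ^+ 2 + b ^+ 2)) * cos th)%:E)%E.
Proof.
move=> c0 BA.
have pos (y B' : R) : `|B'| <= A -> 0 <= A + B' * cos y.
  move=> B'A; have : `|B' * cos y| <= A.
    rewrite normrM (le_trans _ B'A)// ler_piMr//.
    by rewrite ler_norml cos_geN1 cos_le1.
  by rewrite ler_norml => /andP[? _]; lra.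
have BthA : `|B * cos th| <= A.
  rewrite normrM (le_trans _ BA)// ler_piMr//.
  by rewrite ler_norml cos_geN1 cos_le1.
have h : c ^+ 2 + b ^+ 2 != 0.
  by rewrite gt_eqF// ltr_pwDl ?exprn_gt0 ?sqr_ge0.
have clin (k : R) : continuous (fun x : R => k * x).
  by move=> x; apply: cvgM; [exact: cvg_cst|exact: cvg_id].
have cexp : continuous (fun x : R => expR (- (c * `|x|))).
  move=> x; apply: continuous_comp; last exact: continuous_expR.
  by apply: cvgN; apply: cvgM; [exact: cvg_cst|exact: norm_continuous].
have ccos (B' th' : R) : continuous (fun x : R => A + B' * cos (b * x + th')).
  move=> x; apply: cvgD; first exact: cvg_cst.
  apply: cvgM; first exact: cvg_cst.
  apply: continuous_comp; last exact: continuous_cos.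
  by apply: cvgD; [exact: clin|exact: cvg_cst].
apply: etrans (@ge0_integral_even_part _
  (fun x => expR (- (c * `|x|)) * (A + (B * cos th) * cos (b * x))) _ _ _) _.
- by move=> x; rewrite mulr_ge0 ?expR_ge0 ?pos.
- by move=> x; apply: cvgM; [exact: cexp|exact: ccos].
- by move=> x; rewrite normrN mulrN !cosD cosN sinN; field.
transitivity (2%:E * \int[mu]_(x in `[0%R, +oo[) (expR (- (c * x)) *
   (A + (B * cos th) * cos (b * x)))%:E)%E.
  congr (_ * _)%E; apply: eq_integral => x.
  by rewrite inE/= in_itv/= andbT => x0; rewrite ger0_norm.
pose F (x : R) := expR (- (c * x)) *
  (- A / c + (B * cos th) * (- c * cos (b * x) + b * sin (b * x)) / (c ^+ 2 + b ^+ 2)).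
have dF x : is_derive x (1 : R) F (expR (- (c * x)) * (A + (B * cos th) * cos (b * x))).
  exact: is_derive_exp_cos.
have cF : continuous F.
  by move=> x; apply: differentiable_continuous; apply/derivable1_diffP; exact: (@ex_derive _ _ _ _ _ _ _ (dF x)).
rewrite (@ge0_continuous_FTC2y _ _ F 0 0).
- rewrite /F !mulr0 cos0 sin0 oppr0 expR0 mul1r mulr0 addr0 mulr1 -EFinB -EFinM.
  congr (_%:E); field; by rewrite h gt_eqF.
- by move=> x x0; rewrite mulr_ge0 ?expR_ge0 ?pos.
- apply: continuous_subspaceT => x; apply: cvgM.
    apply: continuous_comp; last exact: continuous_expR.
    by apply: cvgN; exact: clin.
  by have := ccos (B * cos th) 0 x; under eq_fun do rewrite addr0.
- pose M := `|A / c| + `|B * cos th| * (c + `|b|) / (c ^+ 2 + b ^+ 2).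
  have bnd x : `|F x| <= expR (- (c * x)) * M.
    rewrite /F normrM ger0_norm ?expR_ge0// ler_wpM2l ?expR_ge0//.
    rewrite (le_trans (ler_normD _ _))// mulNr normrN lerD2l.
    rewrite normrM [`|_ * _|]normrM [`|(_ + _)^-1|]ger0_norm; last first.
      by rewrite invr_ge0 addr_ge0 ?sqr_ge0.
    rewrite ler_wpM2r ?invr_ge0 ?addr_ge0 ?sqr_ge0// ler_wpM2l//.
    apply: le_trans (ler_normD _ _) _; rewrite !normrM normrN (gtr0_norm c0).
    by apply: lerD; apply: ler_piMr => //;
      rewrite ?(ltW c0)// ler_norml ?cos_geN1 ?cos_le1 ?sin_geN1 ?sin_le1.
  have l0 : expR (- (c * x)) * M @[x --> +oo] --> (0 : R).
    by rewrite -(mul0r M); apply: cvgM; [exact: cvg_exp_decay|exact: cvg_cst].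
  apply: (@squeeze_cvgr _ _ _ _ (fun x => - (expR (- (c * x)) * M)) (fun x => expR (- (c * x)) * M)).
  + by apply: nearW => x; rewrite -ler_norml.
  + by rewrite -oppr0; exact: cvgN.
  + exact: l0.
- by move=> x _; exact: (@ex_derive _ _ _ _ _ _ _ (dF x)).
- exact/cvg_at_right_filter/cF.
- by move=> x _; rewrite derive1E (@derive_val _ _ _ _ _ _ _ (dF x)).
Qed.

(** The Fourier transform of the two-sided exponential
    [x |-> exp (- 2 pi e |x|)]. *)
Definition poisson (e s : R) : R := pi^-1 * (e / (e ^+ 2 + s ^+ 2)).

Lemma poisson_ge0 e s : 0 < e -> 0 <= poisson e s.
Proof.
move=> e0; rewrite /poisson mulr_ge0 ?invr_ge0 ?pi_ge0//.
by rewrite divr_ge0 ?(ltW e0)// addr_ge0 ?sqr_ge0.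
Qed.

Lemma continuous_poisson e : 0 < e -> continuous (poisson e).
Proof.
move=> e0 x; apply: cvgM; first exact: cvg_cst.
apply: cvgM; first exact: cvg_cst.
apply: cvgV; first by rewrite gt_eqF// ltr_pwDl ?exprn_gt0 ?sqr_ge0.
by apply: cvgD; [exact: cvg_cst|exact: exprn_continuous].
Qed.

Lemma integral_poisson e : 0 < e -> (\int[mu]_x (poisson e x)%:E = 1)%E.
Proof.
move=> e0.
have dl := is_derive_lin.
pose F (x : R) := pi^-1 * atan (e^-1 * x).
have dF x : is_derive x (1 : R) F (poisson e x).
  have d1 : is_derive x (1 : R) (fun x => atan (e^-1 * x)) ((1 + (e^-1 * x) ^+ 2)^-1 * e^-1).
    exact: (@is_derive1_comp _ atan (fun x => e^-1 * x)).
  apply: is_derive_eq (is_derive_scale pi^-1 d1) _.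
  rewrite /poisson; congr (_ * _); field.
  by rewrite (gt_eqF e0) andbT gt_eqF// ltr_pwDl ?exprn_gt0 ?sqr_ge0.
have cF : continuous F.
  by move=> x; apply: differentiable_continuous; apply/derivable1_diffP; exact: (@ex_derive _ _ _ _ _ _ _ (dF x)).
apply: etrans (@ge0_integral_even_part _ (poisson e) _ _ _) _.
- by move=> x; exact: poisson_ge0.
- exact: continuous_poisson.
- move=> x; rewrite /poisson sqrrN; move: (pi^-1) (e / _) => a b; by field.
rewrite (@ge0_continuous_FTC2y _ _ F 0 (pi^-1 * (pi / 2))).
- rewrite /F mulr0 atan0 mulr0 -EFinB -EFinM; congr (_%:E); have := pi_gt0 R; move: (pi : R) => p pp.
  by field; rewrite gt_eqF.
- by move=> x _; exact: poisson_ge0.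
- by apply: continuous_subspaceT; exact: continuous_poisson.
- apply: cvgM; first exact: cvg_cst.
  apply: (@cvg_comp _ _ _ (fun x => e^-1 * x) (@atan R) _ (pinfty_nbhs R)); last exact: cvgy_atan.
  by apply: gt0_cvgMry => //; rewrite invr_gt0.
- by move=> x _; exact: (@ex_derive _ _ _ _ _ _ _ (dF x)).
- exact/cvg_at_right_filter/cF.
- by move=> x _; rewrite derive1E (@derive_val _ _ _ _ _ _ _ (dF x)).
Qed.

End line_integrals.

(** * The Poisson kernel on Euclidean space *)

Section parametric_cintegral.
Context d1 d2 (X : measurableType d1) (Y : measurableType d2) (R : realType).
Variable m2 : {sigma_finite_measure set Y -> \bar R}.

Lemma measurable_parametric_Rintegral (g : X * Y -> R) : measurable_fun setT g ->
  measurable_fun setT (fun x => \int[m2]_y g (x, y)).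
Proof.
move=> mg; rewrite /Rintegral; apply: measurableT_comp => //.
have mEg : measurable_fun setT (EFin \o g) by exact/measurable_EFinP.
under eq_fun do rewrite integralE.
apply: emeasurable_funB.
- have h := @measurable_fun_fubini_tonelli_F _ _ _ _ _ m2 _
    (measurable_funepos mEg) (fun=> funepos_ge0 _ _).
  by apply: (eq_measurable_fun _ _ h) => x _; apply: eq_integral => y _; rewrite ?funeposE ?funenegE.
- have h := @measurable_fun_fubini_tonelli_F _ _ _ _ _ m2 _
    (measurable_funeneg mEg) (fun=> funeneg_ge0 _ _).
  by apply: (eq_measurable_fun _ _ h) => x _; apply: eq_integral => y _; rewrite ?funeposE ?funenegE.
Qed.

(** The real and imaginary parts are differences of two integrals of
    nonnegative functions, to which Tonelli's theorem applies. *)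
Lemma cmeasurable_parametric (G : X * Y -> R[i]) : cmeasurable G ->
  cmeasurable (fun x => cintegral m2 (fun y => G (x, y))).
Proof.
move=> [mR mI]; split.
- exact: (measurable_parametric_Rintegral mR).
- exact: (measurable_parametric_Rintegral mI).
Qed.

End parametric_cintegral.

Section complex_more.
Context {R : realType}.

Lemma expiD (a b : R) : expi (a + b) = expi a * expi b.
Proof. by apply: complexP; rewrite !reimE ?cosD ?sinD; ring. Qed.
Lemma expi0 : expi (0 : R) = 1.
Proof. by apply: complexP; rewrite !reimE ?cos0 ?sin0. Qed.
Lemma expiN (a : R) : expi (- a) = (expi a)^*%R.
Proof. by apply: complexP; rewrite !reimE ?cosN ?sinN. Qed.
Lemma nsq_expi (a : R) : nsq (expi a) = 1.
Proof. by rewrite /nsq !reimE cos2Dsin2. Qed.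

Lemma normc_ge0 (z : R[i]) : 0 <= normc z.
Proof. by case: z => a b; rewrite sqrtr_ge0. Qed.

Lemma normc_nsq (z : R[i]) : normc z = Num.sqrt (nsq z).
Proof. by case: z. Qed.

Lemma cReN_le_normc (z : R[i]) : - normc z <= complex.Re z.
Proof.
rewrite lerNl; apply: le_trans (ler_norm _) _; rewrite normrN.
rewrite -(ler_pXn2r (n := 2)) ?nnegrE ?normc_ge0// real_normK ?num_real// -nsqE.
exact: Re_sqr_le.
Qed.

Lemma normc_le_ReIm (z : R[i]) : normc z <= `|complex.Re z| + `|complex.Im z|.
Proof.
rewrite -(ler_pXn2r (n := 2)) ?nnegrE ?normc_ge0 ?addr_ge0// -nsqE /nsq sqrrD.
rewrite !real_normK ?num_real//; have := mulr_ge0 (normr_ge0 (complex.Re z)) (normr_ge0 (complex.Im z)).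
lra.
Qed.

(** Turns the cross term of [|F^|^2] into a cosine with a phase, the form in
    which [integral_abel_cos] computes integrals. *)
Lemma polar_form (z : R[i]) : exists th : R, z = (normc z)%:C * expi th.
Proof.
have [->|z0] := eqVneq z 0; first by exists 0; rewrite normc0 mul0r.
have n0 : 0 < normc z.
  rewrite lt0r normc_ge0 andbT; apply: contraNneq z0 => h.
  by apply/eqP; exact: eq0_normc.
set a := complex.Re z / normc z; set b := complex.Im z / normc z.
have ab : a ^+ 2 + b ^+ 2 = 1.
  rewrite /a /b !expr_div_n -mulrDl -/(nsq z) nsqE divff// expf_neq0//.
  by rewrite gt_eqF.
have a1 : -1 <= a <= 1.
  have : a ^+ 2 <= 1 by rewrite -ab lerDl sqr_ge0.
  by move=> h; rewrite -ler_norml -(ler_pXn2r (n := 2)) ?nnegrE// real_normK ?num_real// expr1n.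
have sq : sin (acos a) ^+ 2 = b ^+ 2.
  have := cos2Dsin2 (acos a); rewrite acosK//; lra.
have zE s : s = b -> z = (normc z)%:C * (a +i* s).
  have nz : normc z != 0 by rewrite gt_eqF.
  move=> ->; apply: complexP.
    by rewrite !reimE mul0r subr0 mulrC divfK.
  by rewrite !reimE mul0r addr0 mulrC divfK.
have /orP[/eqP bs|/eqP bs] : (sin (acos a) == b) || (sin (acos a) == - b).
  by rewrite -eqf_sqr; apply/eqP.
- by exists (acos a); rewrite /expi acosK//; exact: zE.
- by exists (- acos a); rewrite /expi cosN sinN acosK//; apply: zE; rewrite bs opprK.
Qed.

End complex_more.

Section poisson_euclidean.
Context {R : realType}.
Local Notation E n := (Euclidean R n).
Local Notation leb n := (lebesgue_Euclidean R n).

Definition edot n (w t : E n) : R := \sum_(i < n) tnth w i * tnth t i.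

Definition abel_weight n (e : R) (w : E n) : R :=
  \prod_(i < n) expR (- (2 * pi * e * `|tnth w i|)).

Definition poisson_kernel n (e : R) (s : E n) : R := \prod_(i < n) poisson e (tnth s i).

Lemma EconsP n (s : E n.+1) : exists x y, s = Econs x y.
Proof. by exists (thead s), (behead_tuple s); apply: val_inj => /=; case: s => -[|a l]. Qed.

Lemma edot_Econs n x y (w t : E n) : edot (Econs x w) (Econs y t) = x * y + edot w t.
Proof.
rewrite /edot big_ord_recl; congr (_ + _).
by apply: eq_bigr => i _; rewrite !tnth_EconsS.
Qed.

Lemma abel_weight_Econs n e x (w : E n) : abel_weight e (Econs x w) =
  expR (- (2 * pi * e * `|x|)) * abel_weight e w.
Proof.
rewrite /abel_weight big_ord_recl; congr (_ * _).
by apply: eq_bigr => i _; rewrite !tnth_EconsS.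
Qed.

Lemma poisson_kernel_Econs n e x (w : E n) : poisson_kernel e (Econs x w) =
  poisson e x * poisson_kernel e w.
Proof.
rewrite /poisson_kernel big_ord_recl; congr (_ * _).
by apply: eq_bigr => i _; rewrite !tnth_EconsS.
Qed.

Lemma abel_weight_ge0 n e (w : E n) : 0 <= abel_weight e w.
Proof. by apply: prodr_ge0 => i _; exact: expR_ge0. Qed.

Lemma poisson_kernel_ge0 n e (w : E n) : 0 < e -> 0 <= poisson_kernel e w.
Proof. by move=> e0; apply: prodr_ge0 => i _; exact: poisson_ge0. Qed.

Lemma measurable_abel_weight n e : measurable_fun setT (@abel_weight n e).
Proof.
apply: measurable_prod => i _; apply: measurableT_comp => //.
apply: measurable_funN; apply: measurable_funM => //.
by apply: measurableT_comp => //; exact: measurable_tnth.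
Qed.

Lemma measurable_poisson_kernel n e : 0 < e ->
  measurable_fun setT (@poisson_kernel n e).
Proof.
move=> e0; apply: measurable_prod => i _; apply: (measurableT_comp (f := poisson e)).
  by apply: continuous_measurable_fun; exact: continuous_poisson.
exact: measurable_tnth.
Qed.

Lemma measurable_edot n d (T : measurableType d) (u v : T -> E n) :
  measurable_fun setT u -> measurable_fun setT v ->
  measurable_fun setT (fun t => edot (u t) (v t)).
Proof.
move=> mu mv; apply: measurable_sum => i; apply: measurable_funM.
- exact: (measurableT_comp (measurable_tnth i) mu).
- exact: (measurableT_comp (measurable_tnth i) mv).
Qed.

Definition abel_mass (e : R) : R := (pi * e)^-1.

Lemma poisson_le_mass e s : 0 < e -> poisson e s <= abel_mass e.
Proof.
move=> e0; rewrite /poisson /abel_mass invfM ler_wpM2l ?invr_ge0 ?pi_ge0//.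
rewrite ler_pdivrMr ?ltr_pwDl ?exprn_gt0 ?sqr_ge0// mulrDr expr2 mulrA mulVf ?gt_eqF// mul1r.
by rewrite lerDl mulr_ge0 ?sqr_ge0// invr_ge0 ltW.
Qed.

Lemma poisson_kernel_le_mass n e (s : E n) : 0 < e ->
  poisson_kernel e s <= abel_mass e ^+ n.
Proof.
move=> e0; rewrite /poisson_kernel -[n in leRHS]card_ord -prodr_const.
by apply: ler_prod => i _; rewrite poisson_ge0//= poisson_le_mass.
Qed.

(** The Fourier transform of the Abel weight is the Poisson kernel.  The
    constant [A] keeps the integrand nonnegative, so that Tonelli's theorem
    applies in the induction on the dimension. *)
Lemma integral_abel_cos n (e A B th : R) (s : E n) : 0 < e -> `|B| <= A ->
  (\int[leb n]_w (abel_weight e w * (A + B * cos (2 * pi * edot w s + th)))%:E =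
   (A * abel_mass e ^+ n + B * poisson_kernel e s * cos th)%:E)%E.
Proof.
move=> e0; elim: n A B th s => [|n IH] A B th s BA.
  rewrite integral_Euclidean0; last first.
    apply/measurable_EFinP; rewrite (_ : (fun _ => _) = cst (A + B * cos th)) //.
    by apply: funext => w; rewrite /abel_weight /edot !big_ord0 mul1r mulr0 add0r.
  rewrite /abel_weight /edot /poisson_kernel !big_ord0 mul1r mulr0 add0r expr0.
  by rewrite !mulr1.
have p2 : 0 < 2 * pi * e by rewrite !mulr_gt0// pi_gt0.
have pos (y B' A' : R) : `|B'| <= A' -> 0 <= A' + B' * cos y.
  move=> B'A; have : `|B' * cos y| <= A'.
    rewrite normrM (le_trans _ B'A)// ler_piMr//.
    by rewrite ler_norml cos_geN1 cos_le1.
  by rewrite ler_norml => /andP[? _]; lra.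
have [x [y ->]] := EconsP s.
have mI k (s' : E k) C D th' : measurable_fun setT (fun w : E k =>
    (abel_weight e w * (C + D * cos (2 * pi * edot w s' + th')))%:E).
  apply/measurable_EFinP; apply: measurable_funM; first exact: measurable_abel_weight.
  apply: measurable_funD => //; apply: measurable_funM => //.
  apply: measurableT_comp; first by apply: continuous_measurable_fun; exact: continuous_cos.
  apply: measurable_funD => //; apply: measurable_funM => //.
  exact: measurable_edot.
rewrite ge0_integral_Econs//; last first.
  by move=> w; rewrite lee_fin mulr_ge0 ?abel_weight_ge0 ?pos.
have A0 : 0 <= A by exact: le_trans (normr_ge0 _) BA.
transitivity (\int[lebesgue_measure]_u (expR (- (2 * pi * e * `|u|)) *
    (A * abel_mass e ^+ n + B * poisson_kernel e y * cos (2 * pi * x * u + th)))%:E)%E.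
  apply: eq_integral => u _.
  transitivity (\int[leb n]_w ((expR (- (2 * pi * e * `|u|)))%:E *
     (abel_weight e w * (A + B * cos (2 * pi * edot w y + (2 * pi * x * u + th))))%:E))%E.
    apply: eq_integral => w _; rewrite abel_weight_Econs edot_Econs -EFinM mulrA.
    congr ((_ * (_ + _ * cos _))%:E); ring.
  rewrite ge0_integralZl_EFin//.
  - by rewrite IH.
  - by move=> w _; rewrite lee_fin mulr_ge0 ?abel_weight_ge0 ?pos.
  - exact: mI.
rewrite integral_exp_cos//; last first.
  rewrite normrM (ger0_norm (poisson_kernel_ge0 _ e0)).
  by apply: ler_pM => //; [exact: poisson_kernel_ge0|exact: poisson_kernel_le_mass].
rewrite poisson_kernel_Econs; congr (_%:E).
have pp := pi_gt0 R.
have -> : 2 * (A * abel_mass e ^+ n) / (2 * pi * e) = A * (abel_mass e * abel_mass e ^+ n).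
  rewrite /abel_mass; move: ((_^-1) ^+ n) => z; move: (pi : R) pp p2 => p pp p2.
  by field; rewrite !gt_eqF.
have -> : 2 * (2 * pi * e) / ((2 * pi * e) ^+ 2 + (2 * pi * x) ^+ 2) = poisson e x.
  rewrite /poisson; move: (pi : R) pp p2 => p pp p2.
  have -> : (2 * p * e) ^+ 2 + (2 * p * x) ^+ 2 = (2 * p) ^+ 2 * (e ^+ 2 + x ^+ 2) by ring.
  have h1 : 0 < e ^+ 2 + x ^+ 2 by rewrite ltr_pwDl ?exprn_gt0 ?sqr_ge0.
  by move: (_ + _) h1 => h h1; field; rewrite !gt_eqF.
by rewrite exprS (mulrC (poisson e x) (poisson_kernel e y)) !mulrA.
Qed.

Lemma integral_poisson_kernel n e : 0 < e ->
  (\int[leb n]_s (poisson_kernel e s)%:E = 1)%E.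
Proof.
move=> e0; elim: n => [|n IH].
  rewrite integral_Euclidean0; last first.
    by apply/measurable_EFinP; exact: measurable_poisson_kernel.
  by rewrite /poisson_kernel big_ord0.
have mK k : measurable_fun setT (fun s : E k => (poisson_kernel e s)%:E).
  by apply/measurable_EFinP; exact: measurable_poisson_kernel.
rewrite ge0_integral_Econs//; last by move=> s; rewrite lee_fin poisson_kernel_ge0.
transitivity (\int[lebesgue_measure]_x (poisson e x)%:E)%E; last exact: integral_poisson.
apply: eq_integral => x _.
transitivity (\int[leb n]_y ((poisson e x)%:E * (poisson_kernel e y)%:E))%E.
  by apply: eq_integral => y _; rewrite poisson_kernel_Econs EFinM.
rewrite ge0_integralZl_EFin//.
- by rewrite IH mule1.
- by move=> y _; rewrite lee_fin poisson_kernel_ge0.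
- exact: mK.
- exact: poisson_ge0.
Qed.

End poisson_euclidean.

(** * The Plancherel theorem *)

Section real_parts.
Context d (T : measurableType d) (R : realType) (mu : {measure set T -> \bar R}).

Lemma EFin_Rintegral (h : T -> R) : mu.-integrable setT (fun t => (h t)%:E) ->
  (\int[mu]_t (h t)%:E = (\int[mu]_t h t)%:E)%E.
Proof. by move=> ih; rewrite /Rintegral fineK//; exact: integrable_fin_num. Qed.

Lemma integrableZl_EFin (k : R) (h : T -> R) : mu.-integrable setT (fun t => (h t)%:E) ->
  mu.-integrable setT (fun t => (k * h t)%:E).
Proof.
by move=> ih; apply: eq_integrable (integrableZl measurableT k ih) => // t _; rewrite EFinM.
Qed.

Lemma integrableD_EFin (h k : T -> R) : mu.-integrable setT (fun t => (h t)%:E) ->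
  mu.-integrable setT (fun t => (k t)%:E) ->
  mu.-integrable setT (fun t => (h t + k t)%:E).
Proof.
by move=> ih ik; apply: eq_integrable (integrableD measurableT ih ik) => // t _; rewrite EFinD.
Qed.

Lemma measurable_normc (G : T -> R[i]) : cmeasurable G ->
  measurable_fun setT (fun t => normc (G t)).
Proof.
move=> mG; under eq_fun do rewrite normc_nsq.
apply: measurableT_comp; last exact: measurable_nsq.
by apply: continuous_measurable_fun; exact: sqrt_continuous.
Qed.

Lemma integrable_normc (G : T -> R[i]) : cintegrable mu G ->
  mu.-integrable setT (fun t => (normc (G t))%:E).
Proof.
move=> [i1 i2].
have mG : cmeasurable G.
  by split; apply/measurable_EFinP; [case/integrableP: i1|case/integrableP: i2].
apply: (@le_integrable _ _ _ _ _ measurableT _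
   (fun t => (`|complex.Re (G t)|%:E + `|complex.Im (G t)|%:E)%E)).
- by apply/measurable_EFinP; exact: measurable_normc.
- move=> t _; rewrite -EFinD /= lee_fin ger0_norm ?normc_ge0// [leRHS]ger0_norm ?addr_ge0//.
  exact: normc_le_ReIm.
- by apply: integrableD => //; exact: integrable_norm.
Qed.

Lemma integral_normc_Re (G : T -> R[i]) (k : R) (c : R[i]) : cintegrable mu G ->
  (\int[mu]_t (k * normc (G t) + complex.Re (G t * c))%:E =
   (k * \int[mu]_t normc (G t) + complex.Re (cintegral mu G * c))%:E)%E.
Proof.
move=> iG; have [i1 i2] := iG; have i3 := integrable_normc iG.
have E1 t : k * normc (G t) + complex.Re (G t * c) = k * normc (G t) +
   (complex.Re c * complex.Re (G t) + (- complex.Im c) * complex.Im (G t)).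
  by rewrite !reimE; ring.
under eq_integral do rewrite E1.
have j1 := integrableZl_EFin k i3.
have j2 := integrableZl_EFin (complex.Re c) i1.
have j3 := integrableZl_EFin (- complex.Im c) i2.
have j4 := integrableD_EFin j2 j3.
rewrite EFin_Rintegral; last exact: integrableD_EFin.
rewrite RintegralD// RintegralD// !RintegralZl//; congr (_%:E).
by rewrite cReM cRe_cintegral cIm_cintegral; ring.
Qed.

End real_parts.

Lemma addeIr (R : realType) (a : R) (x y : \bar R) :
  (a%:E + x = a%:E + y -> x = y)%E.
Proof.
by move: x y => [x| |] [y| |]//=; rewrite -?EFinD// => -[] /addrI ->.
Qed.

Section double_integrals.
Context {d1 d2 : measure_display} {X : measurableType d1} {Y : measurableType d2}.
Context {R : realType} {mu : {measure set X -> \bar R}}.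
Context {nu : {sigma_finite_measure set Y -> \bar R}}.
Implicit Types A B : X -> Y -> R.

Let inner_measurable A : (forall s t, 0 <= A s t) ->
  measurable_fun setT (fun p : X * Y => A p.1 p.2) ->
  measurable_fun setT (fun s => \int[nu]_t (A s t)%:E)%E.
Proof.
move=> A0 /measurable_EFinP mA.
apply: (@measurable_fun_fubini_tonelli_F _ _ _ _ _ nu _ mA) => p.
by rewrite lee_fin.
Qed.

Let inner_slice A s : measurable_fun setT (fun p : X * Y => A p.1 p.2) ->
  measurable_fun setT (fun t => (A s t)%:E).
Proof. by move=> /measurable_EFinP mA; exact: (measurableT_comp mA (pair1_measurable s)). Qed.

Lemma double_integralD A B : (forall s t, 0 <= A s t) -> (forall s t, 0 <= B s t) ->
  measurable_fun setT (fun p : X * Y => A p.1 p.2) ->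
  measurable_fun setT (fun p : X * Y => B p.1 p.2) ->
  (\int[mu]_s \int[nu]_t (A s t + B s t)%:E =
   \int[mu]_s \int[nu]_t (A s t)%:E + \int[mu]_s \int[nu]_t (B s t)%:E)%E.
Proof.
move=> A0 B0 mA mB.
have pA s t : [set: Y] t -> (0 <= (A s t)%:E)%E by rewrite lee_fin.
have pB s t : [set: Y] t -> (0 <= (B s t)%:E)%E by rewrite lee_fin.
have qA s : [set: X] s -> (0 <= \int[nu]_t (A s t)%:E)%E by move=> _; apply: integral_ge0 => t; exact: pA.
have qB s : [set: X] s -> (0 <= \int[nu]_t (B s t)%:E)%E by move=> _; apply: integral_ge0 => t; exact: pB.
rewrite -(ge0_integralD mu measurableT qA (inner_measurable A0 mA) qB (inner_measurable B0 mB)).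
apply: eq_integral => s _.
rewrite -(ge0_integralD nu measurableT (pA s) (inner_slice s mA) (pB s) (inner_slice s mB)).
by apply: eq_integral.
Qed.

Lemma double_integralZ A (k : R) : 0 <= k -> (forall s t, 0 <= A s t) ->
  measurable_fun setT (fun p : X * Y => A p.1 p.2) ->
  (\int[mu]_s \int[nu]_t (k * A s t)%:E = k%:E * \int[mu]_s \int[nu]_t (A s t)%:E)%E.
Proof.
move=> k0 A0 mA.
have pA s t : [set: Y] t -> (0 <= (A s t)%:E)%E by rewrite lee_fin.
have qA s : [set: X] s -> (0 <= \int[nu]_t (A s t)%:E)%E by move=> _; apply: integral_ge0 => t; exact: pA.
rewrite -(ge0_integralZl_EFin mu measurableT qA (inner_measurable A0 mA) k0).
apply: eq_integral => s _.
rewrite -(ge0_integralZl_EFin nu measurableT (pA s) (inner_slice s mA) k0).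
by apply: eq_integral.
Qed.

End double_integrals.

Section plancherel.
Context {R : realType} {n : nat}.
Local Notation E := (Euclidean R n).
Local Notation leb := (lebesgue_Euclidean R n).
Local Notation q := (sqn (cip leb)).

Definition fourier (F : E -> R[i]) (w : E) : R[i] :=
  cintegral leb (fun t => F t * (expi (2 * pi * edot t w))^*).

Variable F : E -> R[i].
Hypotheses (LF : L2on leb F) (iF : cintegrable leb F).

Let G w t := F t * (expi (2 * pi * edot t w))^*.

Let cmG d (T : measurableType d) (w t : T -> E) : measurable_fun setT w ->
  measurable_fun setT t -> cmeasurable (fun p => G (w p) (t p)).
Proof.
move=> mw mt; apply: cmeasurableM; first exact: (cmeasurable_comp LF.1 mt).
apply: cmeasurableJ; apply: cmeasurable_expi; apply: measurable_funM => //.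
exact: measurable_edot.
Qed.

Let normcG w t : normc (G w t) = normc (F t).
Proof. by rewrite /G !normc_nsq nsqM nsqJ nsq_expi mulr1. Qed.

Let iG w : cintegrable leb (G w).
Proof.
have mG : cmeasurable (G w) by apply: cmG => //; exact: measurable_cst.
have iN := integrable_normc iF.
split; apply: le_integrable iN => //.
- by apply/measurable_EFinP; exact: mG.1.
- move=> t _ /=; rewrite lee_fin [leRHS]ger0_norm ?normc_ge0// -(normcG w).
  rewrite -(ler_pXn2r (n := 2)) ?nnegrE ?normc_ge0// real_normK ?num_real// -nsqE.
  exact: Re_sqr_le.
- by apply/measurable_EFinP; exact: mG.2.
- move=> t _ /=; rewrite lee_fin [leRHS]ger0_norm ?normc_ge0// -(normcG w).
  rewrite -(ler_pXn2r (n := 2)) ?nnegrE ?normc_ge0// real_normK ?num_real// -nsqE.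
  exact: Im_sqr_le.
Qed.

Lemma cmeasurable_fourier : cmeasurable (fourier F).
Proof.
exact: (@cmeasurable_parametric _ _ _ _ _ leb (fun wt : E * E => G wt.1 wt.2) (cmG measurable_fst measurable_snd)).
Qed.

Let N := \int[leb]_t normc (F t).

Let cross w s t := normc (F s) * normc (F t) + complex.Re (G w t * (G w s)^*).

Let cross_ge0 w s t : 0 <= cross w s t.
Proof.
have := cReN_le_normc (G w t * (G w s)^*).
rewrite normcM [normc (_^*)]normc_nsq nsqJ -normc_nsq !normcG /cross mulrC.
by rewrite -subr_ge0 opprK addrC.
Qed.

(** Adding the product of the norms to the cross term of [|F^(w)|^2] makes it
    nonnegative; the constant cancels at the end. *)
Let integral_cross w :
  (\int[leb]_s \int[leb]_t (cross w s t)%:E = (N * N + nsq (fourier F w))%:E)%E.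
Proof.
transitivity (\int[leb]_s (N * normc (G w s) + complex.Re (G w s * (fourier F w)^*))%:E)%E.
  apply: eq_integral => s _; rewrite normcG.
  under eq_integral => t _ do rewrite /cross -[in X in _ * X](normcG w t).
  rewrite (integral_normc_Re _ _ (iG w)); congr ((_ + _)%:E).
    rewrite mulrC; congr (_ * _); apply: eq_Rintegral => t _; exact: normcG.
  by rewrite !reimE; ring.
rewrite (integral_normc_Re _ _ (iG w)) -/(fourier F w) mulcJ; congr ((_ * _ + _)%:E).
by apply: eq_Rintegral => t _; exact: normcG.
Qed.

Let tsub (s t : E) : E := tadd (- tcol s) t.

Let mtsub d (T : measurableType d) (s t : T -> E) : measurable_fun setT s ->
  measurable_fun setT t -> measurable_fun setT (fun p => tsub (s p) (t p)).
Proof.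
move=> ms mt; apply: measurable_ctup => i; under eq_fun do rewrite !mxE.
apply: measurable_funD; first apply: measurable_funN.
- exact: (measurableT_comp (measurable_tnth i) ms).
- exact: (measurableT_comp (measurable_tnth i) mt).
Qed.

Let edot_tsub w s t : edot w (tsub s t) = edot t w - edot s w.
Proof.
rewrite /edot -sumrB; apply: eq_bigr => i _; rewrite tnth_tadd !mxE; ring.
Qed.

Section fixed_scale.
Variables (e : R) (e0 : 0 < e).
Local Notation W := (@abel_weight R n e).
Local Notation K := (@poisson_kernel R n e).
Let m := abel_mass e ^+ n.

Let integral_weight_cross s t :
  (\int[leb]_w (W w * cross w s t)%:E =
   (normc (F s) * normc (F t) * m + K (tsub s t) * complex.Re (F t * (F s)^*))%:E)%E.
Proof.
set r := normc (F s) * normc (F t).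
have [th zE] := polar_form (F t * (F s)^*).
have rE : normc (F t * (F s)^*) = r.
  by rewrite normcM [normc (_^*)]normc_nsq nsqJ -normc_nsq mulrC.
rewrite rE in zE.
have r0 : 0 <= r by rewrite mulr_ge0 ?normc_ge0.
transitivity (\int[leb]_w (W w * (r + r * cos (2 * pi * edot w (tsub s t) + - th)))%:E)%E.
  apply: eq_integral => w _; congr ((_ * (_ + _))%:E).
  have -> : G w t * (G w s)^* = (r%:C * expi th) * (expi (2 * pi * edot w (tsub s t)))^*.
    rewrite -zE edot_tsub mulrBr expiD expiN /G !rmorphM/= !conjCK; ring.
  rewrite -expiN -mulrA -expiD; set y := th + _.
  rewrite !reimE mul0r subr0; congr (_ * _).
  by rewrite -cosN /y opprD opprK addrC.
rewrite integral_abel_cos ?(ger0_norm r0)//; congr (_%:E); congr (_ + _).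
by rewrite zE !reimE mul0r subr0 cosN; ring.
Qed.

Let mcross d (T : measurableType d) (w s t : T -> E) : measurable_fun setT w ->
  measurable_fun setT s -> measurable_fun setT t ->
  measurable_fun setT (fun p => (W (w p) * cross (w p) (s p) (t p))%:E).
Proof.
move=> mw ms mt; apply/measurable_EFinP; apply: measurable_funM.
  exact: (measurableT_comp (@measurable_abel_weight R n e) mw).
apply: measurable_funD.
  by apply: measurable_funM; apply: measurable_normc; [exact: (cmeasurable_comp LF.1 ms)|exact: (cmeasurable_comp LF.1 mt)].
have := cmeasurableM (cmG mw mt) (cmeasurableJ (cmG mw ms)).
by case.
Qed.

Let tonelli_cross :
  (\int[leb]_w (W w * (N * N + nsq (fourier F w)))%:E =
   \int[leb]_s \int[leb]_t
     (normc (F s) * normc (F t) * m + K (tsub s t) * complex.Re (F t * (F s)^*))%:E)%E.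
Proof.
have c0 w s t : (0 <= (W w * cross w s t)%:E)%E.
  by rewrite lee_fin mulr_ge0 ?abel_weight_ge0 ?cross_ge0.
transitivity (\int[leb]_w \int[leb]_s \int[leb]_t (W w * cross w s t)%:E)%E.
  apply: eq_integral => w _; rewrite EFinM -integral_cross.
  have mc2 : measurable_fun setT (fun st : E * E => (cross w st.1 st.2)%:E).
    apply/measurable_EFinP; apply: measurable_funD.
      apply: measurable_funM; apply: measurable_normc.
      - exact: (cmeasurable_comp LF.1 measurable_fst).
      - exact: (cmeasurable_comp LF.1 measurable_snd).
    have := cmeasurableM (cmG (measurable_cst w) measurable_snd)
      (cmeasurableJ (cmG (measurable_cst w) measurable_fst)).
    by case.
  rewrite -ge0_integralZl_EFin ?abel_weight_ge0//; last 2 first.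
  - by move=> s _; apply: integral_ge0 => t _; rewrite lee_fin cross_ge0.
  - exact: (@measurable_fun_fubini_tonelli_F _ _ _ _ _ leb (fun st => (cross w st.1 st.2)%:E) mc2
      (fun st => cross_ge0 _ _ _)).
  apply: eq_integral => s _.
  rewrite -ge0_integralZl_EFin ?abel_weight_ge0//; last 2 first.
  - by move=> t _; rewrite lee_fin cross_ge0.
  - exact: (measurableT_comp mc2 (pair1_measurable s)).
have mws : measurable_fun setT (fun ws : E * E => \int[leb]_t (W ws.1 * cross ws.1 ws.2 t)%:E)%E.
  apply: (@measurable_fun_fubini_tonelli_F _ _ _ _ _ leb
    (fun p : (E * E) * E => (W p.1.1 * cross p.1.1 p.1.2 p.2)%:E)) => //.
  apply: mcross => //.
  - exact: (measurableT_comp measurable_fst measurable_fst).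
  - exact: (measurableT_comp measurable_snd measurable_fst).
transitivity (\int[leb]_s \int[leb]_w \int[leb]_t (W w * cross w s t)%:E)%E.
  apply: (@fubini_tonelli _ _ _ _ _ leb leb
    (fun ws => \int[leb]_t (W ws.1 * cross ws.1 ws.2 t)%:E)%E mws) => ws.
  exact: integral_ge0.
apply: eq_integral => s _.
transitivity (\int[leb]_t \int[leb]_w (W w * cross w s t)%:E)%E.
  apply: (@fubini_tonelli _ _ _ _ _ leb leb (fun wt => (W wt.1 * cross wt.1 s wt.2)%:E)) => //.
  by apply: mcross => //; exact: measurable_cst.
by apply: eq_integral => t _; rewrite integral_weight_cross.
Qed.

Let mK d (T : measurableType d) (s t : T -> E) : measurable_fun setT s ->
  measurable_fun setT t -> measurable_fun setT (fun p => K (tsub (s p) (t p))).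
Proof.
move=> ms mt; exact: (measurableT_comp (@measurable_poisson_kernel R n e e0) (mtsub ms mt)).
Qed.

Let N0 : 0 <= N. Proof. by apply: Rintegral_ge0 => t _; exact: normc_ge0. Qed.

(** The squared modulus of continuity of [F] in mean square. *)
Definition translation_defect (u : E) : \bar R :=
  (\int[leb]_s (nsq (F (tadd (tcol u) s) - F s))%:E)%E.

Let translation_defect_ge0 u : (0 <= translation_defect u)%E.
Proof. exact: integral_ge0. Qed.

Let mKF d (T : measurableType d) (u s : T -> E) : measurable_fun setT u ->
  measurable_fun setT s -> measurable_fun setT
  (fun p => (K (u p) * nsq (F (tadd (tcol (u p)) (s p)) - F (s p)))%:E).
Proof.
move=> mu ms; apply/measurable_EFinP; apply: measurable_funM.
  exact: (measurableT_comp (@measurable_poisson_kernel R n e e0) mu).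
apply: measurable_nsq; apply: cmeasurableB.
  apply: (cmeasurable_comp LF.1 (h := fun p => tadd (tcol (u p)) (s p))).
  apply: measurable_ctup => i; under eq_fun do rewrite !mxE.
  apply: measurable_funD.
  - exact: (measurableT_comp (measurable_tnth i) mu).
  - exact: (measurableT_comp (measurable_tnth i) ms).
exact: (cmeasurable_comp LF.1 ms).
Qed.

Let K0 u : 0 <= K u. Proof. exact: poisson_kernel_ge0. Qed.

Let defect_double_integral :
  (\int[leb]_u ((K u)%:E * translation_defect u) =
   \int[leb]_s \int[leb]_t (K (tsub s t) * nsq (F t - F s))%:E)%E.
Proof.
transitivity (\int[leb]_u \int[leb]_s (K u * nsq (F (tadd (tcol u) s) - F s))%:E)%E.
  apply: eq_integral => u _; rewrite -ge0_integralZl_EFin//.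
    by apply: measurable_ensq; apply: (ph_domB (cip_prehilbert leb) (L2on_ttrans (tcol u) LF) LF).1.
transitivity (\int[leb]_s \int[leb]_u (K u * nsq (F (tadd (tcol u) s) - F s))%:E)%E.
  apply: (@fubini_tonelli _ _ _ _ _ leb leb
    (fun us => (K us.1 * nsq (F (tadd (tcol us.1) us.2) - F us.2))%:E)).
    exact: mKF.
  by move=> x; rewrite lee_fin mulr_ge0 ?nsq_ge0.
apply: eq_integral => s _.
rewrite -[LHS](ge0_integral_translation (- tcol s)); last 2 first.
- by apply: mKF => //; exact: measurable_cst.
- by move=> x; rewrite lee_fin mulr_ge0 ?nsq_ge0.
apply: eq_integral => t _; congr ((K _ * nsq (F _ - _))%:E).
by rewrite /tadd ctupK addrC addNKr tcolK || rewrite /tadd ctupK addrAC addNr add0r tcolK.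
Qed.

Let integral_K s : (\int[leb]_t (K (tsub s t))%:E = 1)%E.
Proof.
rewrite -(integral_poisson_kernel n e0).
apply: (ge0_integral_translation (- tcol s) (f := fun t => (K t)%:E)).
- by apply/measurable_EFinP; exact: measurable_poisson_kernel.
- by move=> x; rewrite lee_fin.
Qed.

Let K_sym s t : K (tsub s t) = K (tsub t s).
Proof.
apply: eq_bigr => i _; rewrite !tnth_tadd !mxE /poisson.
by have -> : (- tnth s i + tnth t i) ^+ 2 = (- tnth t i + tnth s i) ^+ 2 by ring.
Qed.

(** Plancherel's identity regularised by the Abel weight, with its exact
    error term.  Writing [|F^(w)|^2] as a double integral over [s] and [t],
    integrating [w] first gives [K (t - s) Re (F t * conj (F s))], which equals
    [K (t - s) (|F t|^2 + |F s|^2 - |F t - F s|^2) / 2]; and [K] has integral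
    [1]. *)
Lemma abel_plancherel :
  (\int[leb]_w (W w * nsq (fourier F w))%:E +
   (2^-1)%:E * \int[leb]_u ((K u)%:E * translation_defect u) = (q F)%:E)%E.
Proof.
have m0 : 0 <= m by rewrite exprn_ge0// invr_ge0 mulr_ge0 ?pi_ge0 ?ltW.
have mW : measurable_fun setT (fun w => (W w)%:E).
  by apply/measurable_EFinP; exact: measurable_abel_weight.
have mnF := measurable_ensq LF.1.
have E1 : (\int[leb]_w (W w * (N * N + nsq (fourier F w)))%:E =
    (m * (N * N))%:E + \int[leb]_w (W w * nsq (fourier F w))%:E)%E.
  have E0 : (\int[leb]_w (W w * (N * N))%:E = (m * (N * N))%:E)%E.
    have := @integral_abel_cos R n e (N * N) 0 0 (ctup 0) e0.
    rewrite normr0 mulr_ge0// => /(_ isT) E0.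
    transitivity ((N * N * abel_mass e ^+ n + 0 * K (ctup 0) * cos 0)%:E : \bar R)%E.
      by rewrite -E0; apply: eq_integral => w _; rewrite mul0r addr0.
    by rewrite !mul0r addr0 mulrC.
  rewrite -E0 -ge0_integralD//.
  - by apply: eq_integral => w _; rewrite -EFinD mulrDr.
  - by move=> w _; rewrite lee_fin mulr_ge0 ?abel_weight_ge0 ?mulr_ge0.
  - apply/measurable_EFinP; apply: measurable_funM => //.
    exact: measurable_abel_weight.
  - by move=> w _; rewrite lee_fin mulr_ge0 ?abel_weight_ge0 ?nsq_ge0.
  - apply/measurable_EFinP; apply: measurable_funM.
      exact: measurable_abel_weight.
    exact: measurable_nsq cmeasurable_fourier.
pose S1 s t := normc (F s) * normc (F t) * m + K (tsub s t) * complex.Re (F t * (F s)^*).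
pose S2 s t := 2^-1 * (K (tsub s t) * nsq (F t - F s)).
pose S3 s t := normc (F s) * normc (F t) * m.
pose S4 s t := 2^-1 * (K (tsub s t) * nsq (F t)).
pose S5 s t := 2^-1 * (K (tsub s t) * nsq (F s)).
have SE s t : S1 s t + S2 s t = S3 s t + (S4 s t + S5 s t).
  rewrite /S1 /S2 /S3 /S4 /S5 -addrA; congr (_ + _).
  rewrite -!mulrDr mulrCA -mulrDr; rewrite [in RHS]mulrCA; congr (_ * _).
  by rewrite /nsq !reimE; field.
have s1 s t : 0 <= S1 s t.
  rewrite -lee_fin /S1 -integral_weight_cross; apply: integral_ge0 => w _.
  by rewrite lee_fin mulr_ge0 ?abel_weight_ge0 ?cross_ge0.
have s2 s t : 0 <= S2 s t by rewrite !mulr_ge0 ?invr_ge0 ?nsq_ge0.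
have s3 s t : 0 <= S3 s t by rewrite !mulr_ge0 ?normc_ge0.
have s4 s t : 0 <= S4 s t by rewrite !mulr_ge0 ?invr_ge0 ?nsq_ge0.
have s5 s t : 0 <= S5 s t by rewrite !mulr_ge0 ?invr_ge0 ?nsq_ge0.
have mfs := cmeasurable_comp LF.1 (@measurable_fst _ _ E E).
have mft := cmeasurable_comp LF.1 (@measurable_snd _ _ E E).
have mKK : measurable_fun setT (fun p : E * E => K (tsub p.1 p.2)) by exact: mK.
have mS3 : measurable_fun setT (fun p : E * E => S3 p.1 p.2).
  by apply: measurable_funM => //; apply: measurable_funM; exact: measurable_normc.
have mS1 : measurable_fun setT (fun p : E * E => S1 p.1 p.2).
  apply: measurable_funD => //; apply: measurable_funM => //.
  by have [] := cmeasurableM mft (cmeasurableJ mfs).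
have mS4 : measurable_fun setT (fun p : E * E => S4 p.1 p.2).
  by apply: measurable_funM => //; apply: measurable_funM => //; exact: measurable_nsq mft.
have mS5 : measurable_fun setT (fun p : E * E => S5 p.1 p.2).
  by apply: measurable_funM => //; apply: measurable_funM => //; exact: measurable_nsq mfs.
have mS2 : measurable_fun setT (fun p : E * E => S2 p.1 p.2).
  apply: measurable_funM => //; apply: measurable_funM => //; apply: measurable_nsq.
  exact: cmeasurableB mft mfs.
have mK1 s : measurable_fun setT (fun t => (K (tsub s t))%:E).
  by apply/measurable_EFinP; apply: mK => //; exact: measurable_cst.
have h0 : (0 : R) <= 2^-1 by rewrite invr_ge0.
have mKB : measurable_fun setT (fun p : E * E => K (tsub p.1 p.2) * nsq (F p.2 - F p.1)).
  apply: measurable_funM => //; apply: measurable_nsq; exact: cmeasurableB mft mfs.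
have I2 : (\int[leb]_s \int[leb]_t (S2 s t)%:E =
   (2^-1)%:E * \int[leb]_u ((K u)%:E * translation_defect u))%E.
  rewrite defect_double_integral; apply: (double_integralZ (A := fun s t => K (tsub s t) * nsq (F t - F s))) => //.
    by move=> s t; rewrite mulr_ge0 ?nsq_ge0.
have I5 : (\int[leb]_s \int[leb]_t (S5 s t)%:E = (2^-1 * q F)%:E)%E.
  rewrite (double_integralZ (A := fun s t => K (tsub s t) * nsq (F s)))//; last 2 first.
  - by move=> s t; rewrite mulr_ge0 ?nsq_ge0.
  - by apply: measurable_funM => //; exact: measurable_nsq mfs.
  rewrite EFinM sqn_cip//; congr (_ * _)%E; apply: eq_integral => s _.
  transitivity (\int[leb]_t ((nsq (F s))%:E * (K (tsub s t))%:E))%E.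
    by apply: eq_integral => t _; rewrite mulrC.
  rewrite ge0_integralZl_EFin ?nsq_ge0//; last by move=> t _; rewrite lee_fin.
  by rewrite integral_K mule1.
have I4 : (\int[leb]_s \int[leb]_t (S4 s t)%:E = (2^-1 * q F)%:E)%E.
  rewrite -I5; transitivity (\int[leb]_t \int[leb]_s (S4 s t)%:E)%E.
    apply: (@fubini_tonelli _ _ _ _ _ leb leb (fun p => (S4 p.1 p.2)%:E)).
      exact/measurable_EFinP.
    by move=> st; rewrite lee_fin.
  by apply: eq_integral => s _; apply: eq_integral => t _; rewrite /S4 /S5 K_sym.
have I3 : (\int[leb]_s \int[leb]_t (S3 s t)%:E = (m * (N * N))%:E)%E.
  have iN := integrable_normc iF.
  have mn : measurable_fun setT (fun t => (normc (F t))%:E).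
    by apply/measurable_EFinP; exact: measurable_normc LF.1.
  transitivity (\int[leb]_s ((m * N)%:E * (normc (F s))%:E))%E.
    apply: eq_integral => s _.
    transitivity (\int[leb]_t ((m * normc (F s))%:E * (normc (F t))%:E))%E.
      by apply: eq_integral => t _; rewrite -EFinM; congr (_%:E); rewrite /S3; ring.
    rewrite ge0_integralZl_EFin ?mulr_ge0 ?normc_ge0//.
      by rewrite (EFin_Rintegral iN) -!EFinM -/N; congr (_%:E); ring.
    by move=> t _; rewrite lee_fin normc_ge0.
  rewrite ge0_integralZl_EFin ?mulr_ge0//.
    by rewrite (EFin_Rintegral iN) -!EFinM -/N mulrA.
  by move=> t _; rewrite lee_fin normc_ge0.
have T1 := tonelli_cross; rewrite E1 in T1.
have : ((m * (N * N))%:E + (\int[leb]_w (W w * nsq (fourier F w))%:E +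
   (2^-1)%:E * \int[leb]_u ((K u)%:E * translation_defect u)) = (m * (N * N))%:E + (q F)%:E)%E.
  rewrite addeA T1 -I2 -(double_integralD s1 s2 mS1 mS2).
  under eq_integral do under eq_integral do rewrite SE.
  have s45 s t : 0 <= S4 s t + S5 s t by rewrite addr_ge0.
  rewrite (double_integralD s3 s45 mS3 (measurable_funD mS4 mS5)) (double_integralD s4 s5 mS4 mS5).
  by rewrite I3 I4 I5 -!EFinD; congr (_%:E); field.
exact: addeIr.
Qed.

End fixed_scale.

Let H := cip_prehilbert leb.
Let defect u : translation_defect u = (q (ttrans (tcol u) F - F))%:E.
Proof. by rewrite sqn_cip//; exact: (ph_domB H (L2on_ttrans _ LF) LF). Qed.

Let measurable_defect : measurable_fun setT translation_defect.
Proof.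
apply: (@measurable_fun_fubini_tonelli_F _ _ _ _ _ leb
  (fun us : E * E => (nsq (F (tadd (tcol us.1) us.2) - F us.2))%:E)) => //.
apply/measurable_EFinP; apply: measurable_nsq; apply: cmeasurableB.
  apply: (cmeasurable_comp LF.1 (h := fun p : E * E => tadd (tcol p.1) p.2)).
  apply: measurable_ctup => i; under eq_fun do rewrite !mxE.
  apply: measurable_funD.
  - exact: (measurableT_comp (measurable_tnth i) measurable_fst).
  - exact: (measurableT_comp (measurable_tnth i) measurable_snd).
exact: (cmeasurable_comp LF.1 measurable_snd).
Qed.

Let measurable_rdefect : measurable_fun setT (fun u => q (ttrans (tcol u) F - F)).
Proof. by apply/measurable_EFinP; move: measurable_defect; apply: eq_measurable_fun => u _; rewrite defect. Qed.

(** Rescaling moves the small parameter from the kernel to the translation,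
    so that dominated convergence applies with a fixed dominating kernel. *)
Let scale_kernel (e : R) : 0 < e ->
  (\int[leb]_u ((@poisson_kernel R n e u)%:E * translation_defect u) =
   \int[leb]_u (@poisson_kernel R n 1 u * q (ttrans (e *: tcol u) F - F))%:E)%E.
Proof.
move=> e0; have dE : \det (e%:M : 'M[R]_n) = e ^+ n by rewrite det_scalar.
have d0 : \det (e%:M : 'M[R]_n) != 0 by rewrite dE expf_neq0// gt_eqF.
have ft (u : E) : (0 <= (@poisson_kernel R n e u)%:E * translation_defect u)%E.
  by rewrite mule_ge0 ?lee_fin ?poisson_kernel_ge0//; exact: integral_ge0.
have mf : measurable_fun setT (fun u : E => (@poisson_kernel R n e u)%:E * translation_defect u)%E.
  by apply: emeasurable_funM => //; apply/measurable_EFinP; exact: measurable_poisson_kernel.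
rewrite (ge0_integral_linear d0 mf ft) dE ger0_norm ?exprn_ge0 ?ltW//.
have k0 : 0 <= e ^+ n by rewrite exprn_ge0 ?ltW.
apply: etrans (esym (ge0_integralZl_EFin leb measurableT
  (fun u _ => ft (tlin e%:M u)) (measurableT_comp mf (measurable_tlin _)) k0)) _.
apply: eq_integral => u _; rewrite defect -!EFinM mulrA /tlin ctupK mul_scalar_mx.
congr ((_ * _)%:E); rewrite /poisson_kernel -[X in e ^+ X]card_ord -prodr_const -big_split/=.
apply: eq_bigr => i _; rewrite tnth_mktuple !mxE /poisson expr1n.
move: (tnth u i) => x.
have h0 : 1 + x ^+ 2 != 0 by rewrite gt_eqF// ltr_pwDl ?sqr_ge0.
have h1 : e ^+ 2 + (e * x) ^+ 2 != 0 by
  (have -> : e ^+ 2 + (e * x) ^+ 2 = e ^+ 2 * (1 + x ^+ 2) by ring);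
  rewrite mulf_neq0// expf_neq0// gt_eqF.
by rewrite mulrCA; congr (_ * _); field; rewrite h0 h1.
Qed.

Let defect_small (a : R) : 0 < a -> exists m : nat,
  (\int[leb]_u ((@poisson_kernel R n m.+1%:R^-1 u)%:E * translation_defect u) < a%:E)%E.
Proof.
move=> a0.
pose D (m : nat) (u : E) := q (ttrans (m.+1%:R^-1 *: tcol u) F - F).
have D0 m u : 0 <= D m u.
  by apply: (sqn_ge0 H); exact: (ph_domB H (L2on_ttrans _ LF) LF).
pose f_ m (u : E) : R[i] := (Num.sqrt (@poisson_kernel R n 1 u * D m u))%:C.
have fE m u : nsq (f_ m u) = @poisson_kernel R n 1 u * D m u.
  by rewrite nsqC sqr_sqrtr// mulr_ge0 ?poisson_kernel_ge0.
have mf m : cmeasurable (f_ m).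
  apply: cmeasurableC; apply: measurableT_comp.
    by apply: continuous_measurable_fun; exact: sqrt_continuous.
  apply: measurable_funM; first exact: measurable_poisson_kernel.
  rewrite (_ : D m = (fun u => q (ttrans (tcol u) F - F)) \o tlin (m.+1%:R^-1)%:M).
    by apply: measurableT_comp => //; exact: measurable_tlin.
  by apply: funext => u /=; rewrite /D /tlin ctupK mul_scalar_mx.
have cv t : nsq (f_ m t) @[m --> \oo] --> 0.
  rewrite -[X in _ --> X](mulr0 (@poisson_kernel R n 1 t)).
  under eq_fun do rewrite fE.
  apply: cvgM; first exact: cvg_cst.
  apply/cvgrPdist_lt => b b0; have [M HM] := ttrans_continuous (tcol t) LF b0.
  exists M => // m /= Mm; rewrite sub0r normrN ger0_norm//; exact: HM.
have bd m t : nsq (f_ m t) <= (4 * q F) * @poisson_kernel R n 1 t.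
  rewrite fE mulrC ler_wpM2r ?poisson_kernel_ge0//.
  have := sqnB_le H (L2on_ttrans (m.+1%:R^-1 *: tcol t) LF) LF; rewrite sqn_ttrans//.
  by rewrite /D; move: (q F) (q (_ - _)) => x y; lra.
have iK : leb.-integrable setT (EFin \o (fun t : E => (4 * q F) * @poisson_kernel R n 1 t)).
  apply: integrableZl_EFin; apply/integrableP; split.
    by apply/measurable_EFinP; exact: measurable_poisson_kernel.
  under eq_integral do rewrite gee0_abs ?lee_fin ?poisson_kernel_ge0//.
  by rewrite integral_poisson_kernel// ltry.
have [M HM] := L2_dct mf cv bd iK a0.
exists M; rewrite scale_kernel//.
by have := HM M (leqnn M); under eq_integral do rewrite fE.
Qed.

(** As the parameter of [abel_plancherel] tends to [0] the weight tends to [1]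
    and the error term to [0], because translations are continuous in mean
    square. *)
Lemma plancherel : (\int[leb]_w (nsq (fourier F w))%:E = (q F)%:E)%E.
Proof.
pose e (m : nat) : R := m.+1%:R^-1; have e0 m : 0 < e m by rewrite invr_gt0.
have b0 m : (0 <= \int[leb]_u ((@poisson_kernel R n (e m) u)%:E * translation_defect u))%E.
  by apply: integral_ge0 => u _; rewrite mule_ge0 ?lee_fin ?poisson_kernel_ge0//; exact: integral_ge0.
apply/eqP; rewrite eq_le; apply/andP; split.
  apply: (fatou_le (N := 0%N) (f_ := fun m w => (@abel_weight R n (e m) w * nsq (fourier F w))%:E)).
  - move=> m; apply/measurable_EFinP; apply: measurable_funM; first exact: measurable_abel_weight.
    exact: measurable_nsq cmeasurable_fourier.
  - by move=> m w; rewrite lee_fin mulr_ge0 ?abel_weight_ge0 ?nsq_ge0.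
  - move=> w; apply: cvg_EFin; first by near=> m.
    rewrite -[X in _ --> X]mul1r; apply: cvgM; last exact: cvg_cst.
    pose c := - (2 * pi * \sum_(i < n) `|tnth w i|).
    have -> : (fun m => @abel_weight R n (e m) w) = (fun m => expR (e m * c)).
      apply: funext => m; rewrite /abel_weight -expR_sum; congr expR.
      by rewrite /c mulrN !mulr_sumr sumrN; congr (- _); apply: eq_bigr => i _; rewrite mulrCA !mulrA.
    rewrite -expR0 -(mul0r c); apply: continuous_cvg; first exact: continuous_expR.
    by apply: cvgM; [exact: cvg_harmonic|exact: cvg_cst].
  - move=> m _; rewrite -(abel_plancherel (e0 m)); apply: leeDl.
    by rewrite mule_ge0.
apply/lee_addgt0Pr => a a0; have [m Hm] := defect_small a0.
rewrite -(abel_plancherel (e0 m)); apply: leeD.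
  apply: ge0_le_integral => //.
  - by move=> w _; rewrite lee_fin mulr_ge0 ?abel_weight_ge0 ?nsq_ge0.
  - apply/measurable_EFinP; apply: measurable_funM; first exact: measurable_abel_weight.
    exact: measurable_nsq cmeasurable_fourier.
  - exact: measurable_ensq cmeasurable_fourier.
  - move=> w _; rewrite lee_fin ler_piMl ?nsq_ge0//; apply: prodr_ile1 => i.
    by rewrite expR_ge0/= -[leRHS]expR0 ler_expR oppr_le0 !mulr_ge0 ?pi_ge0 ?(ltW (e0 m)).
apply: le_trans (ltW Hm); rewrite -[leRHS]mul1e; apply: lee_wpmul2r => //.
by rewrite lee_fin invf_le1// ler1n.
Unshelve. all: by end_near.
Qed.

End plancherel.

(** * Time-frequency shifts *)

Section isometry.
Context {R : realType} {V1 V2 : zmodType}.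
Variables (sc1 : R[i] -> V1 -> V1) (D1 : V1 -> Prop) (ip1 : V1 -> V1 -> R[i]).
Variables (sc2 : R[i] -> V2 -> V2) (D2 : V2 -> Prop) (ip2 : V2 -> V2 -> R[i]).
Hypotheses (H1 : prehilbert sc1 D1 ip1) (H2 : prehilbert sc2 D2 ip2).

(** By polarization; the imaginary part comes from multiplying by [i]. *)
Lemma similarity_ip (k : R) (T : V1 -> V2) :
  (forall f, D1 f -> D2 (T f)) ->
  (forall f g, D1 f -> D1 g -> T (f + g) = T f + T g) ->
  (forall c f, D1 f -> T (sc1 c f) = sc2 c (T f)) ->
  (forall f, D1 f -> sqn ip2 (T f) = k * sqn ip1 f) ->
  forall f g, D1 f -> D1 g -> ip2 (T f) (T g) = k%:C * ip1 f g.
Proof.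
move=> TD TA TZ Tq.
have D0 := ph_dom0 H1.
have T0 : T 0 = 0 by apply: (addrI (T 0)); rewrite -TA// !addr0.
have TN f : D1 f -> T (- f) = - T f.
  move=> Df; apply/eqP; rewrite -addr_eq0 -TA//; last exact: (ph_domN H1).
  by rewrite addNr T0.
have Re f g : D1 f -> D1 g -> complex.Re (ip2 (T f) (T g)) = k * complex.Re (ip1 f g).
  move=> Df Dg; rewrite (polarization H1)// (polarization H2); [|exact: TD..].
  have -> : T f - T g = T (f - g) by rewrite TA ?TN//; exact: (ph_domN H1).
  rewrite -TA// !Tq; [|exact: (ph_domB H1)|exact: (ph_domD H1)].
  by rewrite mulrA mulrBr.
move=> f g Df Dg; apply: complexP; rewrite !reimE ?mul0r ?subr0 ?addr0 ?Re//.
rewrite (Im_ip H2); [|exact: TD..]; rewrite -TZ// Re//; last exact: (ph_domZ H1).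
by rewrite (Im_ip H1).
Qed.

Lemma isometry_ip (T : V1 -> V2) :
  (forall f, D1 f -> D2 (T f)) ->
  (forall f g, D1 f -> D1 g -> T (f + g) = T f + T g) ->
  (forall c f, D1 f -> T (sc1 c f) = sc2 c (T f)) ->
  (forall f, D1 f -> sqn ip2 (T f) = sqn ip1 f) ->
  forall f g, D1 f -> D1 g -> ip2 (T f) (T g) = ip1 f g.
Proof.
move=> TD TA TZ Tq f g Df Dg; rewrite (similarity_ip (k := 1) TD TA TZ)//.
  by rewrite mul1r.
by move=> h Dh; rewrite mul1r Tq.
Qed.

End isometry.

Section time_frequency.
Context {R : realType} {d : nat}.
Local Notation E := (Euclidean R d).
Local Notation leb := (lebesgue_Euclidean R d).
Local Notation ip := (cip leb).
Local Notation q := (sqn ip).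
Implicit Types (f g : E -> R[i]) (u v w : 'cV[R]_(d + d)).

(** Phase-space points are column vectors here, so that they can be added and
    acted on by matrices. *)
Definition tf v f : E -> R[i] := tfshift (ctup v) f.

(** The pairing of the position of [v] with the frequency of [w]; time-frequency
    shifts compose up to the phase [exp (- 2 i pi beta v w)]. *)
Definition beta v w : R := \sum_(i < d) usubmx v i 0 * dsubmx w i 0.

Lemma betaNl v w : beta (- v) w = - beta v w.
Proof. by rewrite /beta -sumrN; apply: eq_bigr => i _ /=; rewrite !mxE mulNr. Qed.
Lemma betaNr v w : beta w (- v) = - beta w v.
Proof. by rewrite /beta -sumrN; apply: eq_bigr => i _ /=; rewrite !mxE mulrN. Qed.
Lemma beta0l w : beta 0 w = 0.
Proof. by rewrite /beta big1// => i _; rewrite !mxE mul0r. Qed.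
Lemma beta0r w : beta w 0 = 0.
Proof. by rewrite /beta big1// => i _; rewrite !mxE mulr0. Qed.

Lemma tfE v f t :
  tf v f t = expi (2 * pi * edot t (ctup (dsubmx v))) * f (tadd (- usubmx v) t).
Proof.
congr (expi (_ * _) * f _).
  by apply: eq_bigr => i _; rewrite !tnth_mktuple !mxE.
by apply: eq_from_tnth => i; rewrite tnth_tadd !tnth_mktuple !mxE addrC.
Qed.

Lemma edot_tadd v w (t : E) : edot (tadd (- usubmx v) t) (ctup (dsubmx w)) =
  edot t (ctup (dsubmx w)) - beta v w.
Proof.
rewrite -sumrB; apply: eq_bigr => i _; rewrite tnth_tadd !tnth_mktuple !mxE.
by rewrite mulrDl mulNr addrC.
Qed.

Lemma taddA x y (t : E) : tadd x (tadd y t) = tadd (x + y) t.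
Proof. by rewrite /tadd ctupK addrA. Qed.
Lemma tadd0 (t : E) : tadd 0 t = t.
Proof. by rewrite /tadd add0r tcolK. Qed.

Lemma tfM v w f : tf v (tf w f) = scf (expi (- (2 * pi * beta v w))) (tf (v + w) f).
Proof.
apply: funext => t; rewrite /scf !tfE taddA -opprD [usubmx w + _]addrC -raddfD/=.
rewrite !mulrA -!expiD; congr (expi _ * _).
rewrite edot_tadd raddfD/=.
have -> : edot t (ctup (dsubmx v + dsubmx w)) = edot t (ctup (dsubmx v)) + edot t (ctup (dsubmx w)).
  by rewrite -big_split; apply: eq_bigr => i _ /=; rewrite !tnth_mktuple mxE mulrDr.
move: pi => a; ring.
Qed.

Lemma tf0 f : tf 0 f = f.
Proof.
apply: funext => t; rewrite tfE !raddf0 tadd0 (_ : edot _ _ = 0) ?mulr0 ?expi0 ?mul1r//.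
by rewrite /edot big1// => i _; rewrite tnth_mktuple mxE mulr0.
Qed.

Lemma tfD v f g : tf v (f + g) = tf v f + tf v g.
Proof. by apply: funext => t; exact: mulrDr. Qed.
Lemma tfZ v c f : tf v (scf c f) = scf c (tf v f).
Proof. by apply: funext => t; exact: mulrCA. Qed.

Lemma scfA (T : Type) (a b : R[i]) (f : T -> R[i]) : scf a (scf b f) = scf (a * b) f.
Proof. by apply: funext => t; exact: mulrA. Qed.
Lemma scf1 (T : Type) (f : T -> R[i]) : scf 1 f = f.
Proof. by apply: funext => t; exact: mul1r. Qed.
Lemma scfBl (T : Type) (a b : R[i]) (f : T -> R[i]) : scf (a - b) f = scf a f - scf b f.
Proof. by apply: funext => t; exact: mulrBl. Qed.
Lemma scfBr (T : Type) (a : R[i]) (f g : T -> R[i]) : scf a (f - g) = scf a f - scf a g.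
Proof. by apply: funext => t; exact: mulrBr. Qed.

Lemma tfB v f g : tf v (f - g) = tf v f - tf v g.
Proof. by apply: funext => t; exact: mulrBr. Qed.

Let H := cip_prehilbert leb.

Lemma nsq_tf v f t : nsq (tf v f t) = nsq (ttrans (- usubmx v) f t).
Proof. by rewrite tfE nsqM nsq_expi mul1r. Qed.

Lemma cmeasurable_tf v f : cmeasurable f -> cmeasurable (tf v f).
Proof.
move=> mf; rewrite (_ : tf v f = (fun t => expi (2 * pi * edot t (ctup (dsubmx v))) *
  f (tadd (- usubmx v) t))); last by apply: funext => t; exact: tfE.
apply: cmeasurableM; last exact: (cmeasurable_comp mf (@measurable_tadd R d _)).
apply: cmeasurable_expi; apply: measurable_funM => //.
exact: measurable_edot.
Qed.

Lemma L2on_tf v f : L2on leb f -> L2on leb (tf v f).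
Proof.
move=> [mf f2]; split; first exact: cmeasurable_tf.
under eq_integral do rewrite nsq_tf.
by rewrite integral_nsq_ttrans.
Qed.

Lemma sqn_tf v f : L2on leb f -> q (tf v f) = q f.
Proof.
move=> Lf; apply: EFin_inj; rewrite !sqn_cip//; last exact: L2on_tf.
under eq_integral do rewrite nsq_tf.
exact: integral_nsq_ttrans Lf.1.
Qed.

Lemma cip_tf v f g : L2on leb f -> L2on leb g -> ip (tf v f) (tf v g) = ip f g.
Proof.
apply: (isometry_ip H H) => [h|h k _ _|c h _|h].
- exact: L2on_tf.
- exact: tfD.
- exact: tfZ.
- exact: sqn_tf.
Qed.

Lemma tfNK v f : tf v (tf (- v) f) = scf (expi (2 * pi * beta v v)) f.
Proof. by rewrite tfM betaNr mulrN opprK subrr tf0. Qed.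

Lemma cip_tf_adj v f g : L2on leb f -> L2on leb g ->
  ip (tf v f) g = expi (2 * pi * beta v v) * ip f (tf (- v) g).
Proof.
move=> Lf Lg; have Ln := L2on_tf (- v) Lg.
rewrite -(cip_tf v Lf Ln) tfNK (ph_ipZr H); [|exact: L2on_tf|exact: Lg].
by rewrite mulrA mulcJ nsq_expi mul1r.
Qed.

(** The commutation character of two phase-space points. *)
Definition chi v w : R[i] := expi (2 * pi * (beta w v - beta v w)).

Lemma tf_comm v w f : tf v (tf w f) = scf (chi v w) (tf w (tf v f)).
Proof.
rewrite !tfM scfA (addrC w); congr scf; rewrite /chi -expiD; congr expi.
move: pi => a; ring.
Qed.

End time_frequency.

(** * The Moyal identity *)

Section expi_estimates.
Context {R : realType}.
Implicit Types a x : R.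

Lemma norm_sin_le x : `|sin x| <= `|x|.
Proof.
wlog x0 : x / 0 <= x.
  move=> W; have [|/ltW x0] := leP 0 x; first exact: W.
  by rewrite -normrN -sinN -[leRHS]normrN; apply: W; rewrite oppr_ge0.
have dS y : y \in `]0, x[ -> is_derive y 1 (@sin R) (cos y) by move=> _; exact: is_derive_sin.
have [|c _] := MVT_segment x0 dS; first exact: (continuous_subspaceT (@continuous_sin R)).
rewrite sin0 !subr0 => ->; rewrite normrM ler_piMl//.
exact: cos_max.
Qed.

Lemma cos_ge x : 1 - x ^+ 2 / 2 <= cos x.
Proof.
have -> : cos x = 1 - 2 * sin (x / 2) ^+ 2.
  rewrite {1}(splitr x) cosD -!expr2 cos2sin2; lra.
have : sin (x / 2) ^+ 2 <= (x / 2) ^+ 2.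
  rewrite -(real_normK (num_real (sin _))) -[leRHS]real_normK ?num_real//.
  by rewrite ler_pXn2r ?nnegrE// norm_sin_le.
rewrite expr_div_n; lra.
Qed.

Lemma nsq_expiB1 a : nsq (expi a - 1) <= a ^+ 2.
Proof.
have -> : nsq (expi a - 1) = 2 - 2 * cos a.
  rewrite /nsq !reimE /= subr0 sin2cos2; ring.
have := cos_ge a; lra.
Qed.

Lemma normc_expiB1 a : normc (expi a - 1) <= `|a|.
Proof.
by rewrite normc_nsq -[leRHS]sqrtr_sqr ler_wsqrtr// nsq_expiB1.
Qed.

Lemma nsq_expiB1_deriv a : nsq (expi a - 1 - 'i * a%:C) <= a ^+ 4 * (1 + a ^+ 2).
Proof.
have c2 : (cos a - 1) ^+ 2 <= a ^+ 4.
  have h1 := cos_ge a; have h2 := cos_le1 a.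
  have -> : a ^+ 4 = (a ^+ 2) ^+ 2 by ring.
  rewrite -sqrrN ler_pXn2r ?nnegrE ?sqr_ge0//; have := sqr_ge0 a; lra.
have s2 : (sin a - a) ^+ 2 <= a ^+ 6.
  have -> : a ^+ 6 = (`|a| ^+ 3) ^+ 2 by rewrite -exprM -[RHS]normrX ger0_norm// exprn_even_ge0.
  rewrite -[leLHS]real_normK ?num_real// ler_pXn2r ?nnegrE ?exprn_ge0//.
  wlog a0 : a {c2} / 0 <= a.
    move=> W; have [|/ltW a0] := leP 0 a; first exact: W.
    by have := W (- a); rewrite oppr_ge0 sinN -opprD !normrN; exact.
  have dS y : y \in `]0, a[ -> is_derive y 1 (fun y : R => sin y - y) (cos y - 1).
    by move=> _; exact: is_deriveB.
  have [|c] := MVT_segment a0 dS.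
    by apply: continuous_subspaceT => y; apply: cvgB; [exact: continuous_sin|exact: cvg_id].
  rewrite in_itv/= => /andP[c0 ca]; rewrite sin0 !subr0 => ->.
  have h1 := cos_ge c; have h2 := cos_le1 c.
  have h3 : c ^+ 2 <= a ^+ 2 by rewrite ler_pXn2r ?nnegrE//.
  rewrite normrM (ger0_norm a0) exprSr ler_wpM2r// ler_norml; have := sqr_ge0 c.
  by move=> ?; apply/andP; split; lra.
have -> : nsq (expi a - 1 - 'i * a%:C) = (cos a - 1) ^+ 2 + (sin a - a) ^+ 2.
  by rewrite /nsq !reimE /=; ring.
have -> : a ^+ 4 * (1 + a ^+ 2) = a ^+ 4 + a ^+ 6 by ring.
exact: lerD.
Qed.

End expi_estimates.

Section moyal.
Context {R : realType} {d : nat}.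
Local Notation E := (Euclidean R d).
Local Notation E2 := (Euclidean R (d + d)).
Local Notation leb := (lebesgue_Euclidean R d).
Local Notation leb2 := (lebesgue_Euclidean R (d + d)).
Local Notation ip := (cip leb).
Local Notation q := (sqn ip).
Let H := cip_prehilbert leb.
Let H2 := cip_prehilbert leb2.

Variables (phi : E -> R[i]) (M : R).
Hypotheses (Lphi : L2on leb phi) (bphi : forall t, nsq (phi t) <= M).

(** The short-time Fourier transform with window [phi]. *)
Definition windowed f (z : E2) : R[i] := ip f (tf (tcol z) phi).

Lemma windowedD f g : L2on leb f -> L2on leb g ->
  windowed (f + g) = windowed f + windowed g.
Proof.
by move=> Lf Lg; apply: funext => z; rewrite /windowed (ph_ipD H)//; exact: L2on_tf.
Qed.

Lemma windowedZ c f : L2on leb f -> windowed (scf c f) = scf c (windowed f).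
Proof.
by move=> Lf; apply: funext => z; rewrite /windowed (ph_ipZ H)//; exact: L2on_tf.
Qed.

Let Fx (f : E -> R[i]) (x : E) : E -> R[i] := fun t => f t * (ttrans (- tcol x) phi t)^*.

Let windowedE f x y : windowed f (Ecat x y) = fourier (Fx f x) y.
Proof.
congr cintegral; apply: funext => t.
rewrite /tf tcolK /tfshift positionE frequencyE /Fx /ttrans rmorphM/=.
rewrite [X in _ * X]mulrC mulrA; congr (_ * (phi _)^* * _).
by apply: eq_from_tnth => i; rewrite tnth_tadd !tnth_mktuple !mxE addrC.
Qed.

Lemma cmeasurable_windowed f : cmeasurable f -> cmeasurable (windowed f).
Proof.
move=> mf.
apply: (@cmeasurable_parametric _ _ _ _ _ leb (fun zt : E2 * E => f zt.2 * (tf (tcol zt.1) phi zt.2)^*)).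
apply: cmeasurableM; first exact: (cmeasurable_comp mf measurable_snd).
apply: cmeasurableJ.
rewrite (_ : (fun _ => _) = (fun zt : E2 * E => expi (2 * pi * edot zt.2 (frequency zt.1)) *
    phi (ctup (\col_i (tnth zt.2 i - tnth (position zt.1) i))))); last first.
  apply: funext => zt; rewrite /tf tcolK /tfshift; congr (_ * phi _).
  by apply: eq_from_tnth => i; rewrite !tnth_mktuple !mxE ?tnth_mktuple.
apply: cmeasurableM.
  apply: cmeasurable_expi; apply: measurable_funM => //.
  apply: measurable_edot; first exact: measurable_snd.
  exact: (measurableT_comp (@measurable_frequency R d) measurable_fst).
apply: (cmeasurable_comp Lphi.1); apply: measurable_ctup => i.
under eq_fun do rewrite mxE; apply: measurable_funB.
  exact: (measurableT_comp (measurable_tnth i) measurable_snd).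
exact: (measurableT_comp (measurable_tnth i) (measurableT_comp (@measurable_position R d) measurable_fst)).
Qed.

Let M0 : 0 <= M.
Proof. exact: le_trans (nsq_ge0 _) (bphi (ctup 0)). Qed.

Let L2on_Fx f x : L2on leb f -> L2on leb (Fx f x).
Proof.
move=> [mf f2]; have mp := (L2on_ttrans (- tcol x) Lphi).1.
have mF : cmeasurable (Fx f x) by apply: cmeasurableM => //; exact: cmeasurableJ.
split=> //; apply: (@le_lt_trans _ _ (\int[leb]_t (M%:E * (nsq (f t))%:E))%E).
  apply: ge0_le_integral => //.
  - exact: measurable_ensq.
  - by apply: measurable_funeM; exact: measurable_ensq.
  - move=> t _; rewrite -EFinM lee_fin nsqM nsqJ mulrC ler_wpM2r ?nsq_ge0//.
    exact: bphi.
rewrite ge0_integralZl_EFin//; last exact: measurable_ensq.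
by rewrite lte_mul_pinfty// lee_fin.
Qed.

Let reflected_mass t : (\int[leb]_x (nsq (ttrans (- tcol x) phi t))%:E = (q phi)%:E)%E.
Proof.
pose g (x : E) : \bar R := (nsq (phi (tadd (tcol t) x)))%:E.
have mg : measurable_fun setT g := measurable_ensq (L2on_ttrans (tcol t) Lphi).1.
have dE : `|\det ((-1)%:M : 'M[R]_d)| = 1.
  by rewrite det_scalar normrX normrN1 expr1n.
have d0 : \det ((-1)%:M : 'M[R]_d) != 0 by rewrite -normr_gt0 dE.
rewrite sqn_cip// -(ge0_integral_translation (tcol t) (measurable_ensq Lphi.1))//.
have := ge0_integral_linear d0 mg (fun x => ensq_ge0 _); rewrite dE mul1e => ->.
apply: eq_integral => x _; rewrite /g /ttrans; congr (nsq (phi _))%:E.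
by rewrite /tadd /tlin ctupK mul_scalar_mx scaleN1r addrC.
Qed.

(** For each position [x], Plancherel's theorem integrates the frequency out
    of the Fourier transform of [f(t) * conj (phi (t - x))]; Tonelli's theorem
    then separates [f] from [phi]. *)
Lemma integral_nsq_windowed f : L2on leb f ->
  (\int[leb2]_z (nsq (windowed f z))%:E = (q phi * q f)%:E)%E.
Proof.
move=> Lf; have mV := cmeasurable_windowed Lf.1.
rewrite (ge0_integral_Ecat (measurable_ensq mV))//.
transitivity (\int[leb]_x \int[leb]_t ((nsq (f t))%:E * (nsq (ttrans (- tcol x) phi t))%:E))%E.
  apply: eq_integral => x _; under eq_integral do rewrite windowedE.
  rewrite (plancherel (L2on_Fx x Lf) (L2on_integrable Lf (L2on_ttrans _ Lphi))).
  rewrite sqn_cip; last exact: L2on_Fx.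
  by apply: eq_integral => t _; rewrite nsqM nsqJ EFinM.
transitivity (\int[leb]_t \int[leb]_x ((nsq (f t))%:E * (nsq (ttrans (- tcol x) phi t))%:E))%E.
  apply: (@fubini_tonelli _ _ _ _ _ leb leb
    (fun p : E * E => ((nsq (f p.2))%:E * (nsq (phi (tadd (- tcol p.1) p.2)))%:E)%E)).
    apply: emeasurable_funM; apply: measurable_ensq.
      exact: (cmeasurable_comp Lf.1 measurable_snd).
    apply: (cmeasurable_comp Lphi.1); apply: measurable_ctup => i.
    under eq_fun do rewrite !mxE; apply: measurable_funD; first apply: measurable_funN.
      exact: (measurableT_comp (measurable_tnth i) measurable_fst).
    exact: (measurableT_comp (measurable_tnth i) measurable_snd).
  by move=> p; rewrite mule_ge0.
have mr t : measurable_fun setT (fun x => (nsq (ttrans (- tcol x) phi t))%:E).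
  apply: measurable_ensq; apply: (cmeasurable_comp Lphi.1); apply: measurable_ctup => i.
  under eq_fun do rewrite !mxE; apply: measurable_funD => //; apply: measurable_funN.
  exact: measurable_tnth.
transitivity (\int[leb]_t ((q phi)%:E * (nsq (f t))%:E))%E.
  apply: eq_integral => t _.
  rewrite (ge0_integralZl_EFin leb measurableT _ (mr t)) ?nsq_ge0//.
  by rewrite reflected_mass muleC.
have qp := sqn_ge0 H Lphi.
rewrite (ge0_integralZl_EFin leb measurableT _ (measurable_ensq Lf.1))//.
by rewrite -sqn_cip// EFinM.
Qed.

Lemma L2on_windowed f : L2on leb f -> L2on leb2 (windowed f).
Proof.
move=> Lf; split; first exact: cmeasurable_windowed Lf.1.
by rewrite integral_nsq_windowed// ltry.
Qed.

Lemma moyal f g : L2on leb f -> L2on leb g ->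
  cip leb2 (windowed f) (windowed g) = (q phi)%:C * ip f g.
Proof.
apply: (similarity_ip H H2) => [h Lh|h k Lh Lk|c h Lh|h Lh].
- exact: L2on_windowed.
- exact: windowedD.
- exact: windowedZ.
- by apply: EFin_inj; rewrite sqn_cip ?integral_nsq_windowed//; exact: L2on_windowed.
Qed.

End moyal.

(** * The Gaussian window *)

Lemma poweR2 (R : realType) (x : \bar R) : (0 <= x -> x `^ 2 = x ^+ 2)%E.
Proof.
case: x => [r r0|_|//]; last by rewrite poweRyr// expe2 mulyy.
by rewrite poweR_EFin powR_mulrn.
Qed.

Lemma sqre_lty (R : realType) (x : \bar R) : (0 <= x -> (x ^+ 2 < +oo) = (x < +oo))%E.
Proof. by case: x => [r _|_|//]; rewrite expe2 -?EFinM ?ltry// mulyy. Qed.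

Section defs_link.
Context {R : realType} {d : nat}.
Local Notation E := (Euclidean R d).
Local Notation leb := (lebesgue_Euclidean R d).
Implicit Types f g : E -> R[i].

(** Relates the norm of the definitions to integrals of [nsq]. *)
Lemma L2norm_sqr f : (L2norm f ^+ 2 = \int[leb]_t (nsq (f t))%:E)%E.
Proof.
rewrite -poweR2/=; last exact: Lnorm_ge0.
rewrite /L2norm poweR_Lnorm//.
apply: eq_integral => t _; rewrite poweR2// -EFin_expe real_normK ?num_real//.
by rewrite nsqE.
Qed.

Lemma L2E f : L2 f <-> L2on leb f.
Proof.
by rewrite /L2 /L2on -L2norm_sqr sqre_lty//; exact: Lnorm_ge0.
Qed.

Lemma L2norm_sqn f : L2on leb f -> (L2norm f ^+ 2 = (sqn (cip leb) f)%:E)%E.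
Proof. by move=> Lf; rewrite L2norm_sqr sqn_cip. Qed.

End defs_link.

Section gaussian_window.
Context {R : realType} {d : nat}.
Local Notation E := (Euclidean R d).
Local Notation leb := (lebesgue_Euclidean R d).
Local Notation ip := (cip leb).
Local Notation q := (sqn ip).
Local Notation phi := (@gaussian R d).
Let H := cip_prehilbert leb.

Let ex (t : E) : R := expR (- pi * \sum_(i < d) tnth t i ^+ 2).

Lemma nsq_gaussian t : nsq (phi t) = ex t ^+ 2.
Proof. by rewrite nsqC. Qed.

Let ex_le1 t : ex t <= 1.
Proof.
rewrite -[leRHS]expR0 ler_expR mulNr oppr_le0 mulr_ge0 ?pi_ge0// sumr_ge0// => i _.
exact: sqr_ge0.
Qed.

Lemma nsq_gaussian_le1 t : nsq (phi t) <= 1.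
Proof. by rewrite nsq_gaussian expr_le1 ?expR_ge0 ?ex_le1. Qed.

Let pi_ge1 : 1 <= pi :> R.
Proof. by apply: le_trans (pi_ge2 R); rewrite ler1n. Qed.

(** Comparison of the Gaussian with a kernel whose integral is known; it gives
    all the integrability needed without computing a Gaussian integral. *)
Let ex_le_poisson t : ex t <= pi ^+ d * @poisson_kernel R d 1 t.
Proof.
rewrite /ex mulNr -mulrN -sumrN mulr_sumr expR_sum /poisson_kernel.
rewrite -[X in pi ^+ X]card_ord -prodr_const -big_split/=.
apply: ler_prod => i _; rewrite expR_ge0 /poisson expr1n mulrA divff ?gt_eqF ?pi_gt0// !mul1r.
rewrite mulrN expRN lef_pV2 ?posrE ?expR_gt0 ?ltr_pwDl ?sqr_ge0//.
apply: le_trans (expR_ge1Dx _); rewrite lerD2l ler_peMl ?sqr_ge0//.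
Qed.

Let measurable_ex : measurable_fun setT ex.
Proof.
apply: measurableT_comp => //; apply: measurable_funM => //.
by apply: measurable_sum => i; apply: measurable_funX; exact: measurable_tnth.
Qed.

Let dominated_L2 (f : E -> R[i]) (K : R) : 0 <= K -> cmeasurable f ->
  (forall t, nsq (f t) <= K * ex t) -> L2on leb f.
Proof.
move=> K0 mf fK; split => //.
apply: (@le_lt_trans _ _ (\int[leb]_t ((K * pi ^+ d)%:E * (@poisson_kernel R d 1 t)%:E))%E).
  apply: ge0_le_integral => //; first exact: measurable_ensq.
    by apply: measurable_funeM; apply/measurable_EFinP; exact: measurable_poisson_kernel.
  move=> t _; rewrite -EFinM lee_fin (le_trans (fK t))// -mulrA.
  by rewrite ler_wpM2l.
rewrite ge0_integralZl_EFin ?mulr_ge0 ?exprn_ge0 ?pi_ge0//.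
- by rewrite integral_poisson_kernel// mule1 ltry.
- by move=> t _; rewrite lee_fin poisson_kernel_ge0.
- by apply/measurable_EFinP; exact: measurable_poisson_kernel.
Qed.

Lemma cmeasurable_gaussian : cmeasurable phi.
Proof. exact: cmeasurableC. Qed.

Lemma L2on_gaussian : L2on leb phi.
Proof.
apply: (dominated_L2 ler01 cmeasurable_gaussian) => t.
by rewrite nsq_gaussian expr2 ler_wpM2r ?expR_ge0.
Qed.

Lemma sqn_gaussian_gt0 : 0 < q phi.
Proof.
(* A lower bound of the squared Gaussian on the unit cube. *)
pose c : R := expR (- (2 * pi * d%:R)).
have c0 : 0 < c by exact: expR_gt0.
apply: (lt_le_trans c0); rewrite -lee_fin sqn_cip; last exact: L2on_gaussian.
rewrite -[leLHS]mule1 -(@integral_cube R d).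
have mc : measurable_fun setT (fun t : E => ((in_cube t)%:R : R)%:E).
  by apply/measurable_EFinP; exact: measurable_in_cube.
have c1 (t : E) : [set: E] t -> (0 <= ((in_cube t)%:R : R)%:E)%E by rewrite lee_fin.
rewrite -(ge0_integralZl_EFin leb measurableT c1 mc (ltW c0)).
apply: ge0_le_integral => //.
- by move=> t _; rewrite -EFinM lee_fin mulr_ge0 ?(ltW c0).
- exact: measurable_funeM.
- exact: measurable_ensq cmeasurable_gaussian.
move=> t _; rewrite -EFinM lee_fin nsq_gaussian.
case: (boolP (in_cube t)) => [/forallP tc|_]; last by rewrite mulr0 sqr_ge0.
rewrite mulr1 /c /ex -expRM_natl ler_expR mulNr mulrN lerN2 -mulrA ler_wpM2l//.
rewrite ler_wpM2l ?pi_ge0// -[leRHS]mulr1 -[X in _ <= X%:R * _]card_ord.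
rewrite -sum1_card natr_sum mulr_suml; apply: ler_sum => i _; rewrite mulr1.
by have /andP[t0 /ltW t1] := tc i; rewrite expr_le1.
Qed.

(** The difference [D_w = pi(w) - 1], which replaces a derivative. *)
Definition dsh (w : 'cV[R]_(d + d)) (f : E -> R[i]) : E -> R[i] := tf w f - f.

Lemma L2on_dsh w f : L2on leb f -> L2on leb (dsh w f).
Proof. by move=> Lf; exact: (ph_domB H (L2on_tf w Lf) Lf). Qed.

Definition unit_shift (j : 'I_d) : 'cV[R]_(d + d) := delta_mx (lshift d j) 0.
Definition unit_mod (j : 'I_d) : 'cV[R]_(d + d) := delta_mx (rshift d j) 0.

Lemma tf_unit_shift j s f : tf (s *: unit_shift j) f = ttrans (- (s *: delta_mx j 0)) f.
Proof.
apply: funext => t; rewrite tfE (_ : edot _ _ = 0).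
  rewrite mulr0 expi0 mul1r /ttrans; congr (f (tadd (- _) t)).
  by apply/colP => i; rewrite !mxE !eqxx (inj_eq (@lshift_inj _ _)).
rewrite /edot big1// => i _; rewrite tnth_mktuple !mxE.
by rewrite eq_rlshift mulr0 mulr0.
Qed.

Lemma tf_unit_mod j s f t :
  tf (s *: unit_mod j) f t = expi (2 * pi * (s * tnth t j)) * f t.
Proof.
rewrite tfE; congr (expi (_ * _) * f _).
  rewrite /edot (bigD1 j)//= big1 => [|i ij]; rewrite tnth_mktuple !mxE.
    by rewrite !eqxx mulr1 addr0 mulrC.
  by rewrite (inj_eq (@rshift_inj _ _)) (negPf ij) mulr0 mulr0.
rewrite (_ : usubmx _ = 0) ?oppr0 ?tadd0//.
by apply/colP => i; rewrite !mxE eq_lrshift mulr0.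
Qed.

(** The product of a Gaussian and its translate is a constant times the square
    of the Gaussian centred half-way. *)
Let gaussian_overlap j s (t : E) :
  tf (s *: unit_shift j) phi t * (phi t)^* = (expR (- pi * (s ^+ 2 / 2)))%:C *
  (ttrans (- ((s / 2) *: delta_mx j 0)) phi t * (ttrans (- ((s / 2) *: delta_mx j 0)) phi t)^*).
Proof.
rewrite tf_unit_shift /ttrans /gaussian.
apply: complexP; rewrite !reimE ?(mul0r, mulr0, subr0, addr0, oppr0, sub0r)//.
rewrite -!expRD -!mulrDr; congr (expR (_ * _)).
have -> : s ^+ 2 / 2 = \sum_(i < d) s ^+ 2 / 2 * (i == j)%:R.
  by rewrite (bigD1 j)//= eqxx mulr1 big1 ?addr0// => i /negPf->; rewrite mulr0.
rewrite -!big_split/=; apply: eq_bigr => i _; rewrite !tnth_tadd !mxE andbT.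
by case: (i == j) => /=; field.
Qed.

Definition lipschitz_along (w : 'cV[R]_(d + d)) (f : E -> R[i]) : Prop :=
  exists2 C, 0 <= C & forall s, q (dsh (s *: w) f) <= C * s ^+ 2.

(** By [gaussian_overlap] the distance to the translate by [s] is computed
    exactly: its square is [2 (1 - exp (- pi s^2 / 2)) |phi|^2]. *)
Lemma gaussian_lipschitz_shift j : lipschitz_along (unit_shift j) phi.
Proof.
have Lp := L2on_gaussian; have qp := sqn_ge0 H Lp.
exists (pi * q phi); first by rewrite mulr_ge0 ?pi_ge0.
move=> s; rewrite /dsh (sqnB H)//; last exact: L2on_tf.
set v : 'cV[R]_d := - ((s / 2) *: delta_mx j 0); set c := expR (- pi * (s ^+ 2 / 2)).
have Lv := L2on_ttrans v Lp.
have -> : ip (tf (s *: unit_shift j) phi) phi = c%:C * ip (ttrans v phi) (ttrans v phi).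
  rewrite {1}/cip; under eq_fun do rewrite gaussian_overlap.
  by rewrite cintegralZ//; exact: L2on_integrable.
rewrite (ph_ip_real H Lv) sqn_ttrans// sqn_tf// !reimE mul0r subr0.
have := expR_ge1Dx (- pi * (s ^+ 2 / 2)); rewrite -/c => hc.
have : 0 <= (c - (1 + - pi * (s ^+ 2 / 2))) * q phi by rewrite mulr_ge0// subr_ge0.
move: pi (q phi) => p x; lra.
Qed.

Lemma gaussian_lipschitz_mod j : lipschitz_along (unit_mod j) phi.
Proof.
have Lp := L2on_gaussian.
pose f (t : E) : R[i] := (tnth t j * ex t)%:C.
have mf : cmeasurable f.
  by apply: cmeasurableC; apply: measurable_funM => //; exact: measurable_tnth.
have Lf : L2on leb f.
  apply: (dominated_L2 ler01 mf) => t; rewrite nsqC.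
  have -> : (tnth t j * ex t) ^+ 2 = tnth t j ^+ 2 * ex t * ex t by ring.
  rewrite ler_wpM2r ?expR_ge0// /ex mulNr expRN ler_pdivrMr ?expR_gt0// mul1r.
  apply: le_trans (expR_ge1Dx _); rewrite ler_wpDl//.
  have S0 : tnth t j ^+ 2 <= \sum_(i < d) tnth t i ^+ 2.
    by rewrite (bigD1 j)//= lerDl sumr_ge0// => i _; exact: sqr_ge0.
  by apply: le_trans S0 _; rewrite ler_peMl// sumr_ge0// => i _; exact: sqr_ge0.
exists ((2 * pi) ^+ 2 * q f).
  by rewrite mulr_ge0 ?sqr_ge0//; exact: (sqn_ge0 H).
move=> s; have Ld := L2on_dsh (s *: unit_mod j) Lp.
have Lz := L2onZ (2 * pi * s)%:C Lf.
rewrite -mulrA [q f * _]mulrC mulrA -exprMn -nsqC -(sqnZ H)// -lee_fin !sqn_cip//.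
apply: ge0_le_integral => //.
- exact: measurable_ensq Ld.1.
- exact: measurable_ensq Lz.1.
move=> t _; rewrite lee_fin /scf nsqM !nsqC.
have -> : dsh (s *: unit_mod j) phi t = (expi (2 * pi * (s * tnth t j)) - 1) * phi t.
  by rewrite mulrBl mul1r -tf_unit_mod.
rewrite nsqM nsq_gaussian [X in _ <= _ * X]exprMn [leRHS]mulrA ler_wpM2r ?sqr_ge0//.
by rewrite -exprMn (le_trans (nsq_expiB1 _))// !mulrA.
Qed.

(** Shifting by [s w] a window centred at [z] costs a phase whose distance to
    [1] grows linearly in [z]: this is where the weight of [M^1_nu] comes in. *)
Lemma chi_dist (w : 'cV[R]_(d + d)) s (z : Euclidean R (d + d)) :
  (forall i, `|w i 0| <= 1) ->
  normc (chi (s *: w) (tcol z) - 1) <= 2 * pi * weight z * `|s|.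
Proof.
move=> w1; apply: le_trans (normc_expiB1 _) _.
have sE (a b : 'cV[R]_(d + d)) : `|beta a b| <= \sum_(i < d) `|usubmx a i 0| * `|dsubmx b i 0|.
  by apply: le_trans (ler_norm_sum _ _ _) _; apply: ler_sum => i _; rewrite normrM.
have -> : beta (tcol z) (s *: w) - beta (s *: w) (tcol z) =
    s * (beta (tcol z) w - beta w (tcol z)).
  rewrite /beta mulrBr !mulr_sumr; congr (_ - _); apply: eq_bigr => i _; rewrite !mxE; ring.
rewrite !normrM (ger0_norm (pi_ge0 R)) ger0_norm// -!mulrA ler_wpM2l// ler_wpM2l ?pi_ge0//.
rewrite mulrC ler_wpM2r//; apply: le_trans (ler_normB _ _) _.
rewrite /weight; apply: le_trans (_ : _ <= 1 + _); last exact: lexx.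
rewrite big_split_ord/= ler_wpDl//; apply: lerD.
  apply: le_trans (sE _ _) _; apply: ler_sum => i _.
  by rewrite !mxE ler_piMr// w1.
apply: le_trans (sE _ _) _; apply: ler_sum => i _.
by rewrite !mxE ler_piMl// w1.
Qed.

End gaussian_window.

(** * Regularity of windows with a weighted integrable transform *)

Lemma weight_ge1 (R : realType) d (z : Euclidean R (d + d)) : 1 <= weight z.
Proof. by rewrite /weight lerDl; apply: sumr_ge0 => i _; exact: normr_ge0. Qed.

Lemma cvg_nsq_of_dist (R : realType) (a : nat -> R[i]) (b : R[i]) :
  nsq (a k - b) @[k --> \oo] --> 0 -> (nsq (a k))%:E @[k --> \oo] --> (nsq b)%:E.
Proof.
move=> ab.
have part (p : R[i] -> R) : (forall z w, p (z - w) = p z - p w) ->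
    (forall z, p z ^+ 2 <= nsq z) -> p (a k) @[k --> \oo] --> p b.
  move=> pB pq; apply/cvgrPdist_lt => e e0.
  have /cvgrPdist_lt/(_ _ (exprn_gt0 2 e0)) [N _ NP] := ab.
  exists N => // k /= Nk; have := NP k Nk; rewrite sub0r normrN ger0_norm ?nsq_ge0// => h.
  rewrite -(ltr_pXn2r (n := 2)) ?nnegrE ?(ltW e0)// real_normK ?num_real//.
  by rewrite -sqrrN opprB -pB (le_lt_trans (pq _)).
have := @cvg_nsq R a b 0 (part _ _ (@Re_sqr_le R)) (part _ _ (@Im_sqr_le R)).
rewrite sub0r nsqN => h; under eq_fun do rewrite -nsqN -sub0r.
by apply: h => z w; rewrite !reimE.
Qed.

Section regularity.
Context {R : realType} {d : nat}.
Local Notation E := (Euclidean R d).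
Local Notation E2 := (Euclidean R (d + d)).
Local Notation leb := (lebesgue_Euclidean R d).
Local Notation leb2 := (lebesgue_Euclidean R (d + d)).
Local Notation ip := (cip leb).
Local Notation q := (sqn ip).
Local Notation phi := (@gaussian R d).
Let H := cip_prehilbert leb.

(** The adjoint of [D_w]: the adjoint of a shift is the opposite shift, up to a
    phase. *)
Definition dsh_adj (w : 'cV[R]_(d + d)) (f : E -> R[i]) : E -> R[i] :=
  scf (expi (2 * pi * beta w w))^* (tf (- w) f) - f.

Lemma L2on_dsh_adj w f : L2on leb f -> L2on leb (dsh_adj w f).
Proof. by move=> Lf; apply: (ph_domB H) => //; apply: L2onZ; exact: L2on_tf. Qed.

Lemma dsh_adjP w f g : L2on leb f -> L2on leb g -> ip (dsh w f) g = ip f (dsh_adj w g).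
Proof.
move=> Lf Lg; have Lt := L2on_tf (- w) Lg.
rewrite (ph_ipB H (L2on_tf w Lf) Lf Lg) (ph_ipBr H (L2onZ _ Lt) Lg Lf).
rewrite (ph_ipZr H)// cip_tf_adj//; congr (_ * _ - _).
by apply: complexP; rewrite !reimE ?opprK.
Qed.

Lemma dsh_tf (v w : 'cV[R]_(d + d)) (f : E -> R[i]) : dsh v (tf w f) =
  scf (chi v w) (tf w (dsh v f)) + scf (chi v w - 1) (tf w f).
Proof. by rewrite /dsh tf_comm tfB scfBr scfBl scf1 addrA subrK. Qed.

(** The distance of [pi(z) phi] to its shift is [O(|s|)] with a constant that
    grows like [weight z]. *)
Let dsh_window (w : 'cV[R]_(d + d)) (s C : R) (z : E2) : 0 <= C -> (forall i, `|w i 0| <= 1) ->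
  q (dsh (s *: w) phi) <= C ^+ 2 * s ^+ 2 ->
  Num.sqrt (q (dsh (s *: w) (tf (tcol z) phi))) <=
    (2 * pi * Num.sqrt (q phi) + C) * weight z * `|s|.
Proof.
move=> C0 w1 hC; have Lp := @L2on_gaussian R d; set v := s *: w.
rewrite dsh_tf.
have La := L2on_tf (tcol z) (L2on_dsh v Lp).
have Lb := L2on_tf (tcol z) Lp.
apply: le_trans (sqn_triangle H (L2onZ _ La) (L2onZ _ Lb)) _.
rewrite !(sqnZ H)// nsq_expi mul1r !sqn_tf//; last exact: L2on_dsh.
rewrite sqrtrM ?nsq_ge0// -normc_nsq addrC.
have z1 := weight_ge1 z.
have w0 : 0 <= weight z * `|s| by rewrite mulr_ge0// (le_trans ler01 z1).
rewrite -mulrA [leRHS]mulrDl; apply: lerD.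
  apply: le_trans (ler_wpM2r (sqrtr_ge0 _) (chi_dist s z w1)) _.
  by rewrite le_eqVlt; apply/orP; left; apply/eqP; move: pi (Num.sqrt _) => a b; ring.
apply: (@le_trans _ _ (C * `|s|)).
  by rewrite -[leRHS]ger0_norm ?mulr_ge0// -sqrtr_sqr ler_wsqrtr// exprMn real_normK ?num_real.
by rewrite ler_wpM2l// ler_peMl.
Qed.

(** For [g = D_w u], the Moyal identity gives
    [|phi|^2 |g|^2 = int V u * conj (V (D_w^* g))], where
    [|V (D_w^* g)(z)| = |<g, D_w pi(z) phi>|] is at most [|g|] times the bound
    of [dsh_window].  The weight is absorbed by [u], and one factor [|g|]
    cancels. *)
Lemma M1_lipschitz (w : 'cV[R]_(d + d)) (u : E -> R[i]) : (forall i, `|w i 0| <= 1) ->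
  lipschitz_along w phi -> M1 u -> lipschitz_along w u.
Proof.
move=> w1 [C0 C00 hC0] [/L2E Lu iV].
have Lp := @L2on_gaussian R d; have qp := @sqn_gaussian_gt0 R d.
pose C := Num.sqrt C0.
have hC s : q (dsh (s *: w) phi) <= C ^+ 2 * s ^+ 2 by rewrite sqr_sqrtr.
have Cge : 0 <= C by exact: sqrtr_ge0.
pose K := 2 * pi * Num.sqrt (q phi) + C.
have K0 : 0 <= K by rewrite addr_ge0// !mulr_ge0 ?pi_ge0 ?sqrtr_ge0.
pose V := windowed phi u.
have iW : leb2.-integrable setT (fun z => (normc (V z) * weight z)%:E).
  have := integrable_normc iV; apply: eq_integrable => // z _; congr (_%:E).
  rewrite normcM /V /windowed /stft /tf tcolK; congr (_ * _).
  by rewrite normc_nsq nsqC sqrtr_sqr ger0_norm// (le_trans ler01)// weight_ge1.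
pose W := \int[leb2]_z (normc (V z) * weight z).
have W0 : 0 <= W.
  apply: Rintegral_ge0 => y _; rewrite mulr_ge0 ?normc_ge0//.
  by rewrite (le_trans ler01)// weight_ge1.
exists ((K * W / q phi) ^+ 2) => [|s]; first exact: sqr_ge0.
set g := dsh (s *: w) u; have Lg : L2on leb g := L2on_dsh _ Lu.
have Lag := L2on_dsh_adj (s *: w) Lg.
have gE : q phi * q g = complex.Re (cip leb2 V (windowed phi (dsh_adj (s *: w) g))).
  rewrite (moyal Lp (@nsq_gaussian_le1 R d))// -dsh_adjP//.
  by rewrite (ph_ip_real H Lg) !reimE mul0r subr0.
set b := Num.sqrt (q g).
have b2 : b * b = q g by rewrite -expr2 sqr_sqrtr//; exact: (sqn_ge0 H).
have b0 : 0 <= b by exact: sqrtr_ge0.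
have pt z : complex.Re (V z * (windowed phi (dsh_adj (s *: w) g) z)^*) <=
    (b * (K * `|s|)) * (normc (V z) * weight z).
  set a := windowed phi _ z.
  have ab : normc a <= b * (K * weight z * `|s|).
    have Lt := L2on_tf (tcol z) Lp.
    have -> : normc a = normc (ip g (dsh (s *: w) (tf (tcol z) phi))).
      by rewrite (ph_ipC H (L2on_dsh _ Lt) Lg) (dsh_adjP _ Lt Lg) /a /windowed (ph_ipC H Lt Lag).
    rewrite normc_nsq; apply: le_trans (ler_wsqrtr (cauchy_schwarz H Lg (L2on_dsh _ Lt))) _.
    rewrite sqrtrM; last exact: (sqn_ge0 H).
    by rewrite ler_wpM2l//; exact: dsh_window.
  apply: (@le_trans _ _ (normc (V z) * normc a)).
    have := cReN_le_normc (- (V z * a^*)); rewrite cReN normcN lerN2 normcM.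
    by rewrite [normc a^*]normc_nsq nsqJ -normc_nsq.
  apply: le_trans (ler_wpM2l (normc_ge0 _) ab) _.
  by rewrite le_eqVlt; apply/orP; left; apply/eqP; ring.
have L1 := L2on_windowed Lp (@nsq_gaussian_le1 R d) Lu.
have L3 := L2on_windowed Lp (@nsq_gaussian_le1 R d) Lag.
have i1 := (L2on_integrable L1 L3).1.
have i2 := integrableZl_EFin (b * (K * `|s|)) iW.
have : q phi * q g <= b * (K * `|s|) * W.
  rewrite gE cRe_cintegral -RintegralZl//.
  by apply: le_Rintegral => // z _; exact: pt.
rewrite -b2 => hb.
have {}hb : b <= K * W / q phi * `|s|.
  have [->|bn] := eqVneq b 0; first by rewrite !mulr_ge0// invr_ge0 ltW.
  have bp : 0 < b by rewrite lt0r bn.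
  rewrite -(ler_pM2l qp) -(ler_pM2l bp) mulrCA (le_trans hb)//.
  rewrite le_eqVlt; apply/orP; left; apply/eqP.
  by move: (q phi) qp => x x0; field; rewrite gt_eqF.
rewrite -expr2 -[s ^+ 2]real_normK ?num_real// -exprMn.
by rewrite ler_pXn2r// nnegrE// !mulr_ge0// invr_ge0 ltW.
Qed.

(** The quotients [(e^(2 i pi s t_j) - 1) u / s] are bounded in norm, so
    Fatou's lemma puts their pointwise limit [2 i pi t_j u] in the space; this
    limit then dominates them, and they converge in norm. *)
Lemma modulation_derivative j (u : E -> R[i]) : L2on leb u ->
  lipschitz_along (unit_mod j) u ->
  exists2 G, L2on leb G & forall e : R, 0 < e -> exists N, forall m, (N <= m)%N ->
    q (scf (m.+1%:R)%:C (dsh (m.+1%:R^-1 *: unit_mod j) u) - G) < e.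
Proof.
move=> Lu [C C0 hC].
pose th (t : E) : R := 2 * pi * tnth t j.
pose G (t : E) : R[i] := 'i * (th t)%:C * u t.
pose D m := scf (m.+1%:R)%:C (dsh (m.+1%:R^-1 *: unit_mod j) u).
have LD m : L2on leb (D m) by apply: L2onZ; exact: L2on_dsh.
have mG : cmeasurable G.
  apply: cmeasurableM; last exact: Lu.1.
  apply: cmeasurableM; first exact: cmeasurable_cst.
  by apply: cmeasurableC; apply: measurable_funM => //; exact: measurable_tnth.
have nG t : nsq (G t) = th t ^+ 2 * nsq (u t).
  by rewrite /G !nsqM nsqC /nsq !reimE; ring.
have DE m t : D m t = (m.+1%:R)%:C * (expi (m.+1%:R^-1 * th t) - 1) * u t.
  rewrite /D /scf -mulrA; congr (_ * _); rewrite mulrBl mul1r.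
  have -> : m.+1%:R^-1 * th t = 2 * pi * (m.+1%:R^-1 * tnth t j).
    by rewrite /th mulrCA.
  by rewrite -tf_unit_mod.
have Dle m t : nsq (D m t) <= nsq (G t).
  rewrite DE nG !nsqM nsqC ler_wpM2r ?nsq_ge0//.
  apply: le_trans (ler_wpM2l (sqr_ge0 _) (nsq_expiB1 _)) _.
  by rewrite -exprMn mulrA divff// mul1r.
have DG m t : nsq (D m t - G t) <= m.+1%:R^-1 * ((th t) ^+ 4 * (1 + (th t) ^+ 2) * nsq (u t)).
  rewrite DE /G -mulrBl nsqM [leRHS]mulrA ler_wpM2r ?nsq_ge0//.
  set a := m.+1%:R^-1.
  have a0 : 0 <= a by rewrite invr_ge0.
  have a1 : a <= 1 by rewrite invf_le1// ler1n.
  have am : m.+1%:R * a = 1 by rewrite divff.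
  have -> : (m.+1%:R)%:C * (expi (a * th t) - 1) - 'i * (th t)%:C =
      (m.+1%:R)%:C * (expi (a * th t) - 1 - 'i * (a * th t)%:C).
    rewrite [RHS]mulrBr; congr (_ - _); rewrite mulrCA; congr (_ * _).
    by rewrite -[RHS]rmorphM/= mulrA am mul1r.
  rewrite nsqM nsqC; apply: le_trans (ler_wpM2l (sqr_ge0 _) (nsq_expiB1_deriv _)) _.
  have -> : m.+1%:R ^+ 2 * ((a * th t) ^+ 4 * (1 + (a * th t) ^+ 2)) =
      (m.+1%:R * a) ^+ 2 * (a * (a * (th t ^+ 4 * (1 + (a ^+ 2 * th t ^+ 2))))) by ring.
  rewrite am expr1n mul1r ler_wpM2l//.
  have t4 : 0 <= th t ^+ 4 by rewrite exprn_even_ge0.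
  have h : 1 + a ^+ 2 * th t ^+ 2 <= 1 + th t ^+ 2.
    by rewrite lerD2l ler_piMl ?sqr_ge0// expr_le1.
  have h0 : 0 <= 1 + a ^+ 2 * th t ^+ 2 by rewrite addr_ge0// mulr_ge0 ?sqr_ge0.
  apply: le_trans (_ : th t ^+ 4 * (1 + a ^+ 2 * th t ^+ 2) <= _); last by rewrite ler_wpM2l.
  by rewrite ler_piMl// mulr_ge0.
have cv t : nsq (D m t - G t) @[m --> \oo] --> 0.
  apply: (@squeeze_cvgr _ _ _ _ (fun=> 0)
    (fun m => m.+1%:R^-1 * ((th t) ^+ 4 * (1 + (th t) ^+ 2) * nsq (u t)))).
  - by near=> m; rewrite nsq_ge0 DG.
  - exact: cvg_cst.
  - rewrite -[X in _ --> X](mul0r ((th t) ^+ 4 * (1 + (th t) ^+ 2) * nsq (u t))).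
    by apply: cvgM; [exact: cvg_harmonic|exact: cvg_cst].
have LG : L2on leb G.
  split=> //; apply: (@le_lt_trans _ _ C%:E); last exact: ltry.
  apply: (fatou_le (N := 0%N) (f_ := fun m t => (nsq (D m t))%:E)).
  - by move=> m; exact: measurable_ensq (LD m).1.
  - by [].
  - by move=> t; exact: cvg_nsq_of_dist.
  - move=> m _; rewrite -sqn_cip// lee_fin (sqnZ H); last exact: L2on_dsh.
    rewrite nsqC; apply: le_trans (ler_wpM2l (sqr_ge0 _) (hC _)) _.
    by rewrite mulrCA -exprMn divff// expr1n mulr1.
exists G => // e e0.
have mDG m : cmeasurable (fun t => D m t - G t) by exact: (ph_domB H (LD m) LG).1.
have bDG m t : nsq (D m t - G t) <= 4 * nsq (G t).
  by apply: le_trans (nsqD_le _ _) _; rewrite nsqN; have := Dle m t; lra.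
have iG : leb.-integrable setT (EFin \o (fun t => 4 * nsq (G t))).
  apply: integrableZl_EFin; apply/integrableP; split; first exact: measurable_ensq.
  by under eq_integral do rewrite gee0_abs//; exact: LG.2.
have [N HN] := L2_dct mDG cv bDG iG e0.
exists N => m Nm; rewrite -lte_fin sqn_cip; first exact: HN.
exact: (ph_domB H (LD m) LG).
Unshelve. all: by end_near.
Qed.

End regularity.

(** * Square-summable families *)

Section ell2.
Context {R : realType} {I : countType}.
Implicit Types a b u : I -> R[i].

Local Notation count := (@counting nat R).

(** Families indexed by a countable type are read as sequences, so that the
    square-summable ones inherit the theory of [L2on] for the counting measure. *)
Definition lseq a : nat -> R[i] := fun m => oapp a 0 (@pickle_inv I m).
Definition ell2 a : Prop := L2on count (lseq a).
Definition lip a b : R[i] := cip count (lseq a) (lseq b).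

Lemma cmeasurable_nat (a : nat -> R[i]) : cmeasurable a.
Proof. by []. Qed.

Lemma integral_lseq a :
  (\int[count]_m (nsq (lseq a m))%:E = \esum_(k in [set: I]) (nsq (a k))%:E)%E.
Proof.
rewrite ge0_integral_count// esum_enum//; apply: eq_eseriesr => m _.
by rewrite /lseq; case: pickle_inv => //=; rewrite nsq0.
Qed.

Lemma ell2E a : ell2 a <-> (\esum_(k in [set: I]) (nsq (a k))%:E < +oo)%E.
Proof. by rewrite /ell2 /L2on integral_lseq; split=> [[]|h]. Qed.

Lemma sqn_lip a : ell2 a -> (sqn lip a)%:E = (\esum_(k in [set: I]) (nsq (a k))%:E)%E.
Proof. by move=> la; rewrite -integral_lseq -sqn_cip. Qed.

Lemma lseqD a b : lseq (a + b) = lseq a + lseq b.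
Proof.
apply: funext => m; have -> : (lseq a + lseq b) m = lseq a m + lseq b m by [].
by rewrite /lseq; case: pickle_inv => //=; rewrite addr0.
Qed.
Lemma lseqZ c a : lseq (scf c a) = scf c (lseq a).
Proof. by apply: funext => m; rewrite /lseq /scf; case: pickle_inv => //=; rewrite mulr0. Qed.
Lemma lseq0 : lseq 0 = 0.
Proof. by apply: funext => m; rewrite /lseq; case: pickle_inv. Qed.

Let H := cip_prehilbert count.

Lemma lip_prehilbert : prehilbert scf ell2 lip.
Proof.
split.
- by rewrite /ell2 lseq0; exact: L2on0.
- by move=> a b la lb; rewrite /ell2 lseqD; exact: (ph_domD H).
- by move=> c a la; rewrite /ell2 lseqZ; exact: (ph_domZ H).
- by move=> a; apply/funext => k; rewrite /scf mulN1r.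
- by move=> a b c la lb lc; rewrite /lip lseqD; exact: (ph_ipD H).
- by move=> c a b la lb; rewrite /lip lseqZ; exact: (ph_ipZ H).
- by move=> a b la lb; exact: (ph_ipC H).
- by move=> a la; exact: (ph_ge0 H).
Qed.

Lemma lip_congr a b a' b' : (forall k, a k * (b k)^* = a' k * (b' k)^*) ->
  lip a b = lip a' b'.
Proof.
move=> h; congr cintegral; apply: funext => m; rewrite /lseq.
by case: pickle_inv => [k|] //=; rewrite !mul0r.
Qed.

Lemma ell2_dominated a b : ell2 a -> (forall k, nsq (b k) <= nsq (a k)) ->
  ell2 b /\ sqn lip b <= sqn lip a.
Proof.
move=> la ba; have h : (\esum_(k in [set: I]) (nsq (b k))%:E <=
    \esum_(k in [set: I]) (nsq (a k))%:E)%E by apply: le_esum => k _; rewrite lee_fin.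
have lb : ell2 b by apply/ell2E; apply: le_lt_trans h _; exact/ell2E.
by split=> //; rewrite -lee_fin !sqn_lip.
Qed.

Lemma ell2_nsq_eq a b : (forall k, nsq (b k) = nsq (a k)) -> ell2 a ->
  ell2 b /\ sqn lip b = sqn lip a.
Proof.
move=> ba la; have [lb le1] : ell2 b /\ sqn lip b <= sqn lip a.
  by apply: ell2_dominated => // k; rewrite ba.
split=> //; apply/eqP; rewrite eq_le le1/=.
have ab k : nsq (a k) <= nsq (b k) by rewrite ba.
by have [] := ell2_dominated lb ab.
Qed.

Lemma ell2_reindex (s : I -> I) a : bijective s -> ell2 a ->
  ell2 (fun k => a (s k)) /\ sqn lip (fun k => a (s k)) = sqn lip a.
Proof.
move=> bs la; have sE : (\esum_(k in [set: I]) (nsq (a k))%:E =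
    \esum_(k in [set: I]) (nsq (a (s k)))%:E)%E.
  by apply: reindex_esum; rewrite setTT_bijective.
have ls : ell2 (fun k => a (s k)) by apply/ell2E; rewrite -sE; exact/ell2E.
by split=> //; apply: EFin_inj; rewrite !sqn_lip.
Qed.

Lemma lip_reindex (s : I -> I) a b : bijective s -> ell2 a -> ell2 b ->
  lip (fun k => a (s k)) (fun k => b (s k)) = lip a b.
Proof.
move=> bs; apply: (isometry_ip lip_prehilbert lip_prehilbert
  (T := fun a k => a (s k))) => // c lc.
- by have [] := ell2_reindex bs lc.
- by have [] := ell2_reindex bs lc.
Qed.

Lemma nsq_le_sqn_lip a k : ell2 a -> nsq (a k) <= sqn lip a.
Proof.
move=> la; rewrite -lee_fin sqn_lip//; apply: esum_ge.
by exists [set k]; [split => //; exact: finite_set1|rewrite fsbig_set1].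
Qed.

Lemma nsq_two_le_sqn_lip a k l : k != l -> ell2 a ->
  nsq (a k) + nsq (a l) <= sqn lip a.
Proof.
move=> kl la; rewrite -lee_fin sqn_lip// (esumID [set k])// setTI esum_set1// EFinD.
rewrite leeD2l//; apply: esum_ge; exists [set l]; last by rewrite fsbig_set1.
split; first exact: finite_set1.
by move=> x /= -> ; split=> //= lk; rewrite lk eqxx in kl.
Qed.

(** Dominated convergence for multipliers of a square-summable family. *)
Lemma ell2_dct a (m : nat -> I -> R[i]) (M : R) : ell2 a ->
  (forall j k, nsq (m j k) <= M) -> (forall k, nsq (m j k) @[j --> \oo] --> 0) ->
  forall e : R, 0 < e -> exists N, forall j, (N <= j)%N ->
    sqn lip (fun k => m j k * a k) < e.
Proof.
move=> la mM m0 e e0.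
pose f j n := lseq (fun k => m j k * a k) n.
have fle j n : nsq (f j n) <= M * nsq (lseq a n).
  rewrite /f /lseq; case: pickle_inv => [k|]/=; last by rewrite nsq0 mulr0.
  by rewrite nsqM ler_wpM2r ?nsq_ge0.
have f0 n : nsq (f j n) @[j --> \oo] --> 0.
  rewrite /f /lseq; case: pickle_inv => [k|]/=; last by rewrite nsq0; exact: cvg_cst.
  rewrite -[X in _ --> X](mul0r (nsq (a k))).
  under eq_fun do rewrite nsqM.
  by apply: cvgM; [exact: m0|exact: cvg_cst].
have ia : count.-integrable setT (EFin \o (fun n => M * nsq (lseq a n))).
  apply: integrableZl_EFin; apply/integrableP; split=> //.
  by under eq_integral do rewrite gee0_abs//; exact: la.2.
have [N HN] := L2_dct (fun j => cmeasurable_nat (f j)) f0 fle ia e0.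
exists N => j Nj; rewrite -lte_fin sqn_cip ?HN//; split=> //.
by apply: lt_trans (HN j Nj) _; exact: ltry.
Qed.

End ell2.

(** * The canonical dual of a Gabor frame *)

Section gabor_coefficients.
Context {R : realType} {d : nat}.
Variable L : 'M[R]_(d + d).
Local Notation E := (Euclidean R d).
Local Notation leb := (lebesgue_Euclidean R d).
Local Notation ip := (cip leb).
Local Notation q := (sqn ip).
Local Notation Lam := 'cV[int]_(d + d).
Implicit Types (f g h u : E -> R[i]) (k l : Lam).
Let H := cip_prehilbert leb.
Let HL := @lip_prehilbert R Lam.

Definition lam k : 'cV[R]_(d + d) := L *m map_mx intr k.

Lemma lamD k l : lam (k + l) = lam k + lam l.
Proof. by rewrite /lam map_mxD mulmxDr. Qed.
Lemma lamN k : lam (- k) = - lam k.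
Proof. by rewrite /lam map_mxN mulmxN. Qed.
Lemma lam0 : lam 0 = 0.
Proof. by rewrite /lam map_mx0 mulmx0. Qed.

(** The analysis coefficients of [f] against the lattice shifts of [g]. *)
Definition coef g f k : R[i] := ip f (tf (lam k) g).

Lemma gabor_sumE g f : gabor_sum L g f = (\esum_(k in [set: Lam]) (nsq (coef g f k))%:E)%E.
Proof. by apply: eq_esum => k _; rewrite nsqE. Qed.

Lemma coefDl g f h : L2on leb g -> L2on leb f -> L2on leb h ->
  coef g (f + h) = coef g f + coef g h.
Proof. by move=> *; apply: funext => k; apply: (ph_ipD H) => //; exact: L2on_tf. Qed.
Lemma coefBl g f h : L2on leb g -> L2on leb f -> L2on leb h ->
  coef g (f - h) = coef g f - coef g h.
Proof. by move=> *; apply: funext => k; apply: (ph_ipB H) => //; exact: L2on_tf. Qed.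
Lemma coefZl g c f : L2on leb g -> L2on leb f -> coef g (scf c f) = scf c (coef g f).
Proof. by move=> *; apply: funext => k; apply: (ph_ipZ H) => //; exact: L2on_tf. Qed.
Lemma coefDr g f h : L2on leb g -> L2on leb f -> L2on leb h ->
  coef (g + h) f = coef g f + coef h f.
Proof.
by move=> *; apply: funext => k; rewrite /coef tfD (ph_ipDr H)//; exact: L2on_tf.
Qed.
Lemma coefBr g f h : L2on leb g -> L2on leb f -> L2on leb h ->
  coef (g - h) f = coef g f - coef h f.
Proof.
by move=> *; apply: funext => k; rewrite /coef tfB (ph_ipBr H)//; exact: L2on_tf.
Qed.

(** Up to a phase, shifting [f] by a lattice point translates its coefficients. *)
Lemma nsq_coef_tf g f l k : L2on leb g -> L2on leb f ->
  nsq (coef g (tf (lam l) f) k) = nsq (coef g f (k - l)).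
Proof.
move=> Lg Lf; rewrite /coef cip_tf_adj//; last exact: L2on_tf.
rewrite tfM (ph_ipZr H)//; last exact: L2on_tf.
rewrite !nsqM nsqJ !nsq_expi !mul1r.
by rewrite lamD lamN (addrC (- _)).
Qed.

Definition bessel (K : R) g : Prop := forall f, L2on leb f ->
  ell2 (coef g f) /\ sqn lip (coef g f) <= K * q f.

Lemma ell2_coef_tf g f l : L2on leb g -> L2on leb f -> ell2 (coef g f) ->
  ell2 (coef g (tf (lam l) f)) /\
  sqn lip (coef g (tf (lam l) f)) = sqn lip (coef g f).
Proof.
move=> Lg Lf lf.
have bs : bijective (fun k : Lam => k - l).
  by exists (fun k => k + l) => k; rewrite ?subrK ?addrK.
have [ls <-] := ell2_reindex bs lf.
have nE k : nsq (coef g (tf (lam l) f) k) = nsq (coef g f (k - l)) by exact: nsq_coef_tf.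
exact: (ell2_nsq_eq nE ls).
Qed.

Section frame.
Variables (n : nat) (g : 'I_n -> E -> R[i]) (A B : R).
Hypotheses (A0 : 0 < A) (Lg : forall i, L2on leb (g i)).
Hypothesis ellg : forall i f, L2on leb f -> ell2 (coef (g i) f).
Hypothesis frame_lower : forall f, L2on leb f ->
  A * q f <= \sum_(i < n) sqn lip (coef (g i) f).
Hypothesis frame_upper : forall f, L2on leb f ->
  \sum_(i < n) sqn lip (coef (g i) f) <= B * q f.

(** For this inner product, equivalent to the original one by the frame
    inequalities, the frame expansion becomes the Riesz theorem. *)
Definition frame_ip f h : R[i] := \sum_(i < n) lip (coef (g i) f) (coef (g i) h).

Lemma sqn_frame_ip f : sqn frame_ip f = \sum_(i < n) sqn lip (coef (g i) f).
Proof. by rewrite /sqn /frame_ip cRe_sum. Qed.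

Lemma frame_ip_prehilbert : prehilbert scf (L2on leb) frame_ip.
Proof.
split.
- exact: (ph_dom0 H).
- exact: (ph_domD H).
- exact: (ph_domZ H).
- exact: (ph_scN1 H).
- move=> f h u Lf Lh Lu; rewrite /frame_ip -big_split/=; apply: eq_bigr => i _.
  by rewrite coefDl// (ph_ipD HL)//; exact: ellg.
- move=> c f h Lf Lh; rewrite /frame_ip mulr_sumr; apply: eq_bigr => i _.
  by rewrite coefZl// (ph_ipZ HL)//; exact: ellg.
- move=> f h Lf Lh; rewrite /frame_ip rmorph_sum/=; apply: eq_bigr => i _.
  by rewrite (ph_ipC HL)//; exact: ellg.
- move=> f Lf; rewrite -/(sqn frame_ip f) sqn_frame_ip; apply: sumr_ge0 => i _.
  by apply: (sqn_ge0 HL); exact: ellg.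
Qed.
Let Hf := frame_ip_prehilbert.

Let frame_complete : ph_complete (L2on leb) frame_ip.
Proof.
move=> u Lu uC.
have [|f Lf uf] := @L2on_complete _ _ _ leb u Lu.
  move=> e e0; have [N HN] := uC _ (mulr_gt0 A0 e0); exists N => j k Nj Nk.
  rewrite -(ltr_pM2l A0); apply: le_lt_trans (HN j k Nj Nk).
  by rewrite sqn_frame_ip; apply: frame_lower; exact: (ph_domB H).
exists f => // e e0.
have B1 : 0 < `|B| + 1 by rewrite ltr_wpDl.
have [N HN] := uf _ (divr_gt0 e0 B1); exists N => k Nk.
have Lk := ph_domB H (Lu k) Lf; rewrite sqn_frame_ip.
apply: le_lt_trans (frame_upper Lk) _.
have q0 := sqn_ge0 H Lk.
apply: le_lt_trans (_ : (`|B| + 1) * q (u k - f) < e).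
  by rewrite ler_wpM2r// (le_trans (ler_norm _))// lerDl.
by rewrite mulrC -ltr_pdivlMr// HN.
Qed.

Lemma dual_exists u : L2on leb u ->
  exists2 h, L2on leb h & forall f, L2on leb f -> ip f u = frame_ip f h.
Proof.
move=> Lu; apply: (riesz Hf (K := q u / A)) => //.
- by move=> f h Lf Lh; exact: (ph_ipD H).
- by move=> c f Lf; exact: (ph_ipZ H).
- move=> f Lf; apply: le_trans (cauchy_schwarz H Lf Lu) _.
  rewrite mulrC -mulrA ler_wpM2l//; first exact: (sqn_ge0 H).
  by rewrite mulrC ler_pdivlMr// mulrC sqn_frame_ip frame_lower.
Qed.

(** The inverse frame operator applied to [u], defined by
    [<f, u> = frame_ip f (dual u)]. *)
Definition dual u : E -> R[i] :=
  xget 0 [set h | L2on leb h /\ forall f, L2on leb f -> ip f u = frame_ip f h].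

Let dualP u : L2on leb u ->
  L2on leb (dual u) /\ forall f, L2on leb f -> ip f u = frame_ip f (dual u).
Proof.
move=> Lu; have [h Lh hP] := dual_exists Lu.
exact: (@xgetPex _ _ [set h | L2on leb h /\ forall f, L2on leb f -> ip f u = frame_ip f h]
  (ex_intro _ h (conj Lh hP))).
Qed.

Let L2on_dual u (Lu : L2on leb u) : L2on leb (dual u) := (dualP Lu).1.
Let dualE u f (Lu : L2on leb u) (Lf : L2on leb f) : ip f u = frame_ip f (dual u) :=
  (dualP Lu).2 f Lf.

Let dual_sym f u : L2on leb f -> L2on leb u -> ip (dual f) u = ip f (dual u).
Proof.
move=> Lf Lu; have Df := L2on_dual Lf; have Du := L2on_dual Lu.
rewrite (dualE Lu Df) (ph_ipC Hf Du Df) -(dualE Lf Du).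
by rewrite -(ph_ipC H Du Lf).
Qed.

Let frame_ip_tf l f h : L2on leb f -> L2on leb h ->
  frame_ip (tf (lam l) f) (tf (lam l) h) = frame_ip f h.
Proof.
apply: (isometry_ip Hf Hf) => [k|k k' _ _|c k _|k Lk].
- exact: L2on_tf.
- exact: tfD.
- exact: tfZ.
rewrite !sqn_frame_ip; apply: eq_bigr => i _.
by have [] := ell2_coef_tf l (Lg i) Lk (ellg i Lk).
Qed.

(** The frame inner product is invariant under lattice shifts, so [dual]
    commutes with them; since [dual u] is only determined up to a null function,
    this is stated inside an inner product. *)
Let dual_tf l f u : L2on leb f -> L2on leb u ->
  ip f (tf (lam l) (dual u)) = ip f (dual (tf (lam l) u)).
Proof.
move=> Lf Lu; have Du := L2on_dual Lu; have Lt := L2on_tf (lam l) Lu.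
have La := L2on_tf (lam l) Du; have Lb := L2on_dual Lt.
have Ld := ph_domB H La Lb; set D := _ - _ in Ld.
have D0 G : L2on leb G -> frame_ip G D = 0.
  move=> LG; pose F := scf (expi (- (2 * pi * beta (lam l) (lam l)))) (tf (- lam l) G).
  have LF : L2on leb F by apply: L2onZ; exact: L2on_tf.
  have -> : G = tf (lam l) F.
    by rewrite /F tfZ tfNK scfA -expiD addNr expi0 scf1.
  have LtF := L2on_tf (lam l) LF.
  by rewrite (ph_ipBr Hf La Lb LtF) frame_ip_tf// -!dualE// cip_tf// subrr.
have qD : q D = 0.
  apply/eqP; rewrite eq_le (sqn_ge0 H Ld) andbT -(ler_pM2l A0) mulr0.
  by apply: le_trans (frame_lower Ld) _; rewrite -sqn_frame_ip /sqn D0// cRe0.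
apply/eqP; rewrite -subr_eq0 -(ph_ipBr H La Lb Lf); apply/eqP; apply: nsq_eq0.
apply/eqP; rewrite eq_le nsq_ge0 andbT; apply: le_trans (cauchy_schwarz H Lf Ld) _.
by rewrite qD mulr0.
Qed.

(** By [dual_tf] and the symmetry of [dual]; it makes the dual windows a
    Bessel family. *)
Let coef_dual i f : L2on leb f -> coef (dual (g i)) f = coef (g i) (dual f).
Proof.
move=> Lf; apply: funext => k; rewrite /coef dual_tf// dual_sym//.
exact: L2on_tf.
Qed.

Let sqn_dual f : L2on leb f -> q (dual f) <= q f / A ^+ 2.
Proof.
move=> Lf; have Df := L2on_dual Lf; have q0 := sqn_ge0 H Df.
have [->|qn] := eqVneq (q (dual f)) 0.
  by rewrite divr_ge0 ?sqr_ge0//; exact: (sqn_ge0 H).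
have qp : 0 < q (dual f) by rewrite lt0r qn.
have h1 : A * q (dual f) <= complex.Re (ip (dual f) f).
  by rewrite dualE// -/(sqn frame_ip _) sqn_frame_ip frame_lower.
have h2 : (A * q (dual f)) ^+ 2 <= q (dual f) * q f.
  apply: le_trans (cauchy_schwarz H Df Lf); apply: le_trans (Re_sqr_le _).
  have a0 : 0 <= A * q (dual f) by rewrite mulr_ge0 ?(ltW A0).
  by rewrite ler_pXn2r// nnegrE (le_trans a0).
rewrite ler_pdivlMr ?exprn_gt0// -(ler_pM2l qp); apply: le_trans h2.
by rewrite le_eqVlt; apply/orP; left; apply/eqP; ring.
Qed.

(** The last clause expresses [<g_i,h_i>] as the frame norm of [dual (g i)];
    it yields [<g_i,h_i> >= <g_i,h_i>^2]. *)
Theorem dual_frame : exists h : 'I_n -> E -> R[i],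
  [/\ forall i, L2on leb (h i),
      exists K, forall i, bessel K (h i),
      forall f u, L2on leb f -> L2on leb u ->
        ip f u = \sum_(j < n) lip (coef (h j) f) (coef (g j) u)
    & forall i, ip (g i) (h i) = (\sum_(j < n) sqn lip (coef (h j) (g i)))%:C].
Proof.
exists (fun i => dual (g i)); split.
- by move=> i; exact: L2on_dual.
- exists (`|B| / A ^+ 2) => i f Lf; rewrite coef_dual//; have Df := L2on_dual Lf.
  split; first exact: ellg.
  apply: (@le_trans _ _ (\sum_(j < n) sqn lip (coef (g j) (dual f)))).
    rewrite (bigD1 i)//= lerDl; apply: sumr_ge0 => j _.
    by apply: (sqn_ge0 HL); exact: ellg.
  apply: le_trans (frame_upper Df) _.
  apply: le_trans (ler_wpM2r (sqn_ge0 H Df) (ler_norm B)) _.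
  by rewrite -mulrA ler_wpM2l// [_^-1 * _]mulrC sqn_dual.
- move=> f u Lf Lu; have Df := L2on_dual Lf; have Du := L2on_dual Lu.
  have E1 : ip f u = frame_ip (dual f) u.
    rewrite (ph_ipC H Lu Lf) (dualE Lf Lu).
    by rewrite -(ph_ipC Hf Lu Df).
  rewrite E1 /frame_ip; apply: eq_bigr => j _.
  by rewrite coef_dual.
- move=> i; have Dg := L2on_dual (Lg i).
  under eq_bigr => j _ do rewrite (coef_dual j (Lg i)).
  by rewrite -sqn_frame_ip -(ph_ip_real Hf Dg) -(dualE (Lg i) Dg) dual_sym.
Qed.

End frame.

End gabor_coefficients.

(** * Density one forces biorthogonality *)

Lemma two_bounds (R : realType) (K1 K2 a b x : R) : a <= K1 * x -> b <= K2 * x ->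
  2 * a + 2 * b <= (2 * K1 + 2 * K2) * x.
Proof. lra. Qed.

Lemma squeezed (R : realType) (a b : R) : 1 <= a -> a + b <= 1 -> b <= 0.
Proof. lra. Qed.

Lemma sqn_polar (R : realType) (V : zmodType) (sc : R[i] -> V -> V) D ip
    (H : prehilbert sc D ip) (f g : V) : D f -> D g ->
  sqn ip (f + g) = sqn ip (f - g) + 4 * complex.Re (ip g f).
Proof.
move=> Df Dg; rewrite (sqnD H)// (sqnB H)// (ph_ipC H Df Dg) cReJ; ring.
Qed.

Section density_one.
#[local] Opaque nsq cip lip gaussian tf tfshift.

Context {R : realType} {d : nat}.
Variable L : 'M[R]_(d + d).
Local Notation E := (Euclidean R d).
Local Notation E2 := (Euclidean R (d + d)).
Local Notation leb := (lebesgue_Euclidean R d).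
Local Notation leb2 := (lebesgue_Euclidean R (d + d)).
Local Notation ip := (cip leb).
Local Notation q := (sqn ip).
Local Notation Lam := 'cV[int]_(d + d).
Local Notation phi := (@gaussian R d).
Implicit Types (k : Lam).
Let H := cip_prehilbert leb.
Let HL := @lip_prehilbert R Lam.
Let Lp := @L2on_gaussian R d.

Definition moved_window (y : E2) : E -> R[i] := tf (L *m tcol y) phi.

Let L2on_moved y : L2on leb (moved_window y). Proof. exact: L2on_tf. Qed.

Let cube (y : E2) : R := (in_cube y)%:R.

Let cube_ge0 y : 0 <= cube y. Proof. by []. Qed.
Let measurable_cube : measurable_fun setT cube. Proof. exact: measurable_in_cube. Qed.

Let nsq_windowed_lattice u k y : L2on leb u ->
  nsq (windowed phi u (tlin L (tadd (intv k) y))) = nsq (coef L u (moved_window y) (- k)).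
Proof.
move=> Lu; have Lm := L2on_moved y; have Lt := L2on_tf (lam L (- k)) Lu.
pose v := L *m tcol y; have Lz := L2on_tf (lam L k + v) Lp.
have W : tlin L (tadd (intv k) y) = ctup (lam L k + v).
  by rewrite /tlin /tadd ctupK mulmxDr.
have T : tf (lam L k) (moved_window y) =
    scf (expi (- (2 * pi * beta (lam L k) v))) (tf (lam L k + v) phi) := tfM _ _ _.
have N1 : nsq (ip u (tf (lam L k) (moved_window y))) = nsq (ip u (tf (lam L k + v) phi)).
  by rewrite T (ph_ipZr H _ Lu Lz) nsqM nsqJ nsq_expi mul1r.
have N2 : nsq (ip (tf (lam L (- k)) u) (moved_window y)) = nsq (ip u (tf (lam L k) (moved_window y))).
  by rewrite (cip_tf_adj _ Lu Lm) nsqM nsq_expi mul1r lamN opprK.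
have N3 : nsq (coef L u (moved_window y) (- k)) = nsq (ip (tf (lam L (- k)) u) (moved_window y)).
  by rewrite /coef (ph_ipC H Lt Lm); exact: nsqJ.
have E0 : windowed phi u (tlin L (tadd (intv k) y)) = ip u (tf (lam L k + v) phi).
  by rewrite W /windowed ctupK.
exact: etrans (congr1 nsq E0) (etrans (esym N1) (etrans (esym N2) (esym N3))).
Qed.

Let measurable_windowed_lattice u k : L2on leb u ->
  measurable_fun setT (fun y => (nsq (windowed phi u (tlin L (tadd (intv k) y))))%:E).
Proof.
move=> Lu; apply: measurable_ensq.
apply: (cmeasurable_comp (cmeasurable_windowed Lp Lu.1) (h := fun y => tlin L (tadd (intv k) y))).
apply: measurableT_comp; first exact: measurable_tlin.
exact: measurable_tadd.
Qed.

Let sqn_coef_moved u y : L2on leb u -> ell2 (coef L u (moved_window y)) ->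
  (\esum_(k in [set: Lam]) (nsq (windowed phi u (tlin L (tadd (intv k) y))))%:E =
   (sqn lip (coef L u (moved_window y)))%:E)%E.
Proof.
move=> Lu lu; rewrite (sqn_lip lu).
have bN : bijective (fun k : Lam => - k) by exists (fun k => - k) => k; rewrite opprK.
rewrite (@reindex_esum _ _ _ setT setT (fun k : Lam => - k)); last by rewrite setTT_bijective.
apply: eq_esum => k _; congr (_%:E).
by rewrite (nsq_windowed_lattice (- k) y Lu) opprK.
Qed.

(** The squared norm of the coefficients, against [u], of the Gaussian moved to
    the phase-space point [L y]. *)
Definition lattice_energy u y : R := sqn lip (coef L u (moved_window y)).

Let energy_ge0 u K y : bessel L K u -> 0 <= lattice_energy u y.
Proof. by move=> bu; exact: (sqn_ge0 HL (bu _ (L2on_moved y)).1). Qed.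

Let measurable_energy u K : L2on leb u -> bessel L K u ->
  measurable_fun setT (fun y => (lattice_energy u y)%:E).
Proof.
move=> Lu bu; have := @measurable_esum R Lam _ _
  (fun k y => (nsq (windowed phi u (tlin L (tadd (intv k) y))))%:E)
  (fun k => measurable_windowed_lattice k Lu) (fun _ _ => ensq_ge0 _).
apply: eq_measurable_fun => y _; exact: (sqn_coef_moved Lu (bu _ (L2on_moved y)).1).
Qed.

(** The Moyal integral over phase space, split into fundamental domains: the
    lattice shifts of [phi] can be moved to the other side as opposite shifts of
    [u]. *)
Lemma cube_average u K : \det L != 0 -> L2on leb u -> bessel L K u ->
  ((`|\det L|)%:E * \int[leb2]_y (cube y * lattice_energy u y)%:E =
   (q phi * q u)%:E)%E.
Proof.
move=> dL Lu bu; rewrite -(integral_nsq_windowed Lp (@nsq_gaussian_le1 R d) Lu).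
have mV := measurable_ensq (cmeasurable_windowed Lp Lu.1).
rewrite (ge0_integral_linear dL mV (fun z => ensq_ge0 _)); congr (_ * _)%E.
have mVL := measurableT_comp mV (measurable_tlin L).
rewrite [RHS](ge0_integral_tiling mVL (fun z => ensq_ge0 _)).
have mc : measurable_fun setT (fun y => (cube y)%:E) by apply/measurable_EFinP.
pose a k y := ((cube y)%:E * (nsq (windowed phi u (tlin L (tadd (intv k) y))))%:E)%E.
have ma k : measurable_fun setT (a k).
  exact: (emeasurable_funM mc (measurable_windowed_lattice k Lu)).
have a0 k y : (0 <= a k y)%E by apply: mule_ge0; [exact: cube_ge0|exact: ensq_ge0].
apply: etrans (@integral_esum R Lam _ _ leb2 a ma a0).
apply: eq_integral => y _; rewrite EFinM /lattice_energy -(sqn_coef_moved Lu (bu _ (L2on_moved y)).1).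
have [c1|c0] : cube y = 1 \/ cube y = 0 by rewrite /cube; case: in_cube; [left|right].
  by rewrite c1 mul1e; apply: eq_esum => k _; rewrite /a c1 mul1e.
by rewrite c0 mul0e esum1// => k _; rewrite /a c0 mul0e.
Qed.

Section biorthogonality.
Variables (n : nat) (g h : 'I_n -> E -> R[i]) (Kg Kh : R).
Hypotheses (n0 : (0 < n)%N) (detL : `|\det L| = n%:R).
Hypotheses (Lg : forall i, L2on leb (g i)) (Lh : forall i, L2on leb (h i)).
Hypotheses (bg : forall i, bessel L Kg (g i)) (bh : forall i, bessel L Kh (h i)).
Hypothesis expansion : forall f u, L2on leb f -> L2on leb u ->
  ip f u = \sum_(j < n) lip (coef L (h j) f) (coef L (g j) u).
Hypothesis diagonal : forall i,
  ip (g i) (h i) = (\sum_(j < n) sqn lip (coef L (h j) (g i)))%:C.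

Let n1 : 0 < n%:R :> R. Proof. by rewrite ltr0n. Qed.
Let dL : \det L != 0. Proof. by rewrite -normr_gt0 detL. Qed.

Let bessel_add i : bessel L (2 * Kg + 2 * Kh) (g i + h i).
Proof.
move=> f Lf; have [lg Bg] := bg i Lf; have [lh Bh] := bh i Lf.
rewrite (coefDr L (Lg i) Lf (Lh i)); split; first exact: (ph_domD HL lg lh).
exact: le_trans (sqnD_le HL lg lh) (two_bounds Bg Bh).
Qed.

Let bessel_sub i : bessel L (2 * Kg + 2 * Kh) (g i - h i).
Proof.
move=> f Lf; have [lg Bg] := bg i Lf; have [lh Bh] := bh i Lf.
rewrite (coefBr L (Lg i) Lf (Lh i)); split; first exact: (ph_domB HL lg lh).
exact: le_trans (sqnB_le HL lg lh) (two_bounds Bg Bh).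
Qed.

(** The frame expansion of [pi(z) phi] against itself, in polarized form: this
    turns it into an identity between nonnegative quantities, which can be
    integrated. *)
Let energy_polar y : \sum_(i < n) lattice_energy (g i + h i) y =
  \sum_(i < n) lattice_energy (g i - h i) y + 4 * q phi.
Proof.
have Lm := L2on_moved y.
have <- : q (moved_window y) = q phi by exact: sqn_tf.
have -> : q (moved_window y) = \sum_(i < n)
    complex.Re (lip (coef L (h i) (moved_window y)) (coef L (g i) (moved_window y))).
  by rewrite /sqn (expansion Lm Lm) cRe_sum.
rewrite mulr_sumr -big_split/=; apply: eq_bigr => i _.
have [lg _] := bg i Lm; have [lh _] := bh i Lm.
rewrite /lattice_energy (coefDr L (Lg i) Lm (Lh i)) (coefBr L (Lg i) Lm (Lh i)).
exact: (sqn_polar HL lg lh).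
Qed.

#[local] Opaque lattice_energy.

Let average (u : 'I_n -> E -> R[i]) K : (forall i, L2on leb (u i)) ->
  (forall i, bessel L K (u i)) ->
  (\int[leb2]_y (cube y * \sum_(i < n) lattice_energy (u i) y)%:E =
   (q phi / n%:R * \sum_(i < n) q (u i))%:E)%E.
Proof.
move=> Lu bu; under eq_integral do rewrite mulr_sumr -sumEFin.
rewrite ge0_integral_sum//; last 2 first.
- move=> i; rewrite (_ : (fun _ => _) = (fun y => (cube y)%:E *
    (lattice_energy (u i) y)%:E)%E); last by apply: funext => y; rewrite EFinM.
  apply: emeasurable_funM; first exact/measurable_EFinP.
  exact: (measurable_energy (Lu i) (bu i)).
- move=> i y _; rewrite lee_fin; apply: mulr_ge0 => //; exact: (energy_ge0 y (bu i)).
rewrite mulr_sumr -sumEFin; apply: eq_bigr => i _.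
have := cube_average dL (Lu i) (bu i); rewrite detL.
set X := (\int[_]_y _)%E => hX.
have -> : X = ((n%:R^-1)%:E * ((n%:R)%:E * X))%E.
  by rewrite muleA -EFinM mulVf ?mul1e// gt_eqF.
by rewrite hX -EFinM; congr (_%:E); rewrite mulrA [_^-1 * _]mulrC.
Qed.

(** Averaging [energy_polar] over the unit cube by [cube_average] gives
    [sum_i |g_i + h_i|^2 = sum_i |g_i - h_i|^2 + 4 |det L|]. *)
Lemma trace_identity : \sum_(i < n) complex.Re (ip (g i) (h i)) = n%:R.
Proof.
have La i : L2on leb (g i + h i) := ph_domD H (Lg i) (Lh i).
have Lb i : L2on leb (g i - h i) := ph_domB H (Lg i) (Lh i).
have h1 := average La bessel_add; have h2 := average Lb bessel_sub.
have mcE : measurable_fun setT (fun y => (cube y)%:E) by apply/measurable_EFinP.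
have h3 : (\int[leb2]_y (cube y * (4 * q phi))%:E = (4 * q phi)%:E)%E.
  have qp : 0 <= 4 * q phi by rewrite mulr_ge0//; exact: (sqn_ge0 H).
  transitivity (\int[leb2]_y ((4 * q phi)%:E * (cube y)%:E))%E.
    by apply: eq_integral => y _; rewrite -EFinM mulrC.
  have c0 (y : E2) : [set: E2] y -> (0 <= (cube y)%:E)%E by move=> _; rewrite lee_fin.
  by rewrite (ge0_integralZl_EFin leb2 measurableT c0 mcE qp) integral_cube mule1.
have : (\int[leb2]_y (cube y * \sum_(i < n) lattice_energy (g i + h i) y)%:E =
    \int[leb2]_y (cube y * \sum_(i < n) lattice_energy (g i - h i) y)%:E +
    \int[leb2]_y (cube y * (4 * q phi))%:E)%E.
  rewrite -ge0_integralD//.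
  - apply: eq_integral => y _.
    apply: etrans (congr1 (fun s => (cube y * s)%:E) (energy_polar y)) _.
    by rewrite mulrDr EFinD.
  - move=> y _; rewrite lee_fin; apply: mulr_ge0 => //; apply: sumr_ge0 => i _.
    exact: (energy_ge0 y (@bessel_sub i)).
  - rewrite (_ : (fun _ => _) = (fun y => (cube y)%:E *
      \sum_(i < n) (lattice_energy (g i - h i) y)%:E)%E); last first.
      by apply: funext => y; rewrite EFinM sumEFin.
    apply: (emeasurable_funM mcE); apply: emeasurable_sum => i.
    exact: (measurable_energy (Lb i) (@bessel_sub i)).
  - by move=> y _; rewrite lee_fin !mulr_ge0//; exact: (sqn_ge0 H).
  - by apply/measurable_EFinP; apply: measurable_funM.
move=> eq_int.
have h4 : q phi / n%:R * (\sum_(i < n) q (g i + h i)) =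
    q phi / n%:R * (\sum_(i < n) q (g i - h i)) + 4 * q phi.
  by apply: EFin_inj; exact: (etrans (esym h1) (etrans eq_int (f_equal2 adde h2 h3))).
move: h4 {h1 h2 h3 eq_int}.
have -> : \sum_(i < n) q (g i + h i) =
    \sum_(i < n) q (g i - h i) + 4 * \sum_(i < n) complex.Re (ip (g i) (h i)).
  rewrite mulr_sumr -big_split/=; apply: eq_bigr => i _.
  by rewrite (sqn_polar H (Lg i) (Lh i)) (ph_ipC H (Lg i) (Lh i)) cReJ.
rewrite mulrDr => /addrI; have := @sqn_gaussian_gt0 R d.
move: (\sum_(i < n) _) (q phi) => S x x0 xS.
have {}xS : (x * 4) * S = (x * 4) * n%:R.
  have nn : n%:R != 0 :> R by rewrite gt_eqF.
  have -> : (x * 4) * S = x / n%:R * (4 * S) * n%:R by field.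
  by rewrite xS; ring.
by apply: (mulfI _ xS); rewrite mulf_neq0// gt_eqF.
Qed.

(** Each [S i = <g_i,h_i>] satisfies [S i ^ 2 <= S i <= 1] and they add up to
    [n], so they are all [1].  The single coefficient [<g_i,h_i>] then exhausts
    the sum of the squares of the [<g_i, pi(l) h_j>]. *)
Theorem biorthogonality i j k : coef L (h j) (g i) k = ((i == j) && (k == 0))%:R.
Proof.
pose S a := \sum_(l < n) sqn lip (coef L (h l) (g a)).
have lh a b : ell2 (coef L (h b) (g a)) by have [] := bh b (Lg a).
have xE a : complex.Re (ip (g a) (h a)) = S a by rewrite diagonal cReC.
have c0 a : nsq (coef L (h a) (g a) 0) = S a ^+ 2.
  by rewrite /coef lam0 tf0 diagonal nsqC.
have q0 a b : 0 <= sqn lip (coef L (h b) (g a)) by apply: (sqn_ge0 HL).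
have Sge a : S a ^+ 2 <= S a.
  rewrite -c0 /S (bigD1 a)//=; apply: le_trans (nsq_le_sqn_lip 0 (lh a a)) _.
  by rewrite lerDl sumr_ge0.
have S1 a : S a <= 1.
  have := Sge a; have [->|s0] := eqVneq (S a) 0; first by rewrite ler01.
  have sp : 0 < S a by rewrite lt0r s0 sumr_ge0.
  by rewrite expr2 -{3}[S a]mulr1 ler_pM2l.
have Sone a : S a = 1.
  have s : \sum_(b < n) (1 - S b) = 0.
    rewrite sumrB sumr_const card_ord -trace_identity.
    by under [X in _ - X]eq_bigr do rewrite -xE; rewrite subrr.
  have /eqP := s; rewrite psumr_eq0; last by move=> b _; rewrite subr_ge0.
  by move=> /allP/(_ a (mem_index_enum _)); rewrite /= subr_eq0 => /eqP.
case: (eqVneq i j) => [<-|ij] /=.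
  case: (eqVneq k 0) => [->|k0].
    by rewrite /coef lam0 tf0 diagonal -/(S i) Sone.
  apply: nsq_eq0; apply/eqP; rewrite eq_le nsq_ge0 andbT.
  have g1 : 1 <= nsq (coef L (h i) (g i) 0) by rewrite c0 Sone expr1n.
  have hs : sqn lip (coef L (h i) (g i)) <= 1.
    by rewrite -(Sone i) /S (bigD1 i)//= lerDl sumr_ge0.
  have k0' : 0 != k by rewrite eq_sym.
  exact: squeezed g1 (le_trans (nsq_two_le_sqn_lip k0' (lh i i)) hs).
apply: nsq_eq0; apply/eqP; rewrite eq_le nsq_ge0 andbT.
apply: le_trans (nsq_le_sqn_lip k (lh i j)) _.
have := nsq_le_sqn_lip 0 (lh i i); rewrite c0 Sone expr1n.
have : sqn lip (coef L (h i) (g i)) + sqn lip (coef L (h j) (g i)) <= S i.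
  rewrite /S (bigD1 i)//= (bigD1 j)//= ?addrA ?lerDl ?sumr_ge0//.
  by rewrite eq_sym.
by rewrite Sone => h2 h1; exact: (squeezed h1 h2).
Qed.

End biorthogonality.

End density_one.

(** * No biorthogonal pair with a regular window *)

Lemma nsq_sum_le (R : realType) n (z : 'I_n -> R[i]) :
  nsq (\sum_(i < n) z i) <= 2 ^+ n * \sum_(i < n) nsq (z i).
Proof.
elim: n z => [|n IH] z; first by rewrite !big_ord0 nsq0 mulr0.
rewrite !big_ord_recr/=; apply: le_trans (nsqD_le _ _) _.
have IHz := IH (fun i => z (widen_ord (leqnSn n) i)).
have n1 : 1 <= 2 ^+ n :> R by rewrite exprn_ege1// ler1n.
have hx : nsq (z ord_max) <= 2 ^+ n * nsq (z ord_max).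
  by apply: ler_peMl => //; exact: nsq_ge0.
rewrite exprS; move: IHz hx {n1}.
set s := \sum_(i < n) z _; set t := \sum_(i < n) nsq _.
move: (nsq s) t (nsq (z ord_max)) (2 ^+ n : R) => x y u c h1 h2; lra.
Qed.

Lemma four_terms (R : realType) (x y a b e : R) : x <= e * a -> y <= e * b ->
  2 * x + 2 * y <= e * (2 * a + 2 * b).
Proof. lra. Qed.

Lemma recombine (R : realType) (r : R) (c p x y z w : R[i]) :
  z = r%:C * x -> w = z - y ->
  nsq (r%:C * conjc (c * p * x)) = nsq (c * p * y + c * p * w).
Proof.
move=> -> ->; rewrite -mulrDr addrC subrK mulrCA [LHS]nsqM [RHS]nsqM; congr (_ * _).
exact: nsqJ.
Qed.

Lemma eight_bound (R : realType) (v r k x : R) : v <= 4 * r -> r <= k * x ->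
  2 * v <= 8 * k * x.
Proof. lra. Qed.

Lemma small_sum (R : realType) (s x e k : R) : s < e / 4 -> x < e / (16 * k + 1) ->
  0 <= x -> 0 <= k -> 2 * s + 8 * k * x < e.
Proof.
move=> se xe x0 k0; have k1 : 0 < 16 * k + 1 by rewrite ltr_wpDl// mulr_ge0.
rewrite ltr_pdivlMr// in xe; nra.
Qed.

Lemma rescale (R : realType) (m e a c s : R) : m * e = 1 -> a <= c * e ^+ 2 -> 0 <= s ->
  (m ^+ 2) ^+ 2 * (a * s) <= c * (m ^+ 2 * s).
Proof.
move=> me ac s0.
have -> : c * (m ^+ 2 * s) = (m ^+ 2) ^+ 2 * (c * e ^+ 2 * s).
  have -> : (m ^+ 2) ^+ 2 * (c * e ^+ 2 * s) = (m * e) ^+ 2 * (c * (m ^+ 2 * s)) by ring.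
  by rewrite me expr1n mul1r.
by rewrite ler_wpM2l ?sqr_ge0// ler_wpM2r.
Qed.

Lemma two_squares (R : realType) (x y c1 c2 e : R) : x <= c2 * e ^+ 2 -> y <= c1 * e ^+ 2 ->
  0 <= c1 -> 0 <= c2 -> 0 <= e -> e <= 1 -> 2 * x + 2 * y <= (2 * c1 + 2 * c2) * e.
Proof.
move=> hx hy h1 h2 e0 e1; have e2 : e ^+ 2 <= e by rewrite expr2 ler_piMr.
have k1 := ler_wpM2l h1 e2; have k2 := ler_wpM2l h2 e2; lra.
Qed.

Lemma quarter_bound (R : realType) (a x y ce : R) : 1 <= a -> ce < 4^-1 -> y <= ce ->
  a <= 2 * x + 2 * y -> 4^-1 <= x.
Proof. lra. Qed.

Lemma product_bound (R : realType) (x y : R) : 4 <= x -> 4^-1 <= y -> 1 <= x * y.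
Proof. nra. Qed.

Lemma nsqBC (R : realType) (z w : R[i]) : nsq w <= 2 * nsq z + 2 * nsq (z - w).
Proof. by have := nsqD_le z (w - z); rewrite addrC subrK -[nsq (w - z)]nsqN opprB. Qed.

Lemma eighth_bound (R : realType) (s x y : R) : 0 <= s -> s <= 2 * x + 2 * y ->
  y <= s / 8 -> s / 4 <= x.
Proof. lra. Qed.

(** Quantitative form of [|e^(i t) - 1| ~ t] for [t = 2 p e^2] small, with
    [m = 1 / e]. *)
Lemma chirp_bound (R : realType) (m e p : R) : m * e = 1 -> 0 <= e -> e <= 1 -> 2 <= p ->
  e * (2 * p) < 4^-1 -> nsq (expi (2 * p * e ^+ 2) - 1 - 'i * (2 * p * e ^+ 2)%:C) <=
    (2 * p * e ^+ 2) ^+ 4 * (1 + (2 * p * e ^+ 2) ^+ 2) ->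
  4 <= (m ^+ 2) ^+ 2 * nsq (expi (2 * p * e ^+ 2) - 1).
Proof.
move=> me e0 e1 p2 ep; set t := 2 * p * e ^+ 2 => hd.
have t4 : 0 <= t <= 4^-1.
  rewrite mulr_ge0 ?sqr_ge0 ?mulr_ge0 ?(le_trans _ p2)//=.
  have : e * (e * (2 * p)) <= 1 * (e * (2 * p)) by rewrite ler_wpM2r// mulr_ge0// mulr_ge0// (le_trans _ p2).
  rewrite /t expr2; nra.
have h := nsqBC (expi t - 1) ('i * t%:C).
have it : nsq ('i * t%:C) = t ^+ 2 by rewrite nsqM nsqC /nsq !reimE; ring.
rewrite it in h.
have mt : (m ^+ 2) ^+ 2 * t ^+ 2 = 4 * p ^+ 2.
  have -> : (m ^+ 2) ^+ 2 * t ^+ 2 = (m * e) ^+ 4 * (4 * p ^+ 2) by rewrite /t; ring.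
  by rewrite me expr1n mul1r.
have tt : t ^+ 4 * (1 + t ^+ 2) <= t ^+ 2 / 8.
  have -> : t ^+ 4 = t ^+ 2 * t ^+ 2 by ring.
  rewrite -mulrA ler_wpM2l ?sqr_ge0//; move/andP: t4 => [t0 t1].
  have : t ^+ 2 <= 16^-1 by nra.
  have := sqr_ge0 t; nra.
have lo : t ^+ 2 / 4 <= nsq (expi t - 1) := eighth_bound (sqr_ge0 t) h (le_trans hd tt).
apply: le_trans (ler_wpM2l (sqr_ge0 _) lo).
have pp : 2 * 2 <= p * p by apply: ler_pM.
rewrite mulrA mt expr2; move: (p * p) pp => y; lra.
Qed.

Lemma swap_conj (R : realType) (x y z w : R[i]) :
  x * (conjc (z * w * y))^* = y * (conjc (z * w * x))^*.
Proof. by apply: complexP; rewrite !reimE; ring. Qed.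

Lemma conj_sub (R : realType) (x y z w : R[i]) :
  conjc (y * w * x) - conjc (z * w * x) = conjc ((y - z) * w * x).
Proof. by apply: complexP; rewrite !reimE; ring. Qed.

Lemma second_difference (R : realType) (x y z w u : R[i]) :
  x - w - (z - u) - (y - z - (w - u)) = x - y.
Proof. ring. Qed.

Section battle.
#[local] Opaque nsq cip lip gaussian tf tfshift.

Context {R : realType} {d : nat}.
Variable L : 'M[R]_(d + d).
Local Notation E := (Euclidean R d).
Local Notation leb := (lebesgue_Euclidean R d).
Local Notation ip := (cip leb).
Local Notation q := (sqn ip).
Local Notation Lam := 'cV[int]_(d + d).
Implicit Types (k : Lam) (a b w v : 'cV[R]_(d + d)).
Let H := cip_prehilbert leb.
Let HL := @lip_prehilbert R Lam.

Lemma betaZl (s : R) v w : beta (s *: v) w = s * beta v w.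
Proof. by rewrite /beta mulr_sumr; apply: eq_bigr => i _; rewrite !mxE mulrA. Qed.
Lemma betaZr (s : R) v w : beta v (s *: w) = s * beta v w.
Proof. by rewrite /beta mulr_sumr; apply: eq_bigr => i _; rewrite !mxE mulrCA. Qed.

Lemma chi_scale (s : R) v w : chi (s *: v) w = expi (s * (2 * pi * (beta w v - beta v w))).
Proof. by rewrite /chi betaZl betaZr -mulrBr mulrCA. Qed.

Lemma nsq_chi v w : nsq (chi v w) = 1. Proof. exact: nsq_expi. Qed.

Variables (n : nat) (g h : 'I_n -> E -> R[i]) (K : R).
Hypotheses (Lg : forall i, L2on leb (g i)) (Lh : forall i, L2on leb (h i)).
Hypothesis bh : forall i, bessel L K (h i).
Hypothesis expansion : forall f u, L2on leb f -> L2on leb u ->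
  ip f u = \sum_(j < n) lip (coef L (h j) f) (coef L (g j) u).
Hypothesis biorthogonal : forall i j k,
  coef L (h j) (g i) k = ((i == j) && (k == 0))%:R.

Let A a i j : Lam -> R[i] := coef L (h j) (dsh a (g i)).
Let p k : R[i] := expi (2 * pi * beta (lam L k) (lam L k)).
Let twisted a i j (c : Lam -> R[i]) : Lam -> R[i] :=
  fun k => (c k * p k * A a j i (- k))^*.

Let ellA a i j : ell2 (A a i j).
Proof. exact: (bh j (L2on_dsh a (Lg i))).1. Qed.

Let nsq_p k : nsq (p k) = 1. Proof. exact: nsq_expi. Qed.

Let pN k : p (- k) = p k.
Proof. by rewrite /p lamN betaNl betaNr opprK. Qed.

Let opp_bij : bijective (fun k : Lam => - k).
Proof. by exists (fun k => - k) => k; rewrite opprK. Qed.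

Let ell_twisted a i j c (M : R) : (forall k, nsq (c k) <= M) -> ell2 (twisted a i j c).
Proof.
move=> cM.
have M0 : 0 <= M by exact: le_trans (nsq_ge0 _) (cM 0).
have [lN _] := ell2_reindex opp_bij (ellA a j i).
have ls := ph_domZ HL (Num.sqrt M)%:C lN.
refine (proj1 (ell2_dominated ls _)) => k.
have -> : nsq (twisted a i j c k) = nsq (c k) * nsq (A a j i (- k)).
  by apply: etrans (nsqJ _) _; rewrite nsqM nsqM nsq_p mulr1.
have -> : nsq (scf (Num.sqrt M)%:C (fun k => A a j i (- k)) k) = M * nsq (A a j i (- k)).
  by rewrite /scf nsqM nsqC sqr_sqrtr.
by apply: ler_wpM2r; [exact: nsq_ge0|exact: cM].
Qed.

(** The quantity whose symmetry in [a] and [b] is tested. *)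
Definition twofold a b : R[i] := \sum_(i < n) ip (dsh b (dsh a (g i))) (h i).

(** Commuting [D_b] with the shift by [l] produces the character [chi b l] and
    the extra term [(chi b l - 1) <pi(l) g_j, h_i>], which biorthogonality
    kills: for [l = 0] the factor vanishes. *)
Let coef_adj b i j k : coef L (g j) (dsh_adj b (h i)) k = twisted b i j (fun k => chi b (lam L k)) k.
Proof.
have Lt := L2on_tf (lam L k) (Lg j); have La := L2on_dsh_adj b (Lh i).
have Ld := L2on_dsh b (Lg j); have Ltd := L2on_tf (lam L k) Ld.
rewrite /coef (ph_ipC H Lt La) -(dsh_adjP b Lt (Lh i)) dsh_tf; congr (_^*).
have L1 := ph_domZ H (chi b (lam L k)) Ltd.
have L2 := ph_domZ H (chi b (lam L k) - 1) Lt.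
rewrite (ph_ipD H L1 L2 (Lh i)) (ph_ipZ H _ Ltd (Lh i)) (ph_ipZ H _ Lt (Lh i)).
rewrite (cip_tf_adj _ Ld (Lh i)) (cip_tf_adj _ (Lg j) (Lh i)) -lamN.
rewrite -[ip (g j) _]/(coef L (h i) (g j) (- k)) biorthogonal oppr_eq0.
rewrite -[ip (dsh b (g j)) _]/(A b j i (- k)) -/(p k) mulrA.
have [->|k0] := eqVneq k 0; last by rewrite andbF mulr0 mulr0 addr0.
by rewrite /chi lam0 beta0l beta0r subrr mulr0 expi0 subrr mul0r addr0.
Qed.

Let twofoldE a b : twofold a b = \sum_(i < n) \sum_(j < n)
  lip (A a i j) (twisted b i j (fun k => chi b (lam L k))).
Proof.
apply: eq_bigr => i _.
rewrite (dsh_adjP b (L2on_dsh a (Lg i)) (Lh i)).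
rewrite (expansion (L2on_dsh a (Lg i)) (L2on_dsh_adj b (Lh i))).
apply: eq_bigr => j _; congr lip; apply: funext => k; exact: coef_adj.
Qed.

(** Renaming [i], [j] and [l] to [j], [i] and [- l] exchanges the two factors. *)
Let twofold_swap a b : twofold b a = \sum_(i < n) \sum_(j < n)
  lip (A a i j) (twisted b i j (fun k => chi a (lam L (- k)))).
Proof.
apply: etrans (twofoldE b a) _.
rewrite [LHS]exchange_big.
apply: eq_bigr => i _.
apply: eq_bigr => j _.
have lt : ell2 (twisted a j i (fun k => chi a (lam L k))).
  by apply: (@ell_twisted a j i _ 1) => k; rewrite nsq_chi.
rewrite -(lip_reindex opp_bij (ellA b j i) lt); apply: lip_congr => k.
rewrite /twisted opprK pN.
exact: swap_conj.
Qed.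

(** The difference of the characters that appear in [twofoldE] and
    [twofold_swap]; it tends to [0] pointwise as [a] and [b] do. *)
Let gap a b k : R[i] := chi b (lam L k) - chi a (lam L (- k)).

Let nsq_gap a b k : nsq (gap a b k) <= 4.
Proof.
apply: le_trans (nsqD_le _ _) _; rewrite nsqN !nsq_chi; lra.
Qed.

Let commutator a b : twofold a b - twofold b a =
  \sum_(i < n) \sum_(j < n) lip (A a i j) (twisted b i j (gap a b)).
Proof.
rewrite twofoldE twofold_swap -sumrB; apply: eq_bigr => i _.
rewrite -sumrB; apply: eq_bigr => j _.
have c1 k : nsq (chi b (lam L k)) <= 1 by rewrite nsq_chi.
have c2 k : nsq (chi a (lam L (- k))) <= 1 by rewrite nsq_chi.
rewrite -(ph_ipBr HL (ell_twisted b i j c1) (ell_twisted b i j c2) (ellA a i j)).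
congr lip; apply: funext => k.
have -> : (twisted b i j (fun k => chi b (lam L k)) - twisted b i j (fun k => chi a (lam L (- k)))) k
  = twisted b i j (fun k => chi b (lam L k)) k - twisted b i j (fun k => chi a (lam L (- k))) k by [].
rewrite /twisted /gap.
exact: conj_sub.
Qed.

(** All terms of the second differences cancel but the products of two
    shifts. *)
Let commutator_tf a b : twofold a b - twofold b a =
  (chi b a - 1) * \sum_(i < n) ip (tf a (tf b (g i))) (h i).
Proof.
rewrite -sumrB mulr_sumr; apply: eq_bigr => i _.
have Lab := L2on_tf a (L2on_tf b (Lg i)).
rewrite -(ph_ipB H (L2on_dsh b (L2on_dsh a (Lg i))) (L2on_dsh a (L2on_dsh b (Lg i))) (Lh i)).
refine (etrans (congr1 (fun f => ip f (h i)) _) (ph_ipZ H (chi b a - 1) Lab (Lh i))).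
rewrite scfBl scf1 -tf_comm /dsh !tfB.
by apply: funext => t; exact: second_difference.
Qed.

Variables (j0 : 'I_d) (G : 'I_n -> E -> R[i]).
Hypotheses (n0 : (0 < n)%N) (LG : forall i, L2on leb (G i)).
Hypothesis lipS : forall i, lipschitz_along (unit_shift j0) (g i).
Hypothesis lipM : forall i, lipschitz_along (unit_mod j0) (g i).
Hypothesis dG : forall i (e : R), 0 < e -> exists N, forall m, (N <= m)%N ->
  q (scf (m.+1%:R)%:C (dsh (m.+1%:R^-1 *: unit_mod j0) (g i)) - G i) < e.

Let eps (m : nat) : R := m.+1%:R^-1.
Let aa m := eps m *: unit_shift j0 : 'cV[R]_(d + d).
Let bb m := eps m *: unit_mod j0 : 'cV[R]_(d + d).
Let M m i j := twisted (bb m) i j (gap (aa m) (bb m)).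
Let Q m i j : R := m.+1%:R ^+ 2 * sqn lip (M m i j).
Let D m i := scf (m.+1%:R)%:C (dsh (bb m) (g i)).
Let mult m k : R[i] := gap (aa m) (bb m) k * p k.

Let eps_gt0 m : 0 < eps m. Proof. by rewrite /eps invr_gt0. Qed.
Let eps_le1 m : eps m <= 1. Proof. by rewrite /eps invf_le1// ler1n. Qed.
Let epsK m : m.+1%:R * eps m = 1. Proof. by rewrite /eps divff. Qed.

Let ellM m i j : ell2 (M m i j).
Proof. exact: (ell_twisted _ i j (nsq_gap (aa m) (bb m))). Qed.

Let nsq_mult m k : nsq (mult m k) <= 4.
Proof. by rewrite /mult nsqM nsq_p mulr1; exact: nsq_gap. Qed.

Let cvg_mult k : nsq (mult m k) @[m --> \oo] --> 0.
Proof.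
pose c1 : R := 2 * pi * (beta (lam L k) (unit_mod j0) - beta (unit_mod j0) (lam L k)).
pose c2 : R := 2 * pi * (beta (lam L (- k)) (unit_shift j0) - beta (unit_shift j0) (lam L (- k))).
have le m : nsq (mult m k) <= eps m * (2 * c1 ^+ 2 + 2 * c2 ^+ 2).
  have -> : nsq (mult m k) = nsq ((expi (eps m * c1) - 1) - (expi (eps m * c2) - 1)).
    rewrite /mult nsqM nsq_p mulr1 /gap /aa /bb !chi_scale -/c1 -/c2.
    by congr nsq; ring.
  apply: le_trans (nsqD_le _ _) _; rewrite nsqN.
  have h1 := nsq_expiB1 (eps m * c1); have h2 := nsq_expiB1 (eps m * c2).
  have e1 := eps_le1 m; have e0 := eps_gt0 m.
  have sq c : (eps m * c) ^+ 2 <= eps m * c ^+ 2.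
    by rewrite exprMn ler_wpM2r ?sqr_ge0// expr2 ler_piMr// ltW.
  exact: four_terms (le_trans h1 (sq c1)) (le_trans h2 (sq c2)).
apply: (@squeeze_cvgr _ _ _ _ (fun=> 0) (fun m => eps m * (2 * c1 ^+ 2 + 2 * c2 ^+ 2))).
- by near=> m; rewrite nsq_ge0 le.
- exact: cvg_cst.
- rewrite -[X in _ --> X](mul0r (2 * c1 ^+ 2 + 2 * c2 ^+ 2)).
  by apply: cvgM; [exact: cvg_harmonic|exact: cvg_cst].
Unshelve. all: by end_near.
Qed.

Let Q_ge0 m i j : 0 <= Q m i j.
Proof. by apply: mulr_ge0; [exact: sqr_ge0|exact: (sqn_ge0 HL (ellM m i j))]. Qed.

(** After division by the step, [D_b g_j] is replaced by its limit [G j]; the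
    error is controlled by the Bessel bound of [h_i]. *)
Let Q_le m i j : Q m i j <=
  2 * sqn lip (fun k => mult m k * coef L (h i) (G j) (- k)) + 8 * `|K| * q (D m j - G j).
Proof.
have LD : L2on leb (D m j) := ph_domZ H _ (L2on_dsh (bb m) (Lg j)).
have Lr := ph_domB H LD (LG j).
have [lG _] := bh i (LG j); have [lr Br] := bh i Lr.
have [lGN _] := ell2_reindex opp_bij lG; have [lrN EN] := ell2_reindex opp_bij lr.
have dom u : ell2 u -> ell2 (fun k => mult m k * u k) /\
    sqn lip (fun k => mult m k * u k) <= 4 * sqn lip u.
  move=> lu; have ls := ph_domZ HL (2%:R)%:C lu.
  have le k : nsq (mult m k * u k) <= nsq (scf (2%:R)%:C u k).
    have -> : nsq (mult m k * u k) = nsq (mult m k) * nsq (u k) by exact: nsqM.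
    have -> : nsq (scf (2%:R)%:C u k) = 4 * nsq (u k).
      by rewrite /scf nsqM nsqC -natrX.
    by apply: ler_wpM2r; [exact: nsq_ge0|exact: nsq_mult].
  have [l1 l2] := ell2_dominated ls le; split; first exact: l1.
  apply: le_trans l2 _; rewrite (sqnZ HL _ lu) nsqC -natrX; exact: lexx.
have [lU _] := dom _ lGN; have [lV leV] := dom _ lrN.
have -> : Q m i j = sqn lip (scf (m.+1%:R)%:C (M m i j)).
  by rewrite (sqnZ HL _ (ellM m i j)) nsqC.
have FE k : nsq (scf (m.+1%:R)%:C (M m i j) k) =
    nsq (((fun k => mult m k * coef L (h i) (G j) (- k)) +
          (fun k => mult m k * coef L (h i) (D m j - G j) (- k))) k).
  have e1 : coef L (h i) (D m j) (- k) = (m.+1%:R)%:C * A (bb m) j i (- k) :=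
    congr1 (fun u => u (- k)) (coefZl L (m.+1%:R)%:C (Lh i) (L2on_dsh (bb m) (Lg j))).
  have e2 : coef L (h i) (D m j - G j) (- k) =
      coef L (h i) (D m j) (- k) - coef L (h i) (G j) (- k) :=
    congr1 (fun u => u (- k)) (coefBl L (Lh i) LD (LG j)).
  exact: recombine e1 e2.
have lS := ph_domD HL lU lV.
have [_ ->] := ell2_nsq_eq FE lS.
apply: le_trans (sqnD_le HL lU lV) _; apply: lerD; first exact: lexx.
have Br' : sqn lip (coef L (h i) (D m j - G j)) <= `|K| * q (D m j - G j).
  apply: le_trans Br _; apply: ler_wpM2r; [exact: (sqn_ge0 H Lr)|exact: ler_norm].
rewrite EN in leV; exact: eight_bound leV Br'.
Qed.

Let cvg_Q i j : Q m i j @[m --> \oo] --> 0.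
Proof.
apply/cvgrPdist_lt => e e0.
have [lG _] := bh i (LG j); have [lGN _] := ell2_reindex opp_bij lG.
have e4 : 0 < e / 4 by rewrite divr_gt0.
have [N1 H1] := ell2_dct lGN nsq_mult cvg_mult e4.
have K1 : 0 < 16 * `|K| + 1 by rewrite ltr_wpDl// mulr_ge0.
have [N2 H2] := dG j (divr_gt0 e0 K1).
exists (maxn N1 N2) => // m /=; rewrite geq_max => /andP[m1 m2].
rewrite sub0r normrN (ger0_norm (Q_ge0 m i j)); apply: le_lt_trans (Q_le m i j) _.
have h1 := H1 m m1; have h2 := H2 m m2.
have LD : L2on leb (D m j) := ph_domZ H _ (L2on_dsh (bb m) (Lg j)).
have q0 := sqn_ge0 H (ph_domB H LD (LG j)).
exact: small_sum h1 h2 q0 (normr_ge0 K).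
Qed.

Let Z m : R[i] := ((m.+1%:R) ^+ 2)%:C * (twofold (aa m) (bb m) - twofold (bb m) (aa m)).

(** One factor of each product is [O(s)] because [g_i] is Lipschitz along
    translations, the other is [o(s)] by [cvg_Q]. *)
Let cvg_Z : nsq (Z m) @[m --> \oo] --> 0.
Proof.
have [C CP] : exists C : 'I_n -> R, forall i, 0 <= C i /\
    forall m, q (dsh (aa m) (g i)) <= C i * eps m ^+ 2.
  have := fun i => lipS i; move=> lS.
  have /choice[C CP] : forall i, exists C, 0 <= C /\ forall s, q (dsh (s *: unit_shift j0) (g i)) <= C * s ^+ 2.
    by move=> i; have [C C0 CP] := lS i; exists C.
  by exists C => i; have [C0 hC] := CP i; split=> // m; exact: hC.
pose B m := 2 ^+ n * \sum_(i < n) (2 ^+ n * \sum_(j < n) (`|K| * C i * Q m i j)).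
have le m : nsq (Z m) <= B m.
  rewrite /Z commutator nsqM nsqC.
  apply: le_trans (ler_wpM2l (sqr_ge0 _) (nsq_sum_le _)) _.
  rewrite mulrCA ler_wpM2l ?exprn_ge0// mulr_sumr; apply: ler_sum => i _.
  apply: le_trans (ler_wpM2l (sqr_ge0 _) (nsq_sum_le _)) _.
  rewrite mulrCA ler_wpM2l ?exprn_ge0// mulr_sumr; apply: ler_sum => j _.
  apply: le_trans (ler_wpM2l (sqr_ge0 _) (cauchy_schwarz HL (ellA (aa m) i j) (ellM m i j))) _.
  have [C0 hC] := CP i.
  have Ld := L2on_dsh (aa m) (Lg i).
  have hA : sqn lip (A (aa m) i j) <= `|K| * C i * eps m ^+ 2.
    apply: le_trans (bh j Ld).2 _.
    apply: le_trans (ler_wpM2r (sqn_ge0 H Ld) (ler_norm K)) _.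
    by rewrite -mulrA; apply: ler_wpM2l; [exact: normr_ge0|exact: hC].
  exact: rescale (epsK m) hA (sqn_ge0 HL (ellM m i j)).
apply: (@squeeze_cvgr _ _ _ _ (fun=> 0) B).
- by near=> m; apply/andP; split; [exact: nsq_ge0|exact: le].
- exact: cvg_cst.
- have -> : 0 = 2 ^+ n * \sum_(i < n) (2 ^+ n * \sum_(j < n) (`|K| * C i * 0)) :> R.
    by rewrite big1 ?mulr0// => i _; rewrite big1 ?mulr0// => j _; rewrite mulr0.
  apply: cvgM; first exact: cvg_cst.
  apply: cvg_big => [|i _]; first exact: add_continuous.
  apply: cvgM; first exact: cvg_cst.
  apply: cvg_big => [|j _]; first exact: add_continuous.
  by apply: cvgM; [exact: cvg_cst|exact: cvg_Q].
Unshelve. all: by end_near.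
Qed.

Let beta_canonical m : beta (aa m) (bb m) - beta (bb m) (aa m) = eps m ^+ 2.
Proof.
rewrite /aa /bb !(betaZl, betaZr).
have -> : beta (unit_shift j0) (unit_mod j0) = 1 :> R.
  rewrite /beta (bigD1 j0)//= big1 => [|i ij]; rewrite !mxE.
    by rewrite !eqxx mulr1 addr0.
  by rewrite (inj_eq (@lshift_inj _ _)) (negPf ij) mul0r.
have -> : beta (unit_mod j0) (unit_shift j0) = 0 :> R.
  by rewrite /beta big1// => i _; rewrite !mxE eq_lrshift mul0r.
by rewrite !mulr0 subr0 mulr1.
Qed.

Let S m := \sum_(i < n) ip (tf (aa m) (tf (bb m) (g i))) (h i).

(** As the steps tend to [0], [S] tends to [sum_i <g_i,h_i> = n]. *)
Let S_near : exists2 c, 0 <= c & forall m, nsq (S m - n%:R) <= c * eps m.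
Proof.
have /choice[C CP] : forall i, exists C, 0 <= C /\
    forall m, q (tf (aa m) (tf (bb m) (g i)) - g i) <= C * eps m.
  move=> i; have [C1 C10 H1] := lipS i; have [C2 C20 H2] := lipM i.
  exists (2 * C1 + 2 * C2); split; first by rewrite addr_ge0// mulr_ge0.
  move=> m; have L1 := L2on_dsh (bb m) (Lg i); have L2 := L2on_dsh (aa m) (Lg i).
  have -> : tf (aa m) (tf (bb m) (g i)) - g i = tf (aa m) (dsh (bb m) (g i)) + dsh (aa m) (g i).
    by rewrite /dsh tfB addrA subrK.
  apply: le_trans (sqnD_le H (L2on_tf (aa m) L1) L2) _.
  rewrite (sqn_tf (aa m) L1).
  exact: two_squares (H2 (eps m)) (H1 (eps m)) C10 C20 (ltW (eps_gt0 m)) (eps_le1 m).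
exists (2 ^+ n * \sum_(i < n) (C i * q (h i))).
  rewrite mulr_ge0 ?exprn_ge0//; apply: sumr_ge0 => i _.
  by rewrite mulr_ge0 ?(CP i).1//; exact: (sqn_ge0 H (Lh i)).
move=> m; have -> : S m - n%:R = \sum_(i < n) ip (tf (aa m) (tf (bb m) (g i)) - g i) (h i).
  rewrite /S -[X in X%:R](card_ord n) -sum1_card natr_sum -sumrB; apply: eq_bigr => i _.
  rewrite (ph_ipB H (L2on_tf _ (L2on_tf _ (Lg i))) (Lg i) (Lh i)); congr (_ - _).
  have := biorthogonal i i 0; rewrite /coef lam0 tf0 !eqxx => ->.
  by [].
apply: le_trans (nsq_sum_le _) _; rewrite -mulrA; apply: ler_wpM2l; first exact: exprn_ge0.
rewrite mulr_suml; apply: ler_sum => i _.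
have Ld := ph_domB H (L2on_tf (aa m) (L2on_tf (bb m) (Lg i))) (Lg i).
apply: le_trans (cauchy_schwarz H Ld (Lh i)) _.
by rewrite mulrAC; apply: ler_wpM2r; [exact: (sqn_ge0 H (Lh i))|exact: (CP i).2].
Qed.

Theorem no_biorthogonal_frame : False.
Proof.
have [c c0 cP] := S_near.
have ec (r : R) : eps m * r @[m --> \oo] --> 0.
  rewrite -[X in _ --> X](mul0r r).
  by apply: cvgM; [exact: cvg_harmonic|exact: cvg_cst].
have small (u : nat -> R) (e : R) : 0 < e -> u @ \oo --> 0 -> exists N, forall m, (N <= m)%N -> u m < e.
  move=> e0 /cvgrPdist_lt/(_ _ e0)[N _ NP]; exists N => m Nm.
  by have := NP m Nm; rewrite sub0r normrN; exact: le_lt_trans (ler_norm _).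
have q4 : 0 < 4^-1 :> R by rewrite invr_gt0.
have [N1 P1] := small _ _ q4 (ec c).
have [N2 P2] := small _ _ q4 (ec (2 * pi)).
have [N3 P3] := small _ _ ltr01 cvg_Z.
pose m := maxn N1 (maxn N2 N3).
have m1 : (N1 <= m)%N by rewrite leq_maxl.
have m2 : (N2 <= m)%N by rewrite leq_max leq_maxl orbT.
have m3 : (N3 <= m)%N by rewrite leq_max leq_maxr orbT.
have hS : 4^-1 <= nsq (S m).
  have hn : 1 <= nsq (n%:R : R[i]).
    have -> : n%:R = (n%:R)%:C :> R[i] by rewrite rmorph_nat.
    by rewrite nsqC exprn_ege1// ler1n.
  have hc : c * eps m < 4^-1 by rewrite mulrC; exact: P1.
  exact: quarter_bound hn hc (cP m) (nsqBC (S m) n%:R).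
have hX : 4 <= (m.+1%:R ^+ 2) ^+ 2 * nsq (chi (bb m) (aa m) - 1).
  rewrite /chi beta_canonical.
  have hd := nsq_expiB1_deriv (2 * pi * eps m ^+ 2).
  have hp := P2 m m2.
  exact: chirp_bound (epsK m) (ltW (eps_gt0 m)) (eps_le1 m) (pi_ge2 R) hp hd.
have := P3 m m3; rewrite /Z commutator_tf nsqM nsqC nsqM -/(S m) mulrA.
apply/negP; rewrite -leNgt; exact: product_bound hX hS.
Qed.

End battle.

(** * Reduction to regular windows and the theorem *)

Lemma product_small (R : realType) (x y e : R) : x < e / (y + 1) -> 0 <= x -> 0 <= y ->
  y * x < e.
Proof.
move=> xe x0 y0; have y1 : 0 < y + 1 by rewrite ltr_wpDl.
rewrite ltr_pdivlMr// in xe; nra.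
Qed.

Lemma sub_cancel (R : realType) (x y z : R[i]) : x - y = x - z - (y - z).
Proof. ring. Qed.

Lemma sub_sub (R : realType) (x y : R[i]) : y = x - (x - y).
Proof. ring. Qed.

Lemma sum_le2 (R : realType) n (a b c : 'I_n -> R) :
  (forall i, a i <= 2 * b i + 2 * c i) ->
  \sum_(i < n) a i <= 2 * \sum_(i < n) b i + 2 * \sum_(i < n) c i.
Proof. by move=> h; rewrite !mulr_sumr -big_split/=; apply: ler_sum => i _; exact: h. Qed.

Lemma lower_bound (R : realType) (a x s t r : R) : a * x <= s -> s <= 2 * t + 2 * r ->
  r <= a / 4 * x -> a / 4 * x <= t.
Proof. lra. Qed.

Lemma upper_bound (R : realType) (a b x s t r : R) : s <= b * x -> t <= 2 * s + 2 * r ->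
  r <= a / 4 * x -> t <= (2 * b + a / 2) * x.
Proof. lra. Qed.

#[local] Opaque nsq cip lip gaussian tf tfshift.

Section reduction.
Context {R : realType} {d : nat}.
Variable L : 'M[R]_(d + d).
Local Notation E := (Euclidean R d).
Local Notation leb := (lebesgue_Euclidean R d).
Local Notation ip := (cip leb).
Local Notation q := (sqn ip).
Local Notation Lam := 'cV[int]_(d + d).
Implicit Types (k : Lam) (f g u : E -> R[i]).
Let H := cip_prehilbert leb.
Let HL := @lip_prehilbert R Lam.

Lemma gabor_sum_le g f (K : R) : L2on leb f -> (gabor_sum L g f <= (K * q f)%:E)%E ->
  ell2 (coef L g f) /\ sqn lip (coef L g f) <= K * q f.
Proof.
rewrite gabor_sumE => Lf h.
have lg : ell2 (coef L g f) by apply/ell2E; apply: le_lt_trans h _; exact: ltry.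
by split; [exact: lg|rewrite -lee_fin (sqn_lip lg)].
Qed.

(** The Heisenberg norm is an infimum of square roots of Bessel bounds. *)
Lemma heisenberg_norm_bessel g (e : R) : 0 < e -> (heisenberg_norm L g < e%:E)%E ->
  bessel L (e ^+ 2) g.
Proof.
move=> e0 /ereal_inf_lt[_ [B [B0 hB] <-]]; rewrite lte_fin => Be f Lf.
apply: gabor_sum_le => //; apply: le_trans (hB f ((L2E f).2 Lf)) _.
rewrite (L2norm_sqn Lf) -EFinM lee_fin; apply: ler_wpM2r; first exact: (sqn_ge0 H Lf).
rewrite -[leLHS](sqr_sqrtr (ltW B0)); apply: ltW.
by rewrite ltr_pXn2r// nnegrE ?sqrtr_ge0// ltW.
Qed.

Lemma coef_continuous (u : nat -> E -> R[i]) g f k : L2on leb f -> L2on leb g ->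
  (forall j, L2on leb (u j)) -> (fun j => L2norm (u j \- g)) @ \oo --> 0%E ->
  nsq (coef L (u j) f k - coef L g f k) @[j --> \oo] --> 0.
Proof.
move=> Lf Lg Lu ug; apply/cvgrPdist_lt => e e0.
have qf := sqn_ge0 H Lf.
(* The 1 avoids dividing by zero when f is null. *)
pose s := Num.sqrt (e / (q f + 1)).
have s0 : 0 < s by rewrite sqrtr_gt0 divr_gt0// ltr_wpDl.
have [N NP] := cvge0_small ug s0.
exists N => // j /= Nj; rewrite sub0r normrN (ger0_norm (nsq_ge0 _)).
have Ld := ph_domB H (Lu j) Lg.
have qd : q (u j - g) < e / (q f + 1).
  have hN : (L2norm (u j - g)%R < s%:E)%E := NP j Nj.
  have n0 : (0 <= L2norm (u j - g)%R)%E by exact: Lnorm_ge0.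
  have := L2norm_sqn Ld; move: n0 hN.
  case: (L2norm _) => [r r0 rs rE|//|//].
  rewrite -lte_fin -rE -EFin_expe lte_fin -[ltRHS]sqr_sqrtr; last first.
    by rewrite divr_ge0 ?(ltW e0)// addr_ge0.
  by rewrite ltr_pXn2r ?nnegrE ?(ltW s0) -?lee_fin -?lte_fin.
have Lt := L2on_tf (lam L k) Ld.
have -> : coef L (u j) f k - coef L g f k = ip f (tf (lam L k) (u j - g)).
  by rewrite tfB (ph_ipBr H (L2on_tf _ (Lu j)) (L2on_tf _ Lg) Lf).
apply: le_lt_trans (cauchy_schwarz H Lf Lt) _; rewrite (sqn_tf _ Ld).
exact: product_small qd (sqn_ge0 H Ld) qf.
Qed.

(** The Bessel bounds of [u_j - u_N] are small along the approximating Cauchy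
    sequence; Fatou's lemma for the sum of the squared coefficients transfers
    the bound to the limit of [u_j]. *)
Lemma module_approximation g (e : R) : 0 < e -> heisenberg_module L g ->
  exists2 u, M1 u & bessel L (e ^+ 2) (g - u).
Proof.
move=> e0 [/L2E Lg [u [Mu Cu ug]]].
have Lu j : L2on leb (u j) by have [/L2E] := Mu j.
have [N NP] := Cu e e0; exists (u N); first exact: Mu.
have bu j : (N <= j)%N -> bessel L (e ^+ 2) (u j - u N).
  by move=> Nj; apply: heisenberg_norm_bessel => //; exact: NP.
move=> f Lf; apply: gabor_sum_le => //; rewrite gabor_sumE -integral_lseq.
have Lgu := ph_domB H Lg (Lu N).
apply: (fatou_le (N := N) (f_ := fun j m => (nsq (lseq (coef L (u j - u N) f) m))%:E)).
- by [].
- by move=> j m; exact: ensq_ge0.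
- move=> m; rewrite /lseq; case: pickle_inv => [k|] /=; last exact: cvg_cst.
  apply: cvg_nsq_of_dist.
  have := coef_continuous k Lf Lg Lu ug.
  rewrite (_ : (fun j => nsq (coef L (u j) f k - coef L g f k)) =
    (fun j => nsq (coef L (u j - u N) f k - coef L (g - u N) f k))) => [//|].
  apply: funext => j; congr nsq.
  rewrite (coefBr L (Lu j) Lf (Lu N)) (coefBr L Lg Lf (Lu N)).
  exact: sub_cancel.
- move=> j Nj; have [lu le] := bu j Nj f Lf.
  by rewrite integral_lseq -(sqn_lip lu) lee_fin.
Qed.

(** By [|a|^2 <= 2 |b|^2 + 2 |a - b|^2] for coefficient families; the bound
    [e^2 n = A / 4] leaves a quarter of the lower frame bound. *)
Lemma frame_perturbation n (g : 'I_n -> E -> R[i]) : (0 < n)%N ->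
  (forall i, heisenberg_module L (g i)) -> multiwindow_gabor_frame L g ->
  exists (u : 'I_n -> E -> R[i]) (A B : R), [/\ 0 < A, forall i, M1 (u i),
    forall i f, L2on leb f -> ell2 (coef L (u i) f),
    forall f, L2on leb f -> A * q f <= \sum_(i < n) sqn lip (coef L (u i) f)
  & forall f, L2on leb f -> \sum_(i < n) sqn lip (coef L (u i) f) <= B * q f].
Proof.
move=> n0 hg [A [B [A0 B0 fr]]].
have n1 : 0 < n%:R :> R by rewrite ltr0n.
have Lg i : L2on leb (g i) by have [/L2E] := hg i.
have lg i f : L2on leb f -> ell2 (coef L (g i) f).
  move=> Lf; have [_ h] := fr f ((L2E f).2 Lf).
  apply/ell2E; rewrite -gabor_sumE; apply: (@le_lt_trans _ _ (B%:E * L2norm f ^+ 2)%E).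
    apply: le_trans h; rewrite (bigD1 i)//=; apply: leeDl.
    by apply: sume_ge0 => j _; apply: esum_ge0 => k _; rewrite lee_fin sqr_ge0.
  by rewrite (L2norm_sqn Lf) -EFinM ltry.
have sumE f : L2on leb f ->
    (\sum_(i < n) gabor_sum L (g i) f = (\sum_(i < n) sqn lip (coef L (g i) f))%:E)%E.
  move=> Lf; rewrite -sumEFin; apply: eq_bigr => i _.
  by rewrite gabor_sumE (sqn_lip (lg i f Lf)).
(* Each of the n perturbations may use a Bessel bound of A / (4 n). *)
pose e := Num.sqrt (A / (4 * n%:R)).
have e0 : 0 < e by rewrite sqrtr_gt0 divr_gt0// mulr_gt0.
have e2 : e ^+ 2 * n%:R = A / 4.
  rewrite sqr_sqrtr ?divr_ge0 ?mulr_ge0// ?(ltW A0)//.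
  by field; rewrite gt_eqF.
have /choice[u uP] : forall i, exists u, M1 u /\ bessel L (e ^+ 2) (g i - u).
  by move=> i; have [u Mu bu] := module_approximation e0 (hg i); exists u.
have Lu i : L2on leb (u i) by have [[/L2E]] := uP i.
have ld i f : L2on leb f -> ell2 (coef L (g i - u i) f) by move=> Lf; have [_ /(_ f Lf)[]] := uP i.
have coefu i f : L2on leb f -> coef L (u i) f = coef L (g i) f - coef L (g i - u i) f.
  move=> Lf; rewrite -(coefBr L (Lg i) Lf (ph_domB H (Lg i) (Lu i))).
  by congr (coef L _ f); apply: funext => t; exact: sub_sub.
have lu i f : L2on leb f -> ell2 (coef L (u i) f).
  by move=> Lf; rewrite (coefu i f Lf); exact: (ph_domB HL (lg i f Lf) (ld i f Lf)).
have defect f : L2on leb f -> \sum_(i < n) sqn lip (coef L (g i - u i) f) <= A / 4 * q f.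
  move=> Lf; rewrite -e2 mulrAC -[X in _ * X%:R]card_ord -sum1_card natr_sum mulr_sumr.
  by apply: ler_sum => i _; rewrite mulr1; have [_ /(_ f Lf)[]] := uP i.
exists u, (A / 4), (2 * B + A / 2); split.
- by rewrite divr_gt0.
- by move=> i; have [] := uP i.
- exact: lu.
- move=> f Lf; have [lo _] := fr f ((L2E f).2 Lf).
  rewrite (L2norm_sqn Lf) (sumE f Lf) -EFinM lee_fin in lo.
  have le : \sum_(i < n) sqn lip (coef L (g i) f) <=
      2 * \sum_(i < n) sqn lip (coef L (u i) f) + 2 * \sum_(i < n) sqn lip (coef L (g i - u i) f).
    apply: sum_le2 => i.
    have e1 : coef L (g i) f = coef L (u i) f + coef L (g i - u i) f by rewrite (coefu i f Lf) subrK.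
    exact: (eq_ind_r (fun a => sqn lip a <= _) (sqnD_le HL (lu i f Lf) (ld i f Lf)) e1).
  exact: lower_bound lo le (defect f Lf).
- move=> f Lf; have [_ up] := fr f ((L2E f).2 Lf).
  rewrite (L2norm_sqn Lf) (sumE f Lf) -EFinM lee_fin in up.
  have le : \sum_(i < n) sqn lip (coef L (u i) f) <=
      2 * \sum_(i < n) sqn lip (coef L (g i) f) + 2 * \sum_(i < n) sqn lip (coef L (g i - u i) f).
    apply: sum_le2 => i.
    exact: (eq_ind_r (fun a => sqn lip a <= _) (sqnB_le HL (lg i f Lf) (ld i f Lf)) (coefu i f Lf)).
  exact: upper_bound up le (defect f Lf).
Qed.

End reduction.

Theorem corollary3p39 (R : realType) (d n : nat) (L0 : 'M[R]_(d + d))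
    (g : 'I_n -> Euclidean R d -> R[i]) :
  (1 <= d)%N -> (1 <= n)%N ->
  L0 \in unitmx -> `|\det L0| = n%:R ->
  (forall i, heisenberg_module L0 (g i)) ->
  ~ multiwindow_gabor_frame L0 g.
Proof.
move=> d1 n1 _ detL hg fr; have H := cip_prehilbert (lebesgue_Euclidean R d).
have [u [A [B [A0 Mu lu lo up]]]] := frame_perturbation n1 hg fr.
have Lu i : L2on (lebesgue_Euclidean R d) (u i) by have [/L2E] := Mu i.
have bu i : bessel L0 B (u i).
  move=> f Lf; split; first exact: (lu i f Lf).
  apply: le_trans (up f Lf); rewrite (bigD1 i)//= lerDl; apply: sumr_ge0 => j _.
  exact: (sqn_ge0 lip_prehilbert (lu j f Lf)).
have [h [Lh [Kh bh] ex diag]] := dual_frame A0 Lu lu lo up.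
have bi := biorthogonality n1 detL Lu Lh bu bh ex diag.
pose j0 := Ordinal d1.
have lS i : lipschitz_along (unit_shift j0) (u i).
  apply: M1_lipschitz (Mu i); last exact: gaussian_lipschitz_shift.
  by move=> k; rewrite mxE; case: (_ && _); rewrite ?normr1 ?normr0.
have lM i : lipschitz_along (unit_mod j0) (u i).
  apply: M1_lipschitz (Mu i); last exact: gaussian_lipschitz_mod.
  by move=> k; rewrite mxE; case: (_ && _); rewrite ?normr1 ?normr0.
have /choice[G GP] : forall i, exists G, L2on (lebesgue_Euclidean R d) G /\
    forall e : R, 0 < e -> exists N, forall m, (N <= m)%N ->
      sqn (cip (lebesgue_Euclidean R d))
        (scf (m.+1%:R)%:C (dsh (m.+1%:R^-1 *: unit_mod j0) (u i)) - G) < e.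
  by move=> i; have [G LG GP] := modulation_derivative (Lu i) (lM i); exists G.
exact: (no_biorthogonal_frame Lu Lh bh ex bi n1 (fun i => (GP i).1) lS lM (fun i => (GP i).2)).
Qed.
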